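(* Let $M(z)$ be a function holomorphic outside some closed bounded subset $\mathcal{D}$ of the closed upper half-plane. The following statements are equivalent: (i) $M(z)$ is the Weyl function of some bounded prime dissipative operator with a rank one imaginary part. (ii) (a) $M(z)$ has the asymptotic expansion at infinity $$M(z)=-\frac1z-\frac{b}{z^2}+O\left(\frac1{z^3}\right)\quad\text{with }\operatorname{Im}b>0;\qquad(\ast)$$ (b) the function $W(z)=1-2i\,\operatorname{Im}b\,M(z)$ is the characteristic function of some bounded dissipative operator with a rank one imaginary part. (iii) (a) $M(z)$ has the expansion $(\ast)$ at infinity; (b) the function $$\mathcal{K}(z,\xi)=\frac{M(z)-\overline{M(\xi)}+2i\,\operatorname{Im}b\;M(z)\overline{M(\xi)}}{z-\overline{\xi}}$$ is a nonnegative kernel. (iv) (a) $M(z)$ has the expansion $(\ast)$ at infinity; (b) the function $$Q(z)=\frac{i\,M(z)}{i+\operatorname{Im}b\;M(z)}$$ has an analytic continuation onto the outside of some bounded interval of the real axis as a Herglotz–Nevanlinna function. (v) (a) $M(z)$ has the expansion $(\ast)$ at infinity; (b) the function $$\mathfrak{M}(z)=-\frac{1}{M(z)}+b$$ has an analytic continuation onto the outside of some bounded interval of the real axis as a Herglotz–Nevanlinna function.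
   Context: For a bounded operator $A$ in a separable complex Hilbert space put $A_I=\frac{A-A^*}{2i}$. $A$ is dissipative if $A_I\ge0$, has a rank one imaginary part if $\operatorname{rank}A_I=1$, and is prime if there is no nonzero reducing subspace of $A$ on which $A$ is self-adjoint. $\rho(A)$ is the resolvent set. Weyl function: if $A$ is a prime dissipative operator with a rank one imaginary part and $e\in\operatorname{ran}(A-A^* )$, $\|e\|=1$, the Weyl function of $A$ is $m_A(z)=((A-zI)^{-1}e,e)$, $z\in\rho(A)$ (independent of the choice of $e$). Characteristic function: if $A$ is a bounded dissipative operator with a rank one imaginary part and $g$ is a vector with $2A_Ih=(h,g)g$ for all $h$, the characteristic function of $A$ is $W(z)=1-i((A-zI)^{-1}g,g)$, $z\in\rho(A)$. Saying that a function given on $\mathbb{C}\setminus\mathcal{D}$ ''is'' the Weyl or characteristic function of $A$ means that they coincide on $(\mathbb{C}\setminus\mathcal{D})\cap\rho(A)$. Nonnegative kernel: $G(z,\xi)$ is a nonnegative kernel if $\sum_{i,j=1}^N\lambda_i\overline{\lambda_j}\,G(z_j,z_i)\ge0$ for all $N\ge1$, all points $z_1,\ldots,z_N$ of the domain of the function (for which the expressions are defined), and all $(\lambda_1,\ldots,\lambda_N)\in\mathbb{C}^N$. Herglotz–Nevanlinna function: a function $V$ holomorphic on $\mathbb{C}\setminus\mathbb{R}$ with $V(z)=\overline{V(\bar z)}$ and $\frac{V(z)-\overline{V(z)}}{z-\bar z}\ge0$ for non-real $z$. *)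

(* Defs.v *)
From HB Require Import structures.
From mathcomp Require Import all_boot all_order all_algebra.
From mathcomp Require Import all_classical all_reals all_analysis.
From mathcomp Require Import sesquilinear complex.

Set Implicit Arguments.
Unset Strict Implicit.
Unset Printing Implicit Defensive.

Import Order.TTheory GRing.Theory Num.Theory.
Import numFieldNormedType.Exports.

Local Open Scope classical_set_scope.
Local Open Scope ring_scope.

(* Throughout, ['i], ['Re z], ['Im z] and [z^*] are the generic notations of
   [numClosedFieldType], so that ['Re z] and ['Im z] are [R[i]]-valued.
   An inequality [x <= y] in [R[i]] says that [y - x] is real and nonnegative. *)

HB.instance Definition _ (R : realType) := NormedModule.copy R[i] R[i]^o.

(* The inner product is linear in its first argument and conjugate-linear in
   the second one. *)
HB.mixin Record isHilbert (R : realType) H & CompleteNormedModule R[i] H := {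
  inner : {dot H for Num.conj};
  inner_norm : forall x : H, `|x| ^+ 2 = inner x x
}.

#[short(type="hilbertType")]
HB.structure Definition Hilbert (R : realType) :=
  { H of CompleteNormedModule R[i] H & isHilbert R H }.

Definition separable (T : topologicalType) : Prop :=
  exists2 S : set T, countable S & dense S.

Section Operators.
Context {R : realType} {H : hilbertType R}.
Implicit Types (A B T : H -> H) (S : set H) (x y e g : H) (z : R[i]).

Definition bounded_operator T : Prop :=
  exists K : R, forall x, `|T x| <= (K%:C)%C * `|x|.

(* By the Riesz theorem the chosen vector is the unique one satisfying the
   condition when [A] is linear and bounded; [0] is a dummy value otherwise. *)
Definition adjoint A : H -> H :=
  fun y => xget 0 [set y' | forall x, inner (A x) y = inner x y'].

Definition imag_part A : H -> H :=
  fun x => (2%:R * 'i)^-1 *: (A x - adjoint A x).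

Definition dissipative A : Prop := forall x, 0 <= inner (imag_part A x) x.

Definition rank_one T : Prop :=
  exists2 g, g != 0 & range T = [set c *: g | c in [set: R[i]]].

Definition orthogonal_complement S : set H :=
  [set y | forall x, S x -> inner x y = 0].

Definition closed_subspace S : Prop :=
  [/\ closed S, S 0 & forall (a : R[i]) x y, S x -> S y -> S (a *: x + y)].

Definition invariant_subspace A S : Prop := forall x, S x -> S (A x).

Definition reducing_subspace A S : Prop :=
  [/\ closed_subspace S, invariant_subspace A S &
      invariant_subspace A (orthogonal_complement S)].

Definition self_adjoint_on A S : Prop :=
  forall x y, S x -> S y -> inner (A x) y = inner x (A y).

Definition prime_operator A : Prop :=
  ~ exists S, [/\ reducing_subspace A S, S <> [set 0] & self_adjoint_on A S].

Definition resolvent_set A : set R[i] :=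
  [set z | exists B : {linear H -> H},
     [/\ bounded_operator B, cancel (fun x => A x - z *: x) B &
         cancel B (fun x => A x - z *: x)]].

(* Meaningful for [z] in the resolvent set, where the vector [x] is unique. *)
Definition resolvent A z : H -> H :=
  fun y => xget 0 [set x | A x - z *: x = y].

Definition weyl_function A e : R[i] -> R[i] :=
  fun z => inner (resolvent A z e) e.

Definition char_function A g : R[i] -> R[i] :=
  fun z => 1 - 'i * inner (resolvent A z g) g.

(* [U] is the set on which [M] (resp. [W]) is given. *)
Definition is_weyl_function (U : set R[i]) (M : R[i] -> R[i]) A : Prop :=
  exists e, [/\ exists x, e = A x - adjoint A x, `|e| = 1 &
    forall z, U z -> resolvent_set A z -> M z = weyl_function A e z].

Definition is_char_function (U : set R[i]) (W : R[i] -> R[i]) A : Prop :=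
  exists2 g, (forall x, 2%:R *: imag_part A x = inner x g *: g) &
    forall z, U z -> resolvent_set A z -> W z = char_function A g z.

End Operators.

Section Functions.
Context {R : realType}.
Implicit Types (U : set R[i]) (f M V : R[i] -> R[i]).

(* To be used with an open set [U]; the derivative is taken over the field
   [R[i]]. *)
Definition holomorphic_on U f : Prop := forall z, U z -> derivable f z 1.

(* M(z) = - 1/z - b/z^2 + O(1/z^3) at infinity. *)
Definition expansion_at_infinity M (b : R[i]) : Prop :=
  exists K r : R, forall z : R[i], (r%:C)%C < `|z| ->
    `|M z - (- z^-1 - b / z ^+ 2)| <= (K%:C)%C / `|z| ^+ 3.

(* [U] is the set of pairs (z, xi) for which [G z xi] is defined. *)
Definition nonnegative_kernel (U : set (R[i] * R[i]))
    (G : R[i] -> R[i] -> R[i]) : Prop :=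
  forall (N : nat) (z lambda : 'I_N -> R[i]), (0 < N)%N ->
    (forall i j, U (z j, z i)) ->
    0 <= \sum_(i < N) \sum_(j < N) lambda i * (lambda j)^* * G (z j) (z i).

Definition herglotz_nevanlinna V : Prop :=
  [/\ holomorphic_on [set z | 'Im z != 0] V,
      forall z : R[i], 'Im z != 0 -> V z = (V (z^*))^* &
      forall z : R[i], 'Im z != 0 -> 0 <= (V z - (V z)^*) / (z - z^*)].

Definition real_segment (c d : R) : set R[i] := [set (t%:C)%C | t in `[c, d]].

(* The function [f], given by an expression that makes sense on [dom], where
   the data entering it live on [U], continues to a Herglotz-Nevanlinna
   function [V] holomorphic off a bounded real segment. At every point of [U]
   off the segment the expression [f] has to make sense and to equal [V]. If [U]
   is connected and [dom] omits only zeros of a denominator which is not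
   identically zero, [dom z] is automatic there, since such a point would be a
   pole of [f]; when [U] has bounded components it rules out a denominator
   vanishing identically on one of them. *)
Definition has_HN_continuation U (dom : set R[i]) f : Prop :=
  exists (c d : R) (V : R[i] -> R[i]),
    [/\ c <= d, herglotz_nevanlinna V,
        holomorphic_on (~` real_segment c d) V &
        forall z, U z -> ~ real_segment c d z -> dom z /\ V z = f z].

End Functions.

(* Main.v *)
Require Import Defs.
From HB Require Import structures.
From mathcomp Require Import all_boot all_order all_algebra.
From mathcomp Require Import all_classical all_reals all_analysis.
From mathcomp Require Import sesquilinear complex.
From mathcomp Require Import ring lra.

(* (i) => (ii): if e = A x - A^* x has norm 1, then 2 A_I = 2 Im b (., e) e with
   b = (A e, e), so that g = sqrt(2 Im b) e, and the expansion comes from the Neumann series.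
   (ii) => (iii): on the resolvent set the kernel is the Gram kernel of the
   vectors (A - z)^-1 g; the resolvent set is dense and M is continuous.
   (iii) => (v): the 2 x 2 minors of the kernel show that M has no zero in the
   open lower half-plane and that there b - 1/M has the right sign; this function
   is extended to the upper half-plane by reflection, and the minors again show
   that the extension agrees with b - 1/M where M is given.
   (v) => (iv): Q = -1/(V - Re b), where V continues b - 1/M; V takes no real
   value off the real axis by the mean value property, since V(z) ~ z at infinity.
   (iv) => (i): if Q is holomorphic off [-2h, 2h], the substitution
   z = h (w + 1/w) turns the residue at infinity of r(z) Q(z) into a circle
   average in w. This functional of the polynomial r is nonnegative whenever r is
   nonnegative on [-2h, 2h], as one sees by letting the circle tend to the unit
   circle, which z maps to the segment. Multiplication by 'X is then a bounded
   symmetric operator S for the inner product defined by the functional, with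
   cyclic vector e = 1, and Q(z) = ((S - z)^-1 e, e), because both sides have the
   same moments. The operator A = S + i (Im b) (., e) e is the one sought. *)

Set Implicit Arguments.
Unset Strict Implicit.
Unset Printing Implicit Defensive.

Import Order.TTheory GRing.Theory Num.Theory.
Import numFieldNormedType.Exports.

Local Open Scope classical_set_scope.
Local Open Scope ring_scope.

(** * Complex numbers and complex differentiability *)

(** The complement of [D] may be disconnected, and a point of the upper half-plane outside [D] need
    not lie in the resolvent set. Continuation from infinity therefore does not reach every point
    where [M] is given: agreement of [M] with the functions constructed from it is obtained
    pointwise, from the minors of the kernel or by algebra, and continuity is kept for the points
    that remain. The complex analysis is confined to means over circles centred at the origin: such
    a mean does not depend on the radius as long as the function is holomorphic in between, and a
    function that is continuous and zero at the centre, and whose means against all [z ^- n] vanish,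
    is zero. No representing measure of a Herglotz-Nevanlinna function is built; positivity of a
    functional on polynomials takes its place, and the Hilbert space is a space of sequences indexed
    by orthogonal polynomials. The constant [b] is quantified separately in each item, so an
    implication obtained by going round the cycle may return its own constant. *)

Section RealNorm.
Context {R : realType} {V : normedModType R[i]}.
Implicit Types (x y : V) (a : R[i]).

(** The norm of a space over [R[i]] has values in [R[i]], where the order is partial; its real part
    carries the same information in an ordered field to which [lra] and [nra] apply. *)
Definition nrm x : R := complex.Re `|x|.

Lemma normE x : `|x| = (nrm x)%:C%C.
Proof. by rewrite /nrm RRe_real // ger0_real. Qed.

Lemma nrm_ge0 x : 0 <= nrm x.
Proof. by have := normr_ge0 x; rewrite normE ler0c. Qed.

Lemma nrm0 : nrm (0 : V) = 0.
Proof. by rewrite /nrm normr0. Qed.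

Lemma nrm0_eq0 x : nrm x = 0 -> x = 0.
Proof. by move=> h; apply/eqP; rewrite -normr_eq0 normE h rmorph0. Qed.

Lemma nrmD x y : nrm (x + y) <= nrm x + nrm y.
Proof. by rewrite -lecR rmorphD /= -!normE ler_normD. Qed.

Lemma nrmN x : nrm (- x) = nrm x.
Proof. by rewrite /nrm normrN. Qed.

Lemma nrmB x y : nrm (x - y) <= nrm x + nrm y.
Proof. by rewrite -(nrmN y) nrmD. Qed.

Lemma nrm_distC x y : nrm (x - y) = nrm (y - x).
Proof. by rewrite -nrmN opprB. Qed.

Lemma nrm_ler_distB x y : nrm x - nrm y <= nrm (x - y).
Proof. by rewrite lerBlDr (le_trans _ (nrmD _ _)) // subrK. Qed.

Lemma nrm_near x y : `|nrm x - nrm y| <= nrm (x - y).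
Proof.
by rewrite ler_norml nrm_ler_distB andbT lerNl opprB nrm_distC nrm_ler_distB.
Qed.

Lemma nrm_sum I (r : seq I) (P : pred I) (F : I -> V) :
  nrm (\sum_(i <- r | P i) F i) <= \sum_(i <- r | P i) nrm (F i).
Proof.
elim/big_ind2 : _ => [|x a y b hx hy|//]; first by rewrite nrm0.
by rewrite (le_trans (nrmD _ _)) // lerD.
Qed.

Lemma le_nrm x (k : R) : (`|x| <= k%:C%C) = (nrm x <= k).
Proof. by rewrite normE lecR. Qed.

Lemma lt_nrm x (k : R) : (`|x| < k%:C%C) = (nrm x < k).
Proof. by rewrite normE ltcR. Qed.

Lemma nrm_gt0 x : (0 < nrm x) = (x != 0).
Proof. by rewrite -ltcR -normE normr_gt0. Qed.

Lemma nrm_le_eps x : (forall e : R, 0 < e -> nrm x <= e) -> x = 0.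
Proof.
move=> h; apply: nrm0_eq0; apply/eqP; rewrite eq_le nrm_ge0 andbT.
by apply/ler_addgt0Pl => e e0; rewrite addr0 h.
Qed.

End RealNorm.

Section ComplexBasics.
Context {R : realType}.
Implicit Types (z w : R[i]) (a b : R).

Lemma nrmZ (V : normedModType R[i]) (a : R[i]) (x : V) :
  nrm (a *: x) = nrm a * nrm x.
Proof. by rewrite {1}/nrm normrZ !normE -rmorphM. Qed.

Lemma nrmM z w : nrm (z * w) = nrm z * nrm w.
Proof. by rewrite {1}/nrm normrM !normE -rmorphM. Qed.

Lemma nrm1 : nrm (1 : R[i]) = 1.
Proof. by rewrite /nrm normr1. Qed.

Lemma nrmX z n : nrm (z ^+ n) = nrm z ^+ n.
Proof. by elim: n => [|n ih]; rewrite ?expr0 ?nrm1 // !exprS nrmM ih. Qed.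

Lemma nrmV z : nrm z^-1 = (nrm z)^-1.
Proof. by rewrite {1}/nrm normfV normE -fmorphV. Qed.

Lemma nrm_real a : nrm (a%:C%C : R[i]) = `|a|.
Proof. by rewrite /nrm normc_def /= expr0n addr0 sqrtr_sqr. Qed.

Lemma nrm_conj z : nrm z^* = nrm z.
Proof. by rewrite /nrm norm_conjC. Qed.

Lemma nrm_i : nrm ('i : R[i]) = 1.
Proof. by rewrite /nrm normCi. Qed.

Lemma ReD z w : complex.Re (z + w) = complex.Re z + complex.Re w.
Proof. by case: z w => [? ?] []. Qed.
Lemma ImD z w : complex.Im (z + w) = complex.Im z + complex.Im w.
Proof. by case: z w => [? ?] []. Qed.
Lemma ReN z : complex.Re (- z) = - complex.Re z.
Proof. by case: z. Qed.
Lemma ImN z : complex.Im (- z) = - complex.Im z.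
Proof. by case: z. Qed.
Lemma ReB z w : complex.Re (z - w) = complex.Re z - complex.Re w.
Proof. by rewrite ReD ReN. Qed.
Lemma ImB z w : complex.Im (z - w) = complex.Im z - complex.Im w.
Proof. by rewrite ImD ImN. Qed.
Lemma ReM z w : complex.Re (z * w)
  = complex.Re z * complex.Re w - complex.Im z * complex.Im w.
Proof. by case: z w => [? ?] []. Qed.
Lemma ImM z w : complex.Im (z * w)
  = complex.Re z * complex.Im w + complex.Im z * complex.Re w.
Proof. by case: z w => [? ?] [? ?] /=; rewrite addrC mulrC [X in _ + X]mulrC addrC mulrC [X in _ + X]mulrC. Qed.
Lemma Re_conj z : complex.Re z^* = complex.Re z.
Proof. by case: z. Qed.
Lemma Im_conj z : complex.Im z^* = - complex.Im z.
Proof. by case: z. Qed.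
Lemma Re_i : complex.Re ('i : R[i]) = 0.
Proof. by rewrite -complexiE. Qed.
Lemma Im_i : complex.Im ('i : R[i]) = 1.
Proof. by rewrite -complexiE. Qed.
Lemma Re_real a : complex.Re (a%:C%C : R[i]) = a. Proof. by []. Qed.
Lemma Im_real a : complex.Im (a%:C%C : R[i]) = 0. Proof. by []. Qed.

Definition ReImE := (ReD, ImD, ReN, ImN, ReM, ImM, Re_conj, Im_conj, Re_i, Im_i,
  Re_real, Im_real).

Lemma conj_real a : (a%:C%C : R[i])^* = a%:C%C.
Proof. by apply/eqP; rewrite eq_complex !ReImE oppr0 !eqxx. Qed.

Lemma complex_ext z w : complex.Re z = complex.Re w ->
  complex.Im z = complex.Im w -> z = w.
Proof. by case: z w => [? ?] [? ?] /= -> ->. Qed.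

Lemma complexReIm z : z = (complex.Re z)%:C%C + 'i * (complex.Im z)%:C%C.
Proof. by apply: complex_ext; rewrite !ReImE; ring. Qed.

Lemma nrm_sqr z : nrm z ^+ 2 = complex.Re z ^+ 2 + complex.Im z ^+ 2.
Proof. by apply: complexI; rewrite add_Re2_Im2 rmorphXn /= -normE. Qed.

Lemma mul_conj z : z * z^* = (nrm z ^+ 2)%:C%C.
Proof. by rewrite -normCK normE rmorphXn. Qed.

Lemma Re_le_nrm z : `|complex.Re z| <= nrm z.
Proof.
rewrite -(@ler_pXn2r _ 2) // ?nnegrE ?nrm_ge0 // nrm_sqr real_normK ?num_real //.
by rewrite lerDl sqr_ge0.
Qed.

Lemma Im_le_nrm z : `|complex.Im z| <= nrm z.
Proof.
rewrite -(@ler_pXn2r _ 2) // ?nnegrE ?nrm_ge0 // nrm_sqr real_normK ?num_real //.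
by rewrite lerDr sqr_ge0.
Qed.

Lemma nrm_le_ReIm z : nrm z <= `|complex.Re z| + `|complex.Im z|.
Proof.
rewrite {1}(complexReIm z) (le_trans (nrmD _ _)) //.
by rewrite nrmM nrm_i mul1r !nrm_real.
Qed.

Lemma ge0_complexE z : (0 <= z) = (complex.Im z == 0) && (0 <= complex.Re z).
Proof. by rewrite lecE /=. Qed.

Lemma gt0_complexE z : (0 < z) = (complex.Im z == 0) && (0 < complex.Re z).
Proof. by rewrite ltcE /=. Qed.

Lemma ImC_real z : 'Im z = (complex.Im z)%:C%C.
Proof. by rewrite complexIm. Qed.

Lemma subC_conj z : z - z^* = 2 * 'i * (complex.Im z)%:C%C.
Proof. by apply: complex_ext; rewrite !ReImE /=; ring. Qed.

Lemma addC_conj z : z + z^* = 2 * (complex.Re z)%:C%C.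
Proof. by apply: complex_ext; rewrite !ReImE /=; ring. Qed.

Lemma nbhs_nrmP (V : normedModType R[i]) (x : V) (A : set V) :
  nbhs x A <-> exists2 d : R, 0 < d & forall y, nrm (y - x) < d -> A y.
Proof.
rewrite -nbhs_nbhs_norm /=; split.
- move=> [e /= e0 he]; have [e1 e2] : complex.Im e = 0 /\ 0 < complex.Re e.
    by move: e0; rewrite gt0_complexE => /andP[/eqP-> ->].
  exists (complex.Re e) => // y hy; apply: he.
  rewrite /ball_/= distrC normE ltcE /= e1 eqxx //.
- move=> [d d0 hd]; exists d%:C%C; first by rewrite /= ltcR.
  by move=> y; rewrite /ball_/= distrC lt_nrm => /hd.
Qed.

Lemma cont_nrmP (V W : normedModType R[i]) (f : V -> W) (x : V) :
  {for x, continuous f} <->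
  forall e : R, 0 < e -> exists2 d : R, 0 < d &
     forall y, nrm (y - x) < d -> nrm (f y - f x) < e.
Proof.
split.
- move=> cf e e0.
  have /cf : nbhs (f x) [set w | nrm (w - f x) < e].
    by apply/nbhs_nrmP; exists e.
  by move/nbhs_nrmP.
- move=> h A /nbhs_nrmP[e e0 he]; apply/nbhs_nrmP.
  by have [d d0 hd] := h e e0; exists d => // y /hd /he.
Qed.

Lemma ccontP (f : R[i] -> R[i]) (x : R[i]) :
  {for x, continuous f} <->
  forall e : R, 0 < e -> exists2 d : R, 0 < d &
     forall y : R[i], nrm (y - x) < d -> nrm (f y - f x) < e.
Proof. exact: cont_nrmP. Qed.

(* Caratheodory's form of complex differentiability. *)
Definition cdiff (f : R[i] -> R[i]) z :=
  exists2 g : R[i] -> R[i], {for z, continuous g} &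
     forall w, f w = f z + g w * (w - z).

End ComplexBasics.

Section ComplexDifferentiability.
Context {R : realType}.
Implicit Types (f g : R[i] -> R[i]) (z w : R[i]).

(** The estimate is not strict, so it also holds at [w = z] and no punctured neighbourhood
    appears. *)
Lemma cdiffP f z : cdiff f z <-> exists l : R[i], forall e : R, 0 < e ->
  exists2 d : R, 0 < d & forall w, nrm (w - z) < d ->
    nrm (f w - f z - l * (w - z)) <= e * nrm (w - z).
Proof.
split.
- move=> [g /ccontP cg fg]; exists (g z) => e e0.
  have [d d0 hd] := cg e e0; exists d => // w /hd hw.
  have -> : f w - f z - g z * (w - z) = (g w - g z) * (w - z) by rewrite fg; ring.
  by rewrite nrmM ler_wpM2r ?nrm_ge0 // ltW.
- move=> [l hl]; pose g w := if w == z then l else (f w - f z) / (w - z).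
  exists g; last first.
    move=> w; rewrite /g; have [->|wz] := eqVneq w z; first by ring.
    by rewrite divfK ?subr_eq0 //; ring.
  apply/ccontP => e e0; have e20 : 0 < e / 2 by lra.
  have [d d0 hd] := hl _ e20; exists d => // w wd.
  rewrite /g eqxx; have [_|wz] := eqVneq w z; first by rewrite subrr nrm0.
  have wz0 : w - z != 0 by rewrite subr_eq0.
  have -> : (f w - f z) / (w - z) - l = (f w - f z - l * (w - z)) / (w - z).
    by field.
  rewrite nrmM nrmV ltr_pdivrMr ?nrm_gt0 //.
  rewrite (le_lt_trans (hd _ wd)) // ltr_pM2r ?nrm_gt0 //; lra.
Qed.

Lemma derivable_cdiff f z : derivable f z 1 <-> cdiff f z.
Proof.
split.
- move=> /cvg_ex[/= l /cvgrPdist_lt hl]; apply/cdiffP; exists l => e e0.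
  have /hl : (0 : R[i]) < e%:C%C by rewrite ltcR.
  move=> /(iffLR (nbhs_nrmP _ _))[d d0 hd]; exists d => // w wd.
  have [->|wz] := eqVneq w z; first by rewrite !subrr mulr0 subrr !nrm0 mulr0.
  have wz0 : w - z != 0 by rewrite subr_eq0.
  have := hd (w - z); rewrite subr0 => /(_ wd wz0).
  rewrite lt_nrm /= -![_ *: _]/(_ * _) mulr1 subrK => h.
  have -> : f w - f z - l * (w - z)
     = - (l - (w - z)^-1 * (f w - f z)) * (w - z) by field.
  by rewrite nrmM nrmN ler_wpM2r ?nrm_ge0 // ltW.
- move=> /cdiffP[l hl]; apply/cvg_ex; exists l; apply/cvgrPdist_lt => e.
  rewrite gt0_complexE => /andP[/eqP eI eR].
  have e20 : 0 < complex.Re e / 2 by lra.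
  have [d d0 hd] := hl _ e20; apply/nbhs_nrmP; exists d => // h; rewrite subr0.
  move=> hhd h0 /=; rewrite -![_ *: _]/(_ * _) mulr1.
  have -> : e = (complex.Re e)%:C%C by apply: complex_ext.
  rewrite lt_nrm; have := hd (h + z); rewrite addrK => /(_ hhd) H.
  have -> : l - h^-1 * (f (h + z) - f z)
     = - (f (h + z) - f z - l * h) / h by field.
  rewrite nrmM nrmV nrmN ltr_pdivrMr ?nrm_gt0 //.
  rewrite (le_lt_trans H) // ltr_pM2r ?nrm_gt0 //; lra.
Qed.

Lemma contD f g z : {for z, continuous f} -> {for z, continuous g} ->
  {for z, continuous (fun w => f w + g w)}.
Proof. by move=> cf cg; exact: (cvgD cf cg). Qed.

Lemma contB f g z : {for z, continuous f} -> {for z, continuous g} ->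
  {for z, continuous (fun w => f w - g w)}.
Proof. by move=> cf cg; exact: (cvgB cf cg). Qed.

Lemma contM f g z : {for z, continuous f} -> {for z, continuous g} ->
  {for z, continuous (fun w => f w * g w)}.
Proof. by move=> cf cg; exact: (cvgM cf cg). Qed.

Lemma contV f z : f z != 0 -> {for z, continuous f} ->
  {for z, continuous (fun w => (f w)^-1)}.
Proof. by move=> f0 cf; exact: (cvgV f0 cf). Qed.

Lemma cont_cst (c : R[i]) z : {for z, continuous (fun=> c)}.
Proof. by apply/ccontP => e e0; exists 1 => // y _; rewrite subrr nrm0. Qed.

Lemma cont_id z : {for z, continuous (fun w : R[i] => w)}.
Proof. by apply/ccontP => e e0; exists e. Qed.

Lemma cont_comp f g z : {for z, continuous f} -> {for f z, continuous g} ->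
  {for z, continuous (fun w => g (f w))}.
Proof.
move=> /ccontP cf /ccontP cg; apply/ccontP => e /cg[d d0 hd].
by have [d' d'0 hd'] := cf d d0; exists d' => // y /hd' /hd.
Qed.

Lemma cdiff_cont f z : cdiff f z -> {for z, continuous f}.
Proof.
move=> [g cg fg]; have -> : f = (fun w => f z + g w * (w - z)) by apply/funext.
exact: (contD (@cont_cst _ _) (contM cg (contB (@cont_id _) (@cont_cst _ _)))).
Qed.

Lemma cdiff_cst z0 z : cdiff (fun=> z0) z.
Proof.
by exists (fun=> 0); [exact: cont_cst | move=> w; rewrite mul0r addr0].
Qed.

Lemma cdiff_id z : cdiff id z.
Proof. by exists (fun=> 1); [exact: cont_cst | move=> w /=; ring]. Qed.

Lemma cdiffD f g z : cdiff f z -> cdiff g z -> cdiff (fun w => f w + g w) z.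
Proof.
move=> [a ca ha] [b cb hb]; exists (fun w => a w + b w); first exact: (contD ca cb).
by move=> w; rewrite ha hb; ring.
Qed.

Lemma cdiffM f g z : cdiff f z -> cdiff g z -> cdiff (fun w => f w * g w) z.
Proof.
move=> df dg; have cf := cdiff_cont df; move: df dg => [a ca ha] [b cb hb].
exists (fun w => a w * g z + f w * b w).
  by exact: (contD (contM ca (@cont_cst _ _)) (contM cf cb)).
by move=> w; rewrite (hb w) !(ha w); ring.
Qed.

Lemma cdiffN f z : cdiff f z -> cdiff (fun w => - f w) z.
Proof.
move=> [a ca ha]; exists (fun w => - a w); first exact: (cvgN ca).
by move=> w; rewrite ha; ring.
Qed.

Lemma cdiffB f g z : cdiff f z -> cdiff g z -> cdiff (fun w => f w - g w) z.
Proof. by move=> df dg; apply: cdiffD => //; exact: cdiffN. Qed.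

Lemma cdiffX f n z : cdiff f z -> cdiff (fun w => f w ^+ n) z.
Proof.
move=> df; elim: n => [|n ih]; first exact: cdiff_cst.
have -> : (fun w => f w ^+ n.+1) = (fun w => f w * f w ^+ n).
  by apply/funext => w; rewrite exprS.
exact: cdiffM.
Qed.

Lemma cdiff_comp f g z : cdiff f z -> cdiff g (f z) -> cdiff (g \o f) z.
Proof.
move=> df dg; have cf := cdiff_cont df; move: df dg => [a ca ha] [b cb hb].
exists (fun w => b (f w) * a w); last first.
  move=> w /=; rewrite (hb (f w)); have -> : f w - f z = a w * (w - z).
    by rewrite (ha w); ring.
  by ring.
by exact: (contM (cont_comp cf cb) ca).
Qed.

Lemma cdiff_near f g z : (exists2 d : R, 0 < d &
    forall w, nrm (w - z) < d -> f w = g w) -> cdiff f z -> cdiff g z.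
Proof.
move=> [d d0 fg] /cdiffP[l hl]; apply/cdiffP; exists l => e e0.
have [d' d'0 hd'] := hl e e0; exists (Num.min d d'); first by rewrite lt_min d0.
move=> w; rewrite lt_min => /andP[h1 h2].
by rewrite -!fg ?subrr ?nrm0 //; exact: hd'.
Qed.

Lemma cdiffV f z : f z != 0 -> cdiff f z -> cdiff (fun w => (f w)^-1) z.
Proof. by move=> f0 /derivable_cdiff df; apply/derivable_cdiff/derivableV. Qed.

Lemma cdiff_inv z : z != 0 -> cdiff (fun w => w^-1) z.
Proof. by move=> z0; apply: (@cdiffV id) => //; exact: cdiff_id. Qed.

Lemma cdiff_conj f z : cdiff f z^* -> cdiff (fun w => (f w^*)^*) z.
Proof.
move=> /cdiffP[l hl]; apply/cdiffP; exists l^* => e e0.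
have [d d0 hd] := hl e e0; exists d => // w wd.
have wd' : nrm (w^* - z^*) < d by rewrite -rmorphB nrm_conj.
have := hd _ wd'; rewrite -rmorphB nrm_conj -(nrm_conj (_ - _ - _)).
by rewrite !rmorphB rmorphM /= rmorphB /= !conjCK.
Qed.

End ComplexDifferentiability.

(** * Goursat's theorem and circle averages *)

Section PathIntegral.
Context {R : realType}.
Implicit Types (g h : R -> R[i]) (a b t : R) (c : R[i]).
Local Notation mu := (@lebesgue_measure R).

(** Continuity of a path is spelled out with [nrm] because its source is normed over [R] and its
    target over [R[i]]. *)
Definition pcont g t := forall e : R, 0 < e -> exists2 d : R, 0 < d &
  forall s, `|s - t| < d -> nrm (g s - g t) < e.

Lemma contR_epsP (f : R -> R) t : {for t, continuous f} <->
  forall e : R, 0 < e -> exists2 d : R, 0 < d &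
    forall s, `|s - t| < d -> `|f s - f t| < e.
Proof.
split.
- move=> /cvgrPdist_lt cf e /cf /nbhs_ballP[d /= d0 hd]; exists d => // s sd.
  by rewrite distrC; apply: hd; rewrite /ball /= distrC.
- move=> h; apply/cvgrPdist_lt => e /h[d d0 hd]; apply/nbhs_ballP; exists d => //.
  by move=> s; rewrite /ball /= distrC => /hd; rewrite distrC.
Qed.

Lemma pcontP g t : pcont g t <->
  {for t, continuous ((fun s => complex.Re (g s)))} /\ {for t, continuous ((fun s => complex.Im (g s)))}.
Proof.
split.
- move=> h; split; apply/contR_epsP => e /h[d d0 hd]; exists d => // s /hd.
  + by move=> /(le_lt_trans (Re_le_nrm _)); rewrite ReB.
  + by move=> /(le_lt_trans (Im_le_nrm _)); rewrite ImB.
- move=> [/contR_epsP h1 /contR_epsP h2] e e0; have e2 : 0 < e / 2 by lra.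
  have [d1 d10 H1] := h1 _ e2; have [d2 d20 H2] := h2 _ e2.
  exists (Num.min d1 d2); first by rewrite lt_min d10.
  move=> s; rewrite lt_min => /andP[/H1 k1 /H2 k2].
  rewrite (le_lt_trans (nrm_le_ReIm _)) // ReB ImB; move: k1 k2 => /=; lra.
Qed.

Definition path_integrable g a b := forall t, a <= t <= b -> pcont g t.

Definition cint a b g : R[i] :=
  (\int[mu]_(t in `[a, b]) complex.Re (g t))%:C%C
  + 'i * (\int[mu]_(t in `[a, b]) complex.Im (g t))%:C%C.

Lemma Re_cint a b g :
  complex.Re (cint a b g) = \int[mu]_(t in `[a, b]) complex.Re (g t).
Proof. by rewrite /cint !ReImE; ring. Qed.

Lemma Im_cint a b g :
  complex.Im (cint a b g) = \int[mu]_(t in `[a, b]) complex.Im (g t).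
Proof. by rewrite /cint !ReImE; ring. Qed.

Opaque cint.

Lemma continuous_integrable a b (f : R -> R) :
  (forall t, a <= t <= b -> {for t, continuous f}) ->
  mu.-integrable `[a, b] (EFin \o f).
Proof.
move=> cf; apply: continuous_compact_integrable; first exact: segment_compact.
apply: continuous_in_subspaceT => t; rewrite inE /= in_itv /=; exact: cf.
Qed.

Lemma path_integrableR a b g : path_integrable g a b ->
  mu.-integrable `[a, b] (EFin \o (fun t => complex.Re (g t))) /\
  mu.-integrable `[a, b] (EFin \o (fun t => complex.Im (g t))).
Proof.
by move=> cg; split; apply: continuous_integrable => t /cg /pcontP[].
Qed.

Lemma eq_cint a b g h : (forall t, a <= t <= b -> g t = h t) ->
  cint a b g = cint a b h.
Proof.
move=> gh; apply: complex_ext; rewrite !(Re_cint, Im_cint); apply: eq_Rintegral;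
by move=> t; rewrite inE /= in_itv /= => /gh ->.
Qed.

Lemma cintD a b g h : path_integrable g a b -> path_integrable h a b ->
  cint a b (fun t => g t + h t) = cint a b g + cint a b h.
Proof.
move=> /path_integrableR[g1 g2] /path_integrableR[h1 h2].
apply: complex_ext; rewrite [in RHS](ReD, ImD) !(Re_cint, Im_cint).
  rewrite -RintegralD //; apply: eq_Rintegral => t _; exact: ReD.
rewrite -RintegralD //; apply: eq_Rintegral => t _; exact: ImD.
Qed.

Lemma pcontZ g t c : pcont g t -> pcont (fun t => c * g t) t.
Proof.
move=> h e e0; have c0 : 0 < nrm c + 1 by have := nrm_ge0 c; lra.
have [d d0 hd] := h _ (divr_gt0 e0 c0); exists d => // s /hd.
rewrite -mulrBr nrmM => hs.
have [->|cz] := eqVneq c 0; first by rewrite nrm0 mul0r.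
rewrite -nrm_gt0 in cz; move: hs; rewrite ltr_pdivlMr // => hs.
by apply: le_lt_trans hs; rewrite mulrC ler_wpM2l ?nrm_ge0 //; lra.
Qed.

Lemma cintZ a b g c : path_integrable g a b ->
  cint a b (fun t => c * g t) = c * cint a b g.
Proof.
move=> /path_integrableR[g1 g2].
have iZ (k : R) (f : R -> R) : mu.-integrable `[a, b] (EFin \o f) ->
    mu.-integrable `[a, b] (EFin \o (fun t => k * f t)).
  move=> hf; have := @integrableZl _ _ _ mu _ (measurable_itv _) k _ hf.
  by apply: eq_integrable => // t _; rewrite /= EFinM.
apply: complex_ext; rewrite [in RHS](ReM, ImM) !(Re_cint, Im_cint).
  rewrite -!RintegralZl // -RintegralB //; [|exact: iZ|exact: iZ].
  by apply: eq_Rintegral => t _; exact: ReM.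
rewrite -!RintegralZl // -RintegralD //; [|exact: iZ|exact: iZ].
by apply: eq_Rintegral => t _; exact: ImM.
Qed.

Lemma pcontD g h t : pcont g t -> pcont h t -> pcont (fun t => g t + h t) t.
Proof.
move=> hg hh e e0; have e2 : 0 < e / 2 by lra.
have [d1 d10 H1] := hg _ e2; have [d2 d20 H2] := hh _ e2.
exists (Num.min d1 d2); first by rewrite lt_min d10.
move=> s; rewrite lt_min => /andP[/H1 k1 /H2 k2].
have -> : g s + h s - (g t + h t) = (g s - g t) + (h s - h t) by ring.
by rewrite (le_lt_trans (nrmD _ _)) //; lra.
Qed.

Lemma pcontN g t : pcont g t -> pcont (fun t => - g t) t.
Proof. by move=> h e /h[d d0 hd]; exists d => // s /hd; rewrite -opprD nrmN. Qed.

Lemma pcontB g h t : pcont g t -> pcont h t -> pcont (fun t => g t - h t) t.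
Proof. by move=> hg hh; apply: pcontD => //; exact: pcontN. Qed.

Lemma pcont_cst c t : pcont (fun=> c) t.
Proof. by move=> e e0; exists 1 => // s _; rewrite subrr nrm0. Qed.

Lemma pcont_comp (f : R[i] -> R[i]) g t : {for g t, continuous f} ->
  pcont g t -> pcont (fun t => f (g t)) t.
Proof.
move=> /ccontP cf cg e /cf[d d0 hd]; have [d' d'0 hd'] := cg _ d0.
by exists d' => // s /hd' /hd.
Qed.

Lemma cintN a b g : path_integrable g a b ->
  cint a b (fun t => - g t) = - cint a b g.
Proof.
move=> hg; rewrite -mulN1r -cintZ //; apply: eq_cint => t _; by rewrite mulN1r.
Qed.

Lemma cintB a b g h : path_integrable g a b -> path_integrable h a b ->
  cint a b (fun t => g t - h t) = cint a b g - cint a b h.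
Proof.
move=> hg hh; rewrite -cintN // cintD // => t /hh; exact: pcontN.
Qed.

Lemma Rintegral_itv_cst a b (k : R) : a <= b ->
  \int[mu]_(t in `[a, b]) k = (b - a) * k.
Proof.
move=> ab; rewrite Rintegral_cst //= lebesgue_measure_itv /= lte_fin.
move: ab; rewrite le_eqVlt => /predU1P[->|ab]; first by rewrite ltxx /= subrr mulr0 mul0r.
by rewrite ab /= mulrC.
Qed.

Lemma cint_cst a b c : a <= b -> cint a b (fun=> c) = (b - a)%:C%C * c.
Proof.
move=> ab; apply: complex_ext; rewrite !(Re_cint, Im_cint) Rintegral_itv_cst //.
  by rewrite !ReImE; ring.
by rewrite !ReImE; ring.
Qed.

Lemma Rintegral_bound a b (f : R -> R) (K : R) : a <= b ->
  (forall t, a <= t <= b -> {for t, continuous f}) ->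
  (forall t, a <= t <= b -> `|f t| <= K) ->
  `|\int[mu]_(t in `[a, b]) f t| <= (b - a) * K.
Proof.
move=> ab cf fK; have If := continuous_integrable cf.
rewrite (le_trans (le_normr_Rintegral _ _)) //.
rewrite -Rintegral_itv_cst //; apply: le_Rintegral => //.
- by apply: (integrable_norm If).
- by apply: continuous_integrable => t _; exact: cvg_cst.
Qed.

(* The factor 2, instead of 1, comes from treating the real and imaginary parts
   separately. *)
Lemma cint_bound a b g (K : R) : a <= b -> path_integrable g a b ->
  (forall t, a <= t <= b -> nrm (g t) <= K) ->
  nrm (cint a b g) <= 2 * (b - a) * K.
Proof.
move=> ab cg gK; rewrite (le_trans (nrm_le_ReIm _)) // Re_cint Im_cint.
have h1 : `|\int[mu]_(t in `[a, b]) complex.Re (g t)| <= (b - a) * K.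
  apply: Rintegral_bound => // t /[dup] /cg /pcontP[? _] // /gK.
  exact/le_trans/Re_le_nrm.
have h2 : `|\int[mu]_(t in `[a, b]) complex.Im (g t)| <= (b - a) * K.
  apply: Rintegral_bound => // t /[dup] /cg /pcontP[_ ?] // /gK.
  exact/le_trans/Im_le_nrm.
lra.
Qed.

Lemma cint_split a m b g : a <= m <= b -> path_integrable g a b ->
  cint a b g = cint a m g + cint m b g.
Proof.
move=> /andP[am mb] /path_integrableR[h1 h2].
have key (f : R -> R) : mu.-integrable `[a, b] (EFin \o f) ->
    \int[mu]_(t in `[a, b]) f t =
    \int[mu]_(t in `[a, m]) f t + \int[mu]_(t in `[m, b]) f t.
  move=> hf; have H := @Rintegral_itvB _ f (BLeft a) (BRight b) m hf.
  rewrite -(@Rintegral_itv_obnd_cbnd _ m (BRight b)).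
    by rewrite -H ?bnd_simp // addrCA subrr addr0.
  apply: integrableS hf => //.
  by move=> t /=; rewrite !in_itv /= => /andP[/ltW ? ->]; rewrite (le_trans am).
by apply: complex_ext; rewrite [in RHS](ReD, ImD) !(Re_cint, Im_cint); exact: key.
Qed.

Lemma cint_opp a g : 0 <= a -> path_integrable g (- a) a ->
  cint (- a) a (fun t => g (- t)) = cint (- a) a g.
Proof.
move=> a0 cg.
have key (f : R -> R) : (forall t, -a <= t <= a -> {for t, continuous f}) ->
    \int[mu]_(t in `[- a, a]) f (- t) = \int[mu]_(t in `[- a, a]) f t.
  move=> cf; rewrite /Rintegral; congr fine.
  have := @integration_by_substitution_oppr _ f (- a) a; rewrite opprK => -> //.
    lra.
  by apply: continuous_in_subspaceT => t; rewrite inE /= in_itv /=; exact: cf.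
apply: complex_ext; rewrite !(Re_cint, Im_cint).
  by rewrite (key ((fun s => complex.Re (g s)))) // => t /cg /pcontP[].
by rewrite (key ((fun s => complex.Im (g s)))) // => t /cg /pcontP[].
Qed.

(** A positive value [f t] would keep [f] above [f t / 2] on a short interval to the right of [t],
    and this interval alone would make the integral positive. *)
Lemma Rintegral_eq0 a b (f : R -> R) : a < b ->
  (forall t, a <= t <= b -> {for t, continuous f}) ->
  (forall t, a <= t <= b -> 0 <= f t) ->
  \int[mu]_(t in `[a, b]) f t = 0 -> forall t, a < t < b -> f t = 0.
Proof.
move=> ab cf f0 If t /andP[ta tb]; apply/eqP; rewrite eq_le f0 ?andbT ?(ltW ta) ?(ltW tb) //.
rewrite leNgt; apply/negP => ft.
have ht : a <= t <= b by rewrite !ltW.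
have ft2 : 0 < f t / 2 by lra.
have /contR_epsP/(_ _ ft2)[d d0 hd] := cf t ht.
pose u := Num.min b (t + d / 2).
have tu : t < u by rewrite lt_min tb /=; lra.
have ub : u <= b by rewrite ge_min lexx.
have ud : u <= t + d / 2 by rewrite ge_min lexx orbT.
clearbody u.
have cfs x y : a <= x -> y <= b -> forall t, x <= t <= y -> {for t, continuous f}.
  by move=> ax yb s /andP[xs sy]; apply: cf; rewrite (le_trans ax xs) (le_trans sy yb).
have Is := continuous_integrable cf.
have split3 : \int[mu]_(t in `[a, b]) f t =
  \int[mu]_(t in `[a, t]) f t + \int[mu]_(t in `[t, u]) f t
   + \int[mu]_(t in `[u, b]) f t.
  (* The real integral is split by regarding [f] as a complex path, so that [cint_split] applies. *)
  pose g s := (f s)%:C%C : R[i].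
  have pg : path_integrable g a b.
    move=> s /cf cs; apply/pcontP; split; first exact: cs.
    by apply/contR_epsP => e e0; exists 1 => // r _; rewrite /= subrr normr0.
  have pg' : path_integrable g t b.
    by move=> s /andP[h1 h2]; apply: pg; rewrite h2 andbT (le_trans (ltW ta)).
  have e : cint a b g = cint a t g + cint t u g + cint u b g.
    by rewrite (cint_split ht pg) (@cint_split t u b) ?addrA // (ltW tu).
  have e' := congr1 (@complex.Re R) e.
  by rewrite [in RHS]ReD [X in _ = X + _]ReD !Re_cint /= in e'.
have p1 : 0 <= \int[mu]_(t in `[a, t]) f t.
  apply: Rintegral_ge0 => s; rewrite /= in_itv /= => /andP[h1 h2]; apply: f0.
  by rewrite h1 (le_trans h2) // ltW.
have p3 : 0 <= \int[mu]_(t in `[u, b]) f t.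
  apply: Rintegral_ge0 => s; rewrite /= in_itv /= => /andP[h1 h2]; apply: f0.
  by rewrite h2 andbT (le_trans _ h1) // ltW // (lt_trans ta tu).
have p2 : (u - t) * (f t / 2) <= \int[mu]_(t in `[t, u]) f t.
  rewrite -Rintegral_itv_cst ?(ltW tu) //; apply: le_Rintegral => //.
  - by apply: continuous_integrable => s _; exact: cvg_cst.
  - by apply: continuous_integrable; apply: cfs => //; exact: ltW.
  - move=> s; rewrite /= in_itv /= => /andP[h1 h2].
    have /hd : `|s - t| < d.
      by rewrite ger0_norm ?subr_ge0 //; clear -h2 ud d0; lra.
    by rewrite ltr_norml => /andP[h _]; clear -h; lra.
have : 0 < (u - t) * (f t / 2) by rewrite mulr_gt0 // subr_gt0.
have gen (x y z w : R) : 0 < w -> 0 <= x -> w <= y -> 0 <= z -> x + y + z = 0 -> False.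
  by clear => *; lra.
by rewrite split3 in If; move=> p4; exact: gen p4 p1 p2 p3 If.
Qed.

End PathIntegral.

(** * Goursat's theorem for rectangles *)

Section Goursat.
Context {R : realType}.
Implicit Types (F : R[i] -> R[i]) (x y w h : R).

Definition pt x y : R[i] := (x +i* y)%C.

Lemma pcont_ptx y x : pcont (fun x => pt x y) x.
Proof.
move=> e e0; exists e => // s hs; rewrite (le_lt_trans (nrm_le_ReIm _)) //=.
by rewrite subrr normr0 addr0.
Qed.

Lemma pcont_pty x y : pcont (fun y => pt x y) y.
Proof.
move=> e e0; exists e => // s hs; rewrite (le_lt_trans (nrm_le_ReIm _)) //=.
by rewrite subrr normr0 add0r.
Qed.

(** The counterclockwise boundary integral of [F z dz]. Opposite sides share one integrand: bottom
    minus top, then right minus left with [dz = 'i dt]. *)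
Definition rect_int F x y w h : R[i] :=
  cint x (x + w) (fun s => F (pt s y) - F (pt s (y + h)))
  + 'i * cint y (y + h) (fun t => F (pt (x + w) t) - F (pt x t)).

Definition rect_cdiff F x y w h := forall s t, x <= s <= x + w ->
  y <= t <= y + h -> cdiff F (pt s t).

Lemma rect_path F x y w h : 0 <= w -> 0 <= h -> rect_cdiff F x y w h ->
  path_integrable (fun s => F (pt s y) - F (pt s (y + h))) x (x + w) /\
  path_integrable (fun t => F (pt (x + w) t) - F (pt x t)) y (y + h).
Proof.
move=> w0 h0 dF; split=> s hs; apply: pcontB.
- apply: (pcont_comp (g := fun s => pt s y)); last exact: pcont_ptx.
  by apply/cdiff_cont/dF => //; rewrite lexx lerDl.
- apply: (pcont_comp (g := fun s => pt s (y + h))); last exact: pcont_ptx.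
  by apply/cdiff_cont/dF => //; rewrite lexx lerDl h0.
- apply: (pcont_comp (g := fun s => pt (x + w) s)); last exact: pcont_pty.
  by apply/cdiff_cont/dF => //; rewrite lexx lerDl w0.
- apply: (pcont_comp (g := fun s => pt x s)); last exact: pcont_pty.
  by apply/cdiff_cont/dF => //; rewrite lexx lerDl.
Qed.

Lemma rect_cdiffS F x y w h x' y' w' h' : rect_cdiff F x y w h ->
  x <= x' -> y <= y' -> x' + w' <= x + w -> y' + h' <= y + h ->
  rect_cdiff F x' y' w' h'.
Proof. by move=> dF ? ? ? ? s t /andP[? ?] /andP[? ?]; apply: dF; lra. Qed.

Lemma rect_splitx F x y w h : 0 <= w -> 0 <= h ->
  rect_cdiff F x y (w + w) h ->
  rect_int F x y (w + w) h = rect_int F x y w h + rect_int F (x + w) y w h.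
Proof.
move=> w0 h0 dF; have ww : 0 <= w + w by lra.
have [p1 p2] := rect_path ww h0 dF; rewrite !(addrA x w w) in p1 p2.
have [q1 q2] : path_integrable (fun s => F (pt s y) - F (pt s (y + h))) x (x + w) /\
  path_integrable (fun t => F (pt (x + w) t) - F (pt x t)) y (y + h).
  by apply: rect_path => //; apply: rect_cdiffS dF _ _ _ _; lra.
have [r1 r2] : path_integrable (fun s => F (pt s y) - F (pt s (y + h))) (x + w) (x + w + w) /\
  path_integrable (fun t => F (pt (x + w + w) t) - F (pt (x + w) t)) y (y + h).
  by apply: rect_path => //; apply: rect_cdiffS dF _ _ _ _; lra.
rewrite /rect_int !(addrA x w w) (@cint_split _ x (x + w)); [|lra|exact: p1].
rewrite (_ : cint y (y + h) _ =
  cint y (y + h) (fun t => F (pt (x + w) t) - F (pt x t)) +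
  cint y (y + h) (fun t => F (pt (x + w + w) t) - F (pt (x + w) t))).
  by ring.
by rewrite -cintD //; apply: eq_cint => t _; ring.
Qed.

Lemma rect_splity F x y w h : 0 <= w -> 0 <= h ->
  rect_cdiff F x y w (h + h) ->
  rect_int F x y w (h + h) = rect_int F x y w h + rect_int F x (y + h) w h.
Proof.
move=> w0 h0 dF; have hh : 0 <= h + h by lra.
have [p1 p2] := rect_path w0 hh dF; rewrite !(addrA y h h) in p1 p2.
have [q1 q2] : path_integrable (fun s => F (pt s y) - F (pt s (y + h))) x (x + w) /\
  path_integrable (fun t => F (pt (x + w) t) - F (pt x t)) y (y + h).
  by apply: rect_path => //; apply: rect_cdiffS dF _ _ _ _; lra.
have [r1 r2] : path_integrable (fun s => F (pt s (y + h)) - F (pt s (y + h + h))) x (x + w) /\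
  path_integrable (fun t => F (pt (x + w) t) - F (pt x t)) (y + h) (y + h + h).
  by apply: rect_path => //; apply: rect_cdiffS dF _ _ _ _; lra.
rewrite /rect_int !(addrA y h h) (@cint_split _ y (y + h)); [|lra|exact: p2].
rewrite (_ : cint x (x + w) _ =
  cint x (x + w) (fun t => F (pt t y) - F (pt t (y + h))) +
  cint x (x + w) (fun t => F (pt t (y + h)) - F (pt t (y + h + h)))).
  by ring.
by rewrite -cintD //; apply: eq_cint => t _; ring.
Qed.

(** The affine part of [F] at [p] integrates to zero, and the remainder [G] is at most [e * (w + h)]
    on the boundary. Each pair of sides doubles this, and [cint_bound] doubles it again, whence the
    factor 4. *)
Lemma rect_small F x y w h p l (e : R) : 0 <= w -> 0 <= h -> 0 <= e ->
  rect_cdiff F x y w h -> x <= complex.Re p <= x + w ->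
  y <= complex.Im p <= y + h ->
  (forall s t, x <= s <= x + w -> y <= t <= y + h ->
    nrm (F (pt s t) - F p - l * (pt s t - p)) <= e * nrm (pt s t - p)) ->
  nrm (rect_int F x y w h) <= 4 * e * (w + h) ^+ 2.
Proof.
move=> w0 h0 e0 dF px py errF; have [q1 q2] := rect_path w0 h0 dF.
pose G z := F z - F p - l * (z - p).
have Gb s t : x <= s <= x + w -> y <= t <= y + h -> nrm (G (pt s t)) <= e * (w + h).
  move=> hs ht; rewrite (le_trans (errF _ _ hs ht)) // ler_wpM2l //.
  rewrite (le_trans (nrm_le_ReIm _)) // ReB ImB /=.
  by apply: lerD; rewrite ler_norml; lra.
have dG : rect_cdiff G x y w h.
  move=> s t hs ht; apply: cdiffB; first by apply: cdiffB; [exact: dF|exact: cdiff_cst].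
  apply: cdiffM; first exact: cdiff_cst.
  by apply: cdiffB; [exact: cdiff_id|exact: cdiff_cst].
have [g1 g2] := rect_path w0 h0 dG.
(* The affine part contributes [- l * 'i * h * w] through the horizontal sides and ['i * l * w * h]
   through the vertical ones. *)
have -> : rect_int F x y w h = rect_int G x y w h.
  rewrite /rect_int.
  rewrite (_ : cint x _ _ = cint x (x + w) (fun s => G (pt s y) - G (pt s (y + h)))
     + w%:C%C * (l * - ('i * h%:C%C))).
    rewrite (_ : cint y _ _ = cint y (y + h) (fun t => G (pt (x + w) t) - G (pt x t))
       + h%:C%C * (l * w%:C%C)).
      by ring.
    have -> : h%:C%C = (y + h - y)%:C%C :> R[i] by congr (_%:C%C); ring.
    rewrite -cint_cst ?lerDl // -cintD //; last by move=> t _; exact: pcont_cst.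
    apply: eq_cint => t _; rewrite /G.
    have -> : w%:C%C = pt (x + w) t - pt x t.
      by apply: complex_ext => /=; ring.
    by ring.
  have -> : w%:C%C = (x + w - x)%:C%C :> R[i] by congr (_%:C%C); ring.
  rewrite -cint_cst ?lerDl // -cintD //; last by move=> t _; exact: pcont_cst.
  apply: eq_cint => t _; rewrite /G.
  have -> : - ('i * h%:C%C) = pt t y - pt t (y + h).
    by rewrite -complexiE; apply: complex_ext => /=; ring.
  by ring.
rewrite /rect_int (le_trans (nrmD _ _)) // nrmM nrm_i mul1r.
have b1 : nrm (cint x (x + w) (fun s => G (pt s y) - G (pt s (y + h))))
    <= 2 * (x + w - x) * (e * (w + h) + e * (w + h)).
  apply: cint_bound => //; first by rewrite lerDl.
  by move=> s hs; rewrite (le_trans (nrmB _ _)) // lerD // Gb //; lra.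
have b2 : nrm (cint y (y + h) (fun t => G (pt (x + w) t) - G (pt x t)))
    <= 2 * (y + h - y) * (e * (w + h) + e * (w + h)).
  apply: cint_bound => //; first by rewrite lerDl.
  by move=> s hs; rewrite (le_trans (nrmB _ _)) // lerD // Gb //; lra.
rewrite (le_trans (lerD b1 b2)) // le_eqVlt; apply/orP; left; apply/eqP; ring.
Qed.

(** The integral is the sum over the four quarters, so one of them carries at least a quarter of its
    modulus. *)
Lemma goursat_quarter F x y w h : 0 <= w -> 0 <= h ->
  rect_cdiff F x y (w + w) (h + h) ->
  exists2 p : R * R, [/\ x <= p.1, p.1 + w <= x + (w + w), y <= p.2 &
      p.2 + h <= y + (h + h)] &
    nrm (rect_int F x y (w + w) (h + h)) <= 4 * nrm (rect_int F p.1 p.2 w h).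
Proof.
move=> w0 h0 dF.
rewrite rect_splitx //; last lra.
have d1 : rect_cdiff F x y w (h + h) by apply: rect_cdiffS dF _ _ _ _; lra.
have d2 : rect_cdiff F (x + w) y w (h + h) by apply: rect_cdiffS dF _ _ _ _; lra.
rewrite !rect_splity //.
set a := rect_int F x y w h; set b := rect_int F x (y + h) w h.
set c := rect_int F (x + w) y w h; set d := rect_int F (x + w) (y + h) w h.
have N : nrm (a + b + (c + d)) <= nrm a + nrm b + nrm c + nrm d.
  rewrite (le_trans (nrmD _ _)) // -(addrA (nrm a + nrm b)).
  exact: lerD (nrmD _ _) (nrmD _ _).
have gen (A B C D K : R) : K <= A + B + C + D ->
    K <= 4 * A \/ K <= 4 * B \/ K <= 4 * C \/ K <= 4 * D.
  move=> HN; have [?|?] := lerP K (4 * A); first by left.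
  have [?|?] := lerP K (4 * B); first by right; left.
  have [?|?] := lerP K (4 * C); first by right; right; left.
  by right; right; right; lra.
have [?|[?|[?|?]]] := gen _ _ _ _ _ N.
- by exists (x, y) => [|//]; clear -w0 h0; split => /=; lra.
- by exists (x, y + h) => [|//]; clear -w0 h0; split => /=; lra.
- by exists (x + w, y) => [|//]; clear -w0 h0; split => /=; lra.
- by exists (x + w, y + h) => [|//]; clear -w0 h0; split => /=; lra.
Qed.

(** The point is the supremum of the left ends: every left end lies below every right end. *)
Lemma nested_point (u : nat -> R) (w : R) : 0 <= w ->
  (forall n, u n <= u n.+1) ->
  (forall n, u n.+1 + w / 2 ^+ n.+1 <= u n + w / 2 ^+ n) ->
  exists x, forall n, u n <= x <= u n + w / 2 ^+ n.
Proof.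
move=> w0 um ud.
have um' m k : u m <= u (m + k)%N.
  by elim: k => [|k ih]; rewrite ?addn0 // addnS (le_trans ih).
have ud' m k : u (m + k)%N + w / 2 ^+ (m + k) <= u m + w / 2 ^+ m.
  by elim: k => [|k ih]; rewrite ?addn0 // addnS (le_trans (ud _)).
have wn n : 0 <= w / 2 ^+ n by rewrite divr_ge0 // exprn_ge0.
have ub m n : u m <= u n + w / 2 ^+ n.
  have [mn|nm] := leqP m n.
    by have := um' m (n - m)%N; rewrite subnKC // => /le_trans; apply; rewrite lerDl.
  have := ud' n (m - n)%N; rewrite subnKC ?(ltnW nm) // => /(le_trans _); apply.
  by rewrite lerDl.
have hs : has_sup (range u).
  by split; [exists (u 0%N), 0%N|exists (u 0%N + w / 2 ^+ 0) => _ [m _ <-]].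
exists (sup (range u)) => n; apply/andP; split.
  by apply: ub_le_sup; [exact: (proj2 hs)|exists n].
by apply: ge_sup; [exact: (proj1 hs)|move=> _ [m _ <-]].
Qed.

Lemma goursat F x y w h : 0 <= w -> 0 <= h -> rect_cdiff F x y w h ->
  rect_int F x y w h = 0.
Proof.
move=> w0 h0 dF; apply: nrm0_eq0; apply/eqP; rewrite eq_le nrm_ge0 andbT.
rewrite leNgt; apply/negP; set c := nrm _ => c0.
pose W n : R := w / 2 ^+ n; pose H n : R := h / 2 ^+ n.
have W0 n : 0 <= W n by rewrite divr_ge0 // exprn_ge0.
have H0 n : 0 <= H n by rewrite divr_ge0 // exprn_ge0.
have half (a : R) n : a / 2 ^+ n = a / 2 ^+ n.+1 + a / 2 ^+ n.+1.
  by rewrite exprS; field; rewrite expf_neq0.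
pose ok n (p : R * R) := [/\ x <= p.1, p.1 + W n <= x + w, y <= p.2,
  p.2 + H n <= y + h & c <= 4 ^+ n * nrm (rect_int F p.1 p.2 (W n) (H n))].
pose nxt n (p q : R * R) := [/\ p.1 <= q.1, q.1 + W n.+1 <= p.1 + W n, p.2 <= q.2 &
  q.2 + H n.+1 <= p.2 + H n].
(* The hypothesis [ok] is put under the existential so that [choice] yields a total function; when
   [ok] fails, any [q] will do. *)
have step (np : nat * (R * R)) : exists q, ok np.1 np.2 ->
    ok np.1.+1 q /\ nxt np.1 np.2 q.
  case: np => n p /=; have [okp|nok] := pselect (ok n p); last by exists p.
  case: (okp) => k1 k2 k3 k4 k5.
  have dn : rect_cdiff F p.1 p.2 (W n.+1 + W n.+1) (H n.+1 + H n.+1).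
    by rewrite -!half; apply: rect_cdiffS dF _ _ _ _.
  have [q [q1 q2 q3 q4] hq] := goursat_quarter (W0 _) (H0 _) dn.
  rewrite -!half in hq q2 q4; exists q => _; split; last by split.
  split; [exact: le_trans k1 q1|exact: le_trans q2 k2|exact: le_trans k3 q3
         |exact: le_trans q4 k4|].
  by rewrite (le_trans k5) // exprSr -mulrA ler_wpM2l // exprn_ge0.
have [f hf] := choice step.
pose u := fix u n := if n is m.+1 then f (m, u m) else (x, y).
have oku n : ok n (u n).
  elim: n => [|n ih]; last exact: (proj1 (hf (n, u n) ih)).
  by split; rewrite /= /W /H ?expr0 ?divr1 ?mul1r.
have nx n : nxt n (u n) (u n.+1) := proj2 (hf (n, u n) (oku n)).
have [px hpx] := @nested_point (fun n => (u n).1) w w0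
   (fun n => let: And4 a _ _ _ := nx n in a) (fun n => let: And4 _ a _ _ := nx n in a).
have [py hpy] := @nested_point (fun n => (u n).2) h h0
   (fun n => let: And4 _ _ a _ := nx n in a) (fun n => let: And4 _ _ _ a := nx n in a).
have dp : cdiff F (pt px py).
  by apply: dF; [have := hpx 0%N|have := hpy 0%N]; rewrite expr0 divr1.
have [l hl] := iffLR (cdiffP _ _) dp.
(* With tolerance [c / (4 * (w + h + 1) ^+ 2)], the factor 4 of [rect_small] cancels and the factors
   [4 ^+ n] balance the squared half-perimeters, leaving [c <= c * ((w + h) / (w + h + 1)) ^+ 2],
   impossible for [c > 0]. *)
have K0 : 0 < 4 * (w + h + 1) ^+ 2.
  by rewrite mulr_gt0 // exprn_gt0 //; lra.
have [d d0 hd] := hl _ (divr_gt0 c0 K0).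
have [n hn] : exists n, (w + h) / 2 ^+ n < d.
  have [k hk] : exists k : nat, (w + h) / d < k%:R.
    exists (Num.Def.archi_bound ((w + h) / d)); rewrite archi_boundP //.
    by rewrite divr_ge0 ?addr_ge0 // ltW.
  exists k; rewrite ltr_pdivrMr ?exprn_gt0 // mulrC -ltr_pdivrMr //.
  by rewrite (lt_trans hk) // -natrX ltr_nat ltn_expl.
have [k1 k2 k3 k4 k5] := oku n.
have hx := hpx n; have hy := hpy n.
have small : nrm (rect_int F (u n).1 (u n).2 (W n) (H n))
    <= 4 * (c / (4 * (w + h + 1) ^+ 2)) * (W n + H n) ^+ 2.
  apply: (@rect_small F _ _ _ _ (pt px py) l) => //.
  - by apply: divr_ge0; apply: ltW.
  - by apply: rect_cdiffS dF _ _ _ _.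
  - move=> s t hs ht; apply: hd; rewrite (le_lt_trans (nrm_le_ReIm _)) //.
    rewrite ReB ImB /= (le_lt_trans _ hn) // mulrDl; apply: lerD.
      by rewrite ler_norml; move: hs hx; rewrite /W; clear; lra.
    by rewrite ler_norml; move: ht hy; rewrite /H; clear; lra.
have e4 : (4 : R) ^+ n * (W n + H n) ^+ 2 = (w + h) ^+ 2.
  rewrite /W /H -mulrDl exprMn exprVn -exprM mulnC exprM.
  have -> : (2 : R) ^+ 2 = 4 by ring.
  by field; rewrite expf_neq0.
have : c <= c / (w + h + 1) ^+ 2 * (w + h) ^+ 2.
  rewrite (le_trans k5) // -e4.
  rewrite (le_trans (ler_wpM2l _ small)) ?exprn_ge0 //.
  rewrite le_eqVlt; apply/orP; left; apply/eqP; field.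
  by apply/eqP; lra.
rewrite leNgt => /negP; apply.
rewrite -mulrA -[ltRHS]mulr1 ltr_pM2l // mulrC ltr_pdivrMr; last first.
  by rewrite exprn_gt0 //; lra.
by rewrite mul1r ltr_pXn2r ?nnegrE //; lra.
Qed.

End Goursat.

(** * The complex exponential *)

Section Exponential.
Context {R : realType}.
Implicit Types (t a b : R) (z w : R[i]).

Definition cis t : R[i] := (cos t +i* sin t)%C.
Definition cexp z : R[i] := (expR (complex.Re z))%:C%C * cis (complex.Im z).

Lemma nrm_cis t : nrm (cis t) = 1.
Proof.
apply/eqP; rewrite -(@eqrXn2 _ 2) ?nrm_ge0 // nrm_sqr /= cos2Dsin2 expr1n //.
Qed.

Lemma cis_neq0 t : cis t != 0.
Proof. by rewrite -nrm_gt0 nrm_cis. Qed.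

Lemma cisN t : cis (- t) = (cis t)^*.
Proof. by rewrite /cis cosN sinN. Qed.

Lemma cis_pi : cis (- pi) = cis pi.
Proof. by rewrite cisN; apply: complex_ext => //=; rewrite sinpi oppr0. Qed.

Lemma cexpD z w : cexp (z + w) = cexp z * cexp w.
Proof.
rewrite /cexp ReD ImD expRD /cis cosD sinD rmorphM /=.
by apply: complex_ext => /=; ring.
Qed.

Lemma cexp0 : cexp 0 = 1.
Proof. by rewrite /cexp /= expR0 mul1r /cis cos0 sin0. Qed.

Lemma is_derive_eps (f : R -> R) (x d : R) : is_derive x 1 f d ->
  forall e : R, 0 < e -> exists2 k : R, 0 < k &
    forall h, `|h| < k -> `|f (x + h) - f x - d * h| <= e * `|h|.
Proof.
move=> [df dE] e e0; move: df; rewrite /derivable => /cvg_ex[l hl].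
have lE : l = d by rewrite -dE; apply/esym/cvg_lim.
rewrite {}lE in hl; move: hl => /cvgrPdist_lt/(_ _ e0) /nbhs_ballP[k /= k0 hk].
exists k => // h hh; have [->|hn0] := eqVneq h 0.
  by rewrite addr0 subrr mulr0 subrr normr0 mulr0.
have := hk h; rewrite /ball /= sub0r normrN => /(_ hh hn0).
rewrite -![_ *: _]/(_ * _) mulr1 (addrC h x) => H.
have -> : f (x + h) - f x - d * h = - (d - h^-1 * (f (x + h) - f x)) * h by field.
by rewrite normrM normrN ler_wpM2r // ltW.
Qed.

Lemma cdiff_cexp0 : cdiff cexp 0.
Proof.
(* The real part of the error is at most [e' + 2 e'] times [nrm w], and so is the imaginary part:
   six in all. The cap at 1 gives [expR a <= 2]. *)
apply/cdiffP; exists 1 => e e0; pose e' := Num.min (e / 6) 1.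
have e'0 : 0 < e' by rewrite lt_min ltr01 andbT; lra.
have e'1 : e' <= 1 by rewrite ge_min lexx orbT.
have e'e : e' <= e / 6 by rewrite ge_min lexx.
clearbody e'.
have [k1 k10 H1] := is_derive_eps (is_derive_expR (0 : R)) e'0.
have [k2 k20 H2] := is_derive_eps (is_derive_cos (0 : R)) e'0.
have [k3 k30 H3] := is_derive_eps (is_derive_sin (0 : R)) e'0.
pose k := Num.min (Num.min k1 k2) (Num.min k3 (e' / 2)).
have [kk1 kk2 kk3 kk4] : [/\ k <= k1, k <= k2, k <= k3 & k <= e' / 2].
  by rewrite /k; split; rewrite !ge_min lexx ?orbT.
have k0 : 0 < k by rewrite !lt_min k10 k20 k30 /=; lra.
clearbody k.
exists k => // w; rewrite subr0 mul1r cexp0 => wk.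
have aw := Re_le_nrm w; have bw := Im_le_nrm w.
set a := complex.Re w in aw *; set b := complex.Im w in bw *.
have {}H1 := H1 a (lt_le_trans (le_lt_trans aw wk) kk1).
have {}H2 := H2 b (lt_le_trans (le_lt_trans bw wk) kk2).
have {}H3 := H3 b (lt_le_trans (le_lt_trans bw wk) kk3).
rewrite add0r expR0 mul1r in H1.
rewrite add0r cos0 sin0 oppr0 mul0r subr0 in H2.
rewrite add0r cos0 sin0 subr0 mul1r in H3.
set N := nrm w in aw bw wk *.
have N0 : 0 <= N := nrm_ge0 w.
have E1 : `|expR a - 1| <= e'.
  have -> : expR a - 1 = (expR a - 1 - a) + a by ring.
  rewrite (le_trans (ler_normD _ _)) //.
  have : e' * `|a| <= 1 * `|a| by rewrite ler_wpM2r.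
  lra.
have E2 : `|expR a| <= 2.
  have -> : expR a = (expR a - 1) + 1 by ring.
  by rewrite (le_trans (ler_normD _ _)) // normr1; lra.
rewrite (le_trans (nrm_le_ReIm _)) // !(ReB, ImB) /=.
rewrite -/a -/b !mul0r subr0 addr0 oppr0 addr0.
have -> : expR a * cos b - 1 - a = (expR a - 1 - a) + expR a * (cos b - 1) by ring.
have -> : expR a * sin b - b = expR a * (sin b - b) + (expR a - 1) * b by ring.
have F1 : `|expR a * (cos b - 1)| <= 2 * (e' * N).
  by rewrite normrM ler_pM // (le_trans H2) // ler_wpM2l // ltW.
have F2 : `|expR a * (sin b - b)| <= 2 * (e' * N).
  by rewrite normrM ler_pM // (le_trans H3) // ler_wpM2l // ltW.
have F3 : `|(expR a - 1) * b| <= e' * N by rewrite normrM ler_pM.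
have F4 : `|expR a - 1 - a| <= e' * N.
  by rewrite (le_trans H1) // ler_wpM2l // ltW.
have F5 : e' * N <= e / 6 * N by rewrite ler_wpM2r.
rewrite (le_trans (lerD (ler_normD _ _) (ler_normD _ _))) //.
have gen (A B C D x y : R) : A <= x -> B <= 2 * x -> C <= 2 * x -> D <= x ->
    x <= e / 6 * y -> A + B + (C + D) <= e * y by clear; lra.
exact: gen F4 F1 F2 F3 F5.
Qed.

Lemma cdiff_cexp z : cdiff cexp z.
Proof.
have -> : cexp = (fun w => cexp z * cexp (w - z)).
  by apply/funext => w; rewrite -cexpD addrC subrK.
apply: cdiffM; first exact: cdiff_cst.
apply: (@cdiff_comp _ (fun w => w - z)).
  by apply: cdiffB; [exact: cdiff_id|exact: cdiff_cst].
by rewrite subrr; exact: cdiff_cexp0.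
Qed.

End Exponential.

(** * Means over circles centred at the origin *)

Section CircleAverage.
Context {R : realType}.
Implicit Types (f g : R[i] -> R[i]) (r t : R) (z w c : R[i]).

Definition polar r t : R[i] := r%:C%C * cis t.

Lemma nrm_polar r t : nrm (polar r t) = `|r|.
Proof. by rewrite nrmM nrm_real nrm_cis mulr1. Qed.

Lemma nrm_polar0 r t : 0 <= r -> nrm (polar r t) = r.
Proof. by move=> r0; rewrite nrm_polar ger0_norm. Qed.

Lemma pcont_cis t : pcont (@cis R) t.
Proof. by apply/pcontP; split; [exact: continuous_cos|exact: continuous_sin]. Qed.

Lemma pcont_polar r t : pcont (polar r) t.
Proof. by apply: pcontZ; exact: pcont_cis. Qed.

(** Integration against [dz / (2 pi i z)] over the circle of radius [r]; the mean of [f z * z ^- n]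
    is the [n]-th Laurent coefficient of [f]. *)
Definition avg f r : R[i] :=
  ((2 * pi)^-1)%:C%C * cint (- pi) pi (fun t => f (polar r t)).

Definition ccirc f r := forall t, - pi <= t <= pi ->
  {for polar r t, continuous f}.

Lemma ccirc_path f r : ccirc f r ->
  path_integrable (fun t => f (polar r t)) (- pi) pi.
Proof. by move=> cf t /cf ct; apply: pcont_comp => //; exact: pcont_polar. Qed.

Lemma pi0 : 0 < pi :> R. Proof. exact: pi_gt0. Qed.

Lemma eq_avg f g r : (forall t, - pi <= t <= pi -> f (polar r t) = g (polar r t)) ->
  avg f r = avg g r.
Proof. by move=> fg; rewrite /avg (eq_cint fg). Qed.

Lemma avgD f g r : ccirc f r -> ccirc g r ->
  avg (fun z => f z + g z) r = avg f r + avg g r.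
Proof. by move=> /ccirc_path cf /ccirc_path cg; rewrite /avg cintD // mulrDr. Qed.

Lemma avgB f g r : ccirc f r -> ccirc g r ->
  avg (fun z => f z - g z) r = avg f r - avg g r.
Proof. by move=> /ccirc_path cf /ccirc_path cg; rewrite /avg cintB // mulrBr. Qed.

Lemma avgZ c f r : ccirc f r -> avg (fun z => c * f z) r = c * avg f r.
Proof. by move=> /ccirc_path cf; rewrite /avg cintZ // mulrCA. Qed.

Lemma avg_cst c r : avg (fun=> c) r = c.
Proof.
rewrite /avg cint_cst; last by have := pi0; lra.
rewrite mulrA -rmorphM /=.
have -> : (2 * pi)^-1 * (pi - - pi) = 1 :> R.
  by field; apply/eqP; have := pi0; lra.
by rewrite mul1r.
Qed.

Lemma ccirc_cst c r : ccirc (fun=> c) r.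
Proof. by move=> t _; exact: cont_cst. Qed.

Lemma ccircM f g r : ccirc f r -> ccirc g r -> ccirc (fun z => f z * g z) r.
Proof. by move=> cf cg t ht; exact: (contM (cf t ht) (cg t ht)). Qed.

Lemma ccircD f g r : ccirc f r -> ccirc g r -> ccirc (fun z => f z + g z) r.
Proof. by move=> cf cg t ht; exact: (contD (cf t ht) (cg t ht)). Qed.

Lemma ccircB f g r : ccirc f r -> ccirc g r -> ccirc (fun z => f z - g z) r.
Proof. by move=> cf cg t ht; exact: (contB (cf t ht) (cg t ht)). Qed.

Lemma ccirc_sum (I : Type) (s : seq I) (F : I -> R[i] -> R[i]) r :
  (forall i, ccirc (F i) r) -> ccirc (fun z => \sum_(i <- s) F i z) r.
Proof.
move=> cF; elim: s => [|i s ih].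
  rewrite (_ : (fun z => _) = fun=> 0); first exact: ccirc_cst.
  by apply/funext => z; rewrite big_nil.
rewrite (_ : (fun z => _) = fun z => F i z + \sum_(j <- s) F j z).
  exact: ccircD (cF i) ih.
by apply/funext => z; rewrite big_cons.
Qed.

Lemma avg_sum (I : Type) (s : seq I) (F : I -> R[i] -> R[i]) r :
  (forall i, ccirc (F i) r) ->
  avg (fun z => \sum_(i <- s) F i z) r = \sum_(i <- s) avg (F i) r.
Proof.
move=> cF; elim: s => [|i s ih].
  by under eq_fun do rewrite big_nil; rewrite big_nil avg_cst.
under eq_fun do rewrite big_cons; rewrite big_cons avgD // ?ih //.
exact: ccirc_sum.
Qed.

Lemma avg_bound f r (K : R) : ccirc f r ->
  (forall t, - pi <= t <= pi -> nrm (f (polar r t)) <= K) ->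
  nrm (avg f r) <= 2 * K.
Proof.
move=> /ccirc_path cf fK; have p0 := pi0.
have pp : - pi <= pi :> R by lra.
rewrite /avg nrmM nrm_real ger0_norm ?invr_ge0; last by lra.
have := cint_bound pp cf fK; set N := nrm _ => HN.
rewrite mulrC ler_pdivrMr; last lra.
by rewrite (le_trans HN) //; lra.
Qed.

Lemma ccirc_bounded f r : ccirc f r ->
  exists2 K : R, 0 <= K & forall t, - pi <= t <= pi -> nrm (f (polar r t)) <= K.
Proof.
move=> /ccirc_path cf; have p0 := pi0; have pp : - pi <= pi :> R by lra.
have cn : {within `[- pi, pi], continuous (fun t => nrm (f (polar r t)))}.
  apply: continuous_in_subspaceT => t; rewrite inE /= in_itv /= => /cf ct.
  apply/contR_epsP => e /ct[d d0 hd]; exists d => // s /hd.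
  exact/le_lt_trans/nrm_near.
have [c cI cm] := EVT_max pp cn.
exists (nrm (f (polar r c))); first exact: nrm_ge0.
by move=> t ht; apply: cm; rewrite in_itv.
Qed.

(** Compactness of [[-pi, pi]] makes [f (polar r t)] converge uniformly in [t] as [r] tends to [r0].
    The tolerance is halved because [cint_bound] loses a factor 2. *)
Lemma avg_continuous f r0 (b : R) : 0 < b ->
  (forall r, `|r - r0| < b -> ccirc f r) ->
  forall e : R, 0 < e -> exists2 d : R, 0 < d &
    forall r, `|r - r0| < d -> nrm (avg f r - avg f r0) <= e.
Proof.
move=> b0 cf e e0; have e2 : 0 < e / 2 by lra.
have cf0 : ccirc f r0 by apply: cf; rewrite subrr normr0.
have /compact_near_coveringP NC := @segment_compact R (- pi) pi.
pose P (r t : R) := nrm (f (polar r t) - f (polar r0 t)) < e / 2.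
have := NC _ (nbhs r0) P _ _; case.
  move=> t; rewrite /= in_itv /= => ht.
  have e4 : 0 < e / 4 by lra.
  (* Half of [d] is spent on the radius and half on the angle; [|r0| + 1] replaces [|r0|], which may
     be zero. *)
  have [d d0 hd] := iffLR (ccontP _ _) (cf0 t ht) _ e4.
  have r1 : 0 < `|r0| + 1 by have := normr_ge0 r0; lra.
  have d2 : 0 < d / 2 by lra.
  have [k k0 hk] := @pcont_cis t _ (divr_gt0 d2 r1).
  have close r s : `|r - r0| < d / 2 -> `|s - t| < k ->
      nrm (polar r s - polar r0 t) < d.
    move=> hr /hk hs.
    have -> : polar r s - polar r0 t =
       (r - r0)%:C%C * cis s + r0%:C%C * (cis s - cis t).
      by rewrite /polar rmorphB /=; ring.
    rewrite (le_lt_trans (nrmD _ _)) // !nrmM !nrm_real nrm_cis mulr1.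
    have : `|r0| * nrm (cis s - cis t) <= (`|r0| + 1) * nrm (cis s - cis t).
      by rewrite ler_wpM2r ?nrm_ge0 //; lra.
    move: hs; rewrite ltr_pdivlMr // mulrC; lra.
  exists ([set s | `|s - t| < k], [set r | `|r - r0| < d / 2]) => /=.
    split; apply/nbhs_ballP; [exists k => //|exists (d / 2) => //];
    by move=> s /=; rewrite /ball /= distrC.
  move=> [s r] /= [hs hr]; rewrite /P.
  have h1 := hd _ (close _ _ hr hs).
  have h0 : `|r0 - r0| < d / 2 by rewrite subrr normr0.
  have h2 := hd _ (close _ _ h0 hs).
  have -> : f (polar r s) - f (polar r0 s) =
    (f (polar r s) - f (polar r0 t)) - (f (polar r0 s) - f (polar r0 t)) by ring.
  by rewrite (le_lt_trans (nrmB _ _)) //; lra.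
move=> d /= d0 hd; exists (Num.min b d); first by rewrite lt_min b0.
move=> r; rewrite lt_min => /andP[rb rd].
have cfr := cf r rb.
have -> : avg f r - avg f r0 = 
   ((2 * pi)^-1)%:C%C * cint (- pi) pi (fun t => f (polar r t) - f (polar r0 t)).
  by rewrite cintB ?mulrBr //; exact: ccirc_path.
have p0 := pi0.
have pp : - pi <= pi :> R by lra.
rewrite nrmM nrm_real ger0_norm ?invr_ge0; last by lra.
have cb : nrm (cint (- pi) pi (fun t => f (polar r t) - f (polar r0 t)))
   <= 2 * (pi - - pi) * (e / 2).
  apply: cint_bound => //.
    by move=> t ht; apply: pcontB; apply: ccirc_path.
  move=> t ht; apply: ltW; apply: (hd r); last by rewrite /= in_itv.
  by rewrite /= distrC.
rewrite mulrC ler_pdivrMr; last lra.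
by rewrite (le_trans cb) //; lra.
Unshelve. all: by end_near. Qed.

(* Integrate [f \o exp] around the rectangle [ln r1, ln r2] x [-pi, pi]; the two
   horizontal sides cancel by periodicity. *)
Lemma avg_const f r1 r2 : 0 < r1 <= r2 ->
  (forall z, r1 <= nrm z <= r2 -> cdiff f z) -> avg f r1 = avg f r2.
Proof.
move=> /andP[r10 r12] df; have r20 := lt_le_trans r10 r12; have p0 := pi0.
pose F z := f (cexp z).
have Fpt r t : 0 < r -> F (pt (ln r) t) = f (polar r t).
  by move=> r0; rewrite /F /cexp /= lnK.
have ln12 : ln r1 <= ln r2 by rewrite ler_ln.
have dF : rect_cdiff F (ln r1) (- pi) (ln r2 - ln r1) (pi + pi).
  move=> s t hs ht; apply: (@cdiff_comp _ (@cexp R)); first exact: cdiff_cexp.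
  apply: df; rewrite /cexp nrmM nrm_cis mulr1 nrm_real /= gtr0_norm ?expR_gt0 //.
  rewrite -{1}(lnK r10) -[X in _ && (_ <= X)](lnK r20) !ler_expR.
  by rewrite addrC subrK in hs.
have := goursat _ _ dF; rewrite subr_ge0 => /(_ ln12) G.
have {}G : 0 = rect_int F (ln r1) (- pi) (ln r2 - ln r1) (pi + pi) by rewrite G //; lra.
move: G; rewrite /rect_int (addrC (ln r1)) subrK addKr.
rewrite (_ : cint (ln r1) _ _ = 0); last first.
  rewrite (@eq_cint _ _ _ _ (fun=> 0)) ?cint_cst ?mulr0 //.
  by move=> s _; rewrite /F /cexp /= cis_pi subrr.
rewrite add0r => /esym/eqP; rewrite mulf_eq0 (negbTE (neq0Ci _)) /=.
have [_ pI] : path_integrable (fun s => F (pt s (- pi)) - F (pt s (- pi + (pi + pi)))) (ln r1) (ln r1 + (ln r2 - ln r1)) /\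
  path_integrable (fun t => F (pt (ln r1 + (ln r2 - ln r1)) t) - F (pt (ln r1) t)) (- pi) (- pi + (pi + pi)).
  by apply: rect_path => //; lra.
have cc r : r1 <= r <= r2 -> ccirc f r.
  move=> hr t ht; apply/cdiff_cont/df; rewrite nrm_polar0 //.
  by case/andP: hr => /(le_trans (ltW r10)).
rewrite (@eq_cint _ _ _ _ (fun t => f (polar r2 t) - f (polar r1 t))); last first.
  by move=> t _; rewrite !Fpt.
rewrite cintB; [|by apply/ccirc_path/cc; lra|by apply/ccirc_path/cc; lra].
by rewrite subr_eq0 /avg => /eqP ->.
Qed.

(** On either side of the exceptional circle the mean is constant by [avg_const], and continuity in
    the radius joins both constants to the mean over that circle. *)
Lemma avg_cross f (a r0 b : R) : 0 <= a -> a < r0 -> r0 < b ->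
  (forall z, a < nrm z < b -> {for z, continuous f}) ->
  (forall z, a < nrm z < b -> nrm z != r0 -> cdiff f z) ->
  forall r1 r2, a < r1 < b -> a < r2 < b -> avg f r1 = avg f r2.
Proof.
move=> a0 ar rb cf df.
suff H r1 : a < r1 < b -> avg f r1 = avg f r0 by move=> r1 r2 /H -> /H ->.
move=> /andP[ar1 r1b]; apply/eqP; rewrite -subr_eq0; apply/eqP.
apply: nrm_le_eps => e e0.
have d0 : 0 < Num.min (r0 - a) (b - r0) by rewrite lt_min; lra.
have cc r : a < r < b -> ccirc f r.
  by move=> hr t _; apply: cf; rewrite nrm_polar0 //; lra.
have [|d d1 hd] := @avg_continuous f r0 _ d0 _ _ e0.
  move=> r; rewrite lt_min !ltr_norml => ?; apply: cc; lra.
have [r1r0|r0r1|->] := ltgtP r1 r0; last by rewrite subrr nrm0 ltW.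
- pose s := Num.max r1 (r0 - d / 2).
  have [s1 s2] : r1 <= s /\ r0 - d / 2 <= s by rewrite /s !le_max !lexx orbT.
  have s3 : s < r0 by rewrite gt_max; lra.
  clearbody s.
  have -> : avg f r1 = avg f s.
    by apply: avg_const => [|z hz]; [lra|apply: df; lra].
  by apply: hd; rewrite ltr_norml; lra.
- pose s := Num.min r1 (r0 + d / 2).
  have [s1 s2] : s <= r1 /\ s <= r0 + d / 2 by rewrite /s !ge_min !lexx orbT.
  have s3 : r0 < s by rewrite lt_min; lra.
  clearbody s.
  have <- : avg f s = avg f r1.
    by apply: avg_const => [|z hz]; [lra|apply: df; lra].
  by apply: hd; rewrite ltr_norml; lra.
Qed.

(** The radius may be shrunk at will, and over a small circle [f] is close to [f 0]. *)
Lemma avg_center f (b r : R) : 0 < r < b -> {for 0, continuous f} ->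
  (forall z, 0 < nrm z < b -> cdiff f z) -> avg f r = f 0.
Proof.
move=> /andP[r0 rb] cf df; apply/eqP; rewrite -subr_eq0; apply/eqP.
apply: nrm_le_eps => e e0; have e2 : 0 < e / 2 by lra.
have [d d0 hd] := iffLR (ccontP _ _) cf _ e2.
pose s := Num.min r (d / 2).
have s0 : 0 < s by rewrite lt_min r0; lra.
have [s1 s2] : s <= r /\ s <= d / 2 by rewrite /s !ge_min !lexx orbT.
clearbody s.
have <- : avg f s = avg f r.
  by apply: avg_const => [|z hz]; [lra|apply: df; lra].
have cs : ccirc f s by move=> t _; apply/cdiff_cont/df; rewrite nrm_polar0; lra.
have -> : avg f s - f 0 = avg (fun z => f z - f 0) s.
  by rewrite (avgB cs (@ccirc_cst _ _)) avg_cst.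
have -> : e = 2 * (e / 2) by field.
apply: avg_bound.
  exact: (ccircB cs (@ccirc_cst _ _)).
move=> t _; apply: ltW; apply: hd; rewrite subr0 nrm_polar0; lra.
Qed.

End CircleAverage.

(** * Uniqueness theorems and the mean value property *)

Section Uniqueness.
Context {R : realType}.
Implicit Types (f g G : R[i] -> R[i]) (r t : R) (z w c : R[i]).

Lemma cdiff_invX n z : z != 0 -> cdiff (fun w => w ^- n) z.
Proof.
by move=> z0; apply: cdiffV; rewrite ?expf_neq0 //; apply: cdiffX; exact: cdiff_id.
Qed.

Lemma ccirc_cdiff f r : 0 <= r -> (forall z, nrm z = r -> cdiff f z) -> ccirc f r.
Proof. by move=> r0 df t _; apply/cdiff_cont/df; rewrite nrm_polar0. Qed.

Lemma ccirc_invX n r : 0 < r -> ccirc (fun z => z ^- n) r.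
Proof.
move=> r0; apply: ccirc_cdiff => [|z zr]; first exact: ltW.
by apply: cdiff_invX; rewrite -nrm_gt0 zr.
Qed.

Lemma avg_scale_invX n r : 0 < r ->
  avg (fun z => z ^- n) r = (r ^- n)%:C%C * avg (fun z => z ^- n) 1.
Proof.
move=> r0; rewrite -avgZ; last exact: ccirc_invX.
rewrite /avg; congr (_ * _); apply: eq_cint => t _.
by rewrite /polar rmorph1 mul1r exprMn invfM fmorphV rmorphXn.
Qed.

(** The mean over the circle of radius 2 is [2 ^- n] times the one over the unit circle by
    homogeneity, and equal to it by [avg_const]. *)
Lemma avg_invX n r : (0 < n)%N -> 0 < r -> avg (fun z => z ^- n) r = 0.
Proof.
move=> n0 r0; rewrite avg_scale_invX //.
suff -> : avg (fun z => z ^- n) 1 = 0 :> R[i] by rewrite mulr0.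
have h2 : 0 < 2 :> R by lra.
have H : avg (fun z => z ^- n) 1 = avg (fun z : R[i] => z ^- n) (2 : R).
  apply: avg_const => [|z hz]; first lra.
  by apply: cdiff_invX; rewrite -nrm_gt0; lra.
move: H; rewrite (avg_scale_invX _ h2) => /eqP; rewrite -subr_eq0 -{1}[avg _ _]mul1r.
rewrite -mulrBl mulf_eq0 -(rmorph1 (real_complex R)) -rmorphB /= => /orP[|/eqP //].
rewrite (inj_eq (@complexI R)) subr_eq0 eq_sym invr_eq1 => /eqP h.
have : (2 : R) ^+ n > 1 by rewrite exprn_egt1 ?ltr1n // -lt0n.
by rewrite h ltxx.
Qed.

Lemma geometric_split z w N : z != 0 -> z != w ->
  z / (z - w) = \sum_(i < N) w ^+ i * z ^- i + (w / z) ^+ N * (z / (z - w)).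
Proof.
move=> z0 zw; have zw0 : z - w != 0 by rewrite subr_eq0.
elim: N => [|N ih]; first by rewrite big_ord0 add0r expr0 mul1r.
rewrite {1}ih big_ord_recr /= -addrA; congr (_ + _).
rewrite -expr_div_n exprS; set q := _ ^+ N; field; apply/andP; split => //.
Qed.

Lemma small_expr (K q e : R) : 0 <= q < 1 -> 0 < e ->
  exists N : nat, K * q ^+ N.+1 <= e.
Proof.
move=> /andP[q0 q1] e0.
have K1 : 0 < `|K| + 1 by have := normr_ge0 K; lra.
have : `|q| < 1 by rewrite ger0_norm.
move=> /cvg_expr /cvgrPdist_lt /(_ _ (divr_gt0 e0 K1)) [N _ /(_ N.+1 (leqnSn _))] /=.
rewrite sub0r normrN normrX (ger0_norm q0) => h; exists N.
rewrite ltr_pdivlMr // in h; apply: le_trans (ltW h); rewrite mulrC ler_wpM2l ?exprn_ge0 //.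
by have := ler_norm K; lra.
Qed.

(* For [r1 < |w| < r2] compare the averages over the two circles of
   [(G z - G w) z / (z - w)], which is continuous across [w]: the inner one is
   the value [0] at the centre, the outer one is [- G w]. *)
Lemma holo_coef_eq0 G (b : R) : {for 0, continuous G} -> G 0 = 0 ->
  (forall z, 0 < nrm z < b -> cdiff G z) ->
  (forall n r, 0 < r < b -> avg (fun z => G z * z ^- n) r = 0) ->
  forall w, nrm w < b -> G w = 0.
Proof.
move=> c0 G0 dG coef w wb.
have [->//|w0] := eqVneq w 0; have w1 : 0 < nrm w by rewrite nrm_gt0.
(* The Caratheodory quotient [g] of [G] at [w] fills the gap: off [w], [Psi z] is [g z * z], which
   is continuous at [w] as well. *)
have [g cg gE] := dG w ltac:(by rewrite w1).
pose Psi z := (G z - G w) * z / (z - w).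
have cG z : nrm z < b -> {for z, continuous G}.
  move=> zb; have [->|z0] := eqVneq z 0; first exact: c0.
  by apply/cdiff_cont/dG; rewrite nrm_gt0 z0.
have PsiE z : z != w -> Psi z = g z * z.
  by move=> zw; rewrite /Psi gE; field; rewrite subr_eq0.
have dPsi z : 0 < nrm z < b -> z != w -> cdiff Psi z.
  move=> zb zw; apply: cdiffM; last first.
    apply: cdiffV; rewrite ?subr_eq0 //.
    by apply: cdiffB; [exact: cdiff_id|exact: cdiff_cst].
  apply: cdiffM; last exact: cdiff_id.
  by apply: cdiffB; [exact: dG|exact: cdiff_cst].
have dPhi z : 0 < nrm z < b -> z != w -> cdiff (fun z => g z * z) z.
  move=> zb zw; apply: cdiff_near (dPsi _ zb zw).
  exists (nrm (z - w)); first by rewrite nrm_gt0 subr_eq0.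
  move=> u hu; apply: PsiE; apply: contraTneq hu => ->.
  by rewrite nrm_distC ltxx.
have cPhi z : 0 < nrm z < b -> {for z, continuous (fun z => g z * z)}.
  move=> zb; have [->|zw] := eqVneq z w; last exact/cdiff_cont/dPhi.
  exact: (contM cg (@cont_id _ _)).
pose r1 := nrm w / 2; pose r2 := (nrm w + b) / 2.
have r1w : 0 < r1 < nrm w by rewrite /r1; lra.
have r2w : nrm w < r2 < b by rewrite /r2; lra.
have e12 : avg (fun z => g z * z) r1 = avg (fun z => g z * z) r2.
  apply: (@avg_cross _ _ 0 (nrm w) b) => //; [|lra|lra].
  move=> z hz zw; apply: dPhi => //; apply: contraNneq zw => ->; exact: eqxx.
have eP r : 0 < r -> r != nrm w -> avg (fun z => g z * z) r = avg Psi r.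
  move=> r0 rw; apply: eq_avg => t _; rewrite PsiE //.
  by apply: contraNneq rw => <-; rewrite nrm_polar0 // ltW.
rewrite eP in e12; [|lra|by rewrite lt_eqF //; lra].
rewrite eP in e12; [|lra|by rewrite gt_eqF //; lra].
have in0 : avg Psi r1 = 0.
  rewrite (@avg_center _ _ (nrm w)); [|exact: r1w| |].
  - by rewrite /Psi mulr0 mul0r.
  - have H0 : {for 0, continuous (fun z : R[i] => z - w)}.
      exact: (contB (@cont_id _ _) (@cont_cst _ _ _)).
    have n0 : (fun z => z - w) 0 != 0 by rewrite /= sub0r oppr_eq0.
    have H1 : {for 0, continuous (fun z : R[i] => (z - w)^-1)}.
      exact: (@contV _ (fun z => z - w) _ n0 H0).
    have H2 : {for 0, continuous (fun z : R[i] => G z - G w)}.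
      exact: (contB c0 (@cont_cst _ _ _)).
    exact: (contM (contM H2 (@cont_id _ _)) H1).
  - move=> z hz; apply: dPsi; first by lra.
    by apply: contraTneq (proj2 (andP hz)) => ->; rewrite ltxx.
have r20 : 0 < r2 by lra.
have cGr2 : ccirc (fun z => G z - G w) r2.
  apply: ccircB; last exact: ccirc_cst.
  by move=> t _; apply: cG; rewrite nrm_polar0; lra.
have cP : ccirc Psi r2.
  apply: ccirc_cdiff; first exact: ltW.
  move=> z zr; apply: dPsi; first by lra.
  by apply/eqP => zw; move: zr; rewrite zw; lra.
suff out : avg Psi r2 = - G w.
  by apply/eqP; rewrite -oppr_eq0 -out -e12 in0.
apply/eqP; rewrite -subr_eq0; apply/eqP; apply: nrm_le_eps => e e0.
have [K K0 HK] := ccirc_bounded cP.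
pose q := nrm w / r2.
have q01 : 0 <= q < 1.
  by rewrite /q divr_ge0 ?nrm_ge0 ?ltW // ltr_pdivrMr // mul1r; lra.
have [N HN] := small_expr (2 * K) q01 e0.
pose T i z := w ^+ i * ((G z - G w) * z ^- i).
have cT i : ccirc (T i) r2.
  exact: (ccircM (@ccirc_cst _ (w ^+ i) r2) (ccircM cGr2 (@ccirc_invX i r2 r20))).
(* In the expansion of [z / (z - w)] in powers of [w / z], the part with [G z] has mean zero by
   hypothesis, and the constant [G w] survives only at order 0. *)
have aT i : avg (T i) r2 = if i == 0%N then - G w else 0.
  have cGi : ccirc (fun z => G z * z ^- i) r2.
    have cGc : ccirc G r2 by move=> t _; apply: cG; rewrite nrm_polar0; lra.
    exact: (ccircM cGc (@ccirc_invX i r2 r20)).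
  rewrite /T avgZ; last exact: (ccircM cGr2 (@ccirc_invX i r2 r20)).
  under [X in _ * avg X _]eq_fun do rewrite mulrBl.
  rewrite (avgB cGi (ccircM (@ccirc_cst _ (G w) r2) (@ccirc_invX i r2 r20))).
  rewrite coef ?sub0r; last by lra.
  rewrite (avgZ _ (@ccirc_invX i r2 r20)).
  case: i {cGi} => [|i] /=; last by rewrite avg_invX // mulr0 oppr0 mulr0.
  under eq_fun do rewrite expr0 invr1.
  by rewrite avg_cst expr0 mul1r mulr1.
pose E z := (w / z) ^+ N.+1 * Psi z.
have PE t : Psi (polar r2 t) = \sum_(i <- index_iota 0 N.+1) T i (polar r2 t) + E (polar r2 t).
  have z0 : polar r2 t != 0 by rewrite -nrm_gt0 (nrm_polar0 _ (ltW r20)).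
  have zw : polar r2 t != w.
    by apply: contraTneq (proj1 (andP r2w)) => <-; rewrite (nrm_polar0 _ (ltW r20)) ltxx.
  rewrite /E {1}/Psi -mulrA (@geometric_split _ w N.+1) // mulrDr; congr (_ + _).
    rewrite mulr_sumr big_mkord; apply: eq_bigr => i _; rewrite /T mulrCA //.
  by rewrite /Psi -!mulrA mulrCA.
have cE : ccirc E r2.
  suff cq : ccirc (fun z => (w / z) ^+ N.+1) r2 by exact: (ccircM cq cP).
  apply: ccirc_cdiff; first exact: ltW.
  move=> z zr; apply: cdiffX; apply: cdiffM; first exact: cdiff_cst.
  by apply: cdiff_inv; rewrite -nrm_gt0 zr.
rewrite (@eq_avg _ _ (fun z => \sum_(i <- index_iota 0 N.+1) T i z + E z)); last by move=> t _.
rewrite (avgD (@ccirc_sum _ _ _ _ _ cT) cE).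
rewrite (avg_sum _ cT) big_nat_recl // aT /= big1 => [|i _]; last by rewrite aT.
rewrite addr0 [X in X - _]addrC addrK (le_trans _ HN) // -mulrA.
apply: (avg_bound cE) => t ht; rewrite /E nrmM nrmX nrmM nrmV nrm_polar0 ?(ltW r20) // -/q.
by rewrite [leRHS]mulrC ler_wpM2l ?HK ?exprn_ge0 //; case/andP: q01.
Qed.

(** All Laurent coefficients about [z0] may be computed over a circle inside the disc where [f]
    vanishes. *)
Lemma identity_disc f z0 (b d : R) : 0 < d ->
  (forall z, nrm (z - z0) < b -> cdiff f z) ->
  (forall z, nrm (z - z0) < d -> f z = 0) ->
  forall z, nrm (z - z0) < b -> f z = 0.
Proof.
move=> d0 df fz z zb; pose G w := f (z0 + w).
have dG w : nrm w < b -> cdiff G w.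
  move=> wb; apply: (@cdiff_comp _ (fun w => z0 + w)).
    by apply: cdiffD; [exact: cdiff_cst|exact: cdiff_id].
  by apply: df; rewrite addrAC subrr add0r.
have Gz w : nrm w < d -> G w = 0.
  by move=> wd; apply: fz; rewrite addrAC subrr add0r.
have b0 : 0 < b by apply: le_lt_trans zb; exact: nrm_ge0.
have -> : f z = G (z - z0) by rewrite /G addrC subrK.
apply: (@holo_coef_eq0 G b); [| | | |by []].
- by apply/cdiff_cont/dG; rewrite nrm0.
- by apply: Gz; rewrite nrm0.
- by move=> w /andP[_]; exact: dG.
move=> n r /andP[r0 rb]; pose s := Num.min r (d / 2).
have s0 : 0 < s by rewrite lt_min r0; lra.
have [s1 s2] : s <= r /\ s <= d / 2 by rewrite /s !ge_min !lexx orbT.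
clearbody s.
have <- : avg (fun z => G z * z ^- n) s = avg (fun z => G z * z ^- n) r.
  apply: avg_const => [|w hw]; first lra.
  by apply: cdiffM; [apply: dG; lra|apply: cdiff_invX; rewrite -nrm_gt0; lra].
rewrite (@eq_avg _ _ (fun=> 0)) ?avg_cst // => t _.
by rewrite Gz ?mul0r // nrm_polar0; lra.
Qed.

(** A nonnegative continuous function with mean zero over a circle vanishes on it; the point wanted,
    straight above [z0], is the one at angle [pi / 2]. *)
Lemma mean_value_Im f z0 (b : R) :
  (forall z, nrm (z - z0) < b -> cdiff f z) ->
  (forall z, nrm (z - z0) < b -> 0 <= complex.Im (f z)) ->
  complex.Im (f z0) = 0 ->
  forall s, 0 <= s < b -> complex.Im (f (z0 + 'i * s%:C%C)) = 0.
Proof.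
move=> df f0 fz s /andP[]; rewrite le_eqVlt => /predU1P[<-|s0] sb.
  by rewrite mulr0 addr0.
have p0 := @pi0 R.
pose G w := f (z0 + w).
have dG w : nrm w < b -> cdiff G w.
  move=> wb; apply: (@cdiff_comp _ (fun w => z0 + w)).
    by apply: cdiffD; [exact: cdiff_cst|exact: cdiff_id].
  by apply: df; rewrite addrAC subrr add0r.
have : avg G s = G 0.
  apply: (@avg_center _ _ b); first by rewrite s0.
    by apply/cdiff_cont/dG; rewrite nrm0; lra.
  by move=> z hz; apply: dG; lra.
have cs t : pcont (fun t => G (polar s t)) t.
  apply: pcont_comp; last exact: pcont_polar.
  by apply/cdiff_cont/dG; rewrite nrm_polar0 // ltW.
move=> /(congr1 (@complex.Im R)); rewrite /G addr0 fz /avg ImM Re_real Im_real mul0r addr0.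
rewrite Im_cint => /eqP; rewrite mulf_eq0 invr_eq0 => /orP[/eqP|/eqP]; first lra.
move=> I0; have := @Rintegral_eq0 _ (- pi) pi _ _ _ _ I0 (pi / 2).
rewrite /polar /cis cos_pihalf sin_pihalf.
have -> : z0 + s%:C%C * (0 +i* 1)%C = z0 + 'i * s%:C%C.
  by rewrite mulrC -complexiE.
apply; [lra| | |lra].
- by move=> t _; have /pcontP[] := cs t.
- move=> t _; apply: f0; rewrite addrAC subrr add0r -/(polar s t) nrm_polar0 //.
  exact: ltW.
Qed.

(** A point at height at least [y] is the centre of a disc of radius at least [y] in the upper
    half-plane, so a move of length [y / 2] upwards is always allowed, and finitely many moves reach
    any height. *)
Lemma climb (P : R[i] -> Prop) z0 : 0 < complex.Im z0 ->
  (forall z, 0 < complex.Im z -> P z -> forall s, 0 <= s < complex.Im z ->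
     P (z + 'i * s%:C%C)) ->
  P z0 -> forall s, 0 <= s -> P (z0 + 'i * s%:C%C).
Proof.
move=> y0 step P0; set y := complex.Im z0 in y0.
have main n s : 0 <= s <= n%:R * (y / 2) -> P (z0 + 'i * s%:C%C).
  elim: n s => [|n ih] s.
    rewrite mul0r => hs; have -> : s = 0 by lra.
    by rewrite mulr0 addr0.
  rewrite -[n.+1]addn1 natrD mulrDl mul1r => hs.
  (* The height reached before the last move of length at most [y / 2]. *)
  pose s' := Num.max 0 (s - y / 2).
  have [s1 s2] : 0 <= s' /\ s - y / 2 <= s' by rewrite /s' !le_max !lexx orbT.
  have n0 : 0 <= n%:R * (y / 2) by rewrite mulr_ge0 //; lra.
  have s3 : s' <= n%:R * (y / 2) by rewrite ge_max n0; lra.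
  have s4 : s' <= s by rewrite ge_max; lra.
  clearbody s'.
  have hs' : 0 <= s' <= n%:R * (y / 2) by rewrite s1.
  have eI : complex.Im (z0 + 'i * s'%:C%C) = y + s'.
    by rewrite ImD ImM Re_i Im_i /= mul0r add0r mul1r.
  have := @step (z0 + 'i * s'%:C%C) _ (ih _ hs') (s - s').
  rewrite eI -addrA -mulrDr -rmorphD /= (addrC s') subrK; apply; lra.
move=> s s0; pose n := Num.Def.archi_bound (s / (y / 2)).
apply: (main n); rewrite s0 /= -ler_pdivrMr; last lra.
by apply/ltW/archi_boundP; rewrite divr_ge0 //; lra.
Qed.

End Uniqueness.

(** * Hilbert spaces *)

Section HilbertBasics.
Context {R : realType} {H : hilbertType R}.
Implicit Types (x y z : H) (a c : R[i]) (u : nat -> H).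

Lemma innerDl x y z : inner (x + y) z = inner x z + inner y z.
Proof. exact: linearDl. Qed.
Lemma innerDr x y z : inner x (y + z) = inner x y + inner x z.
Proof. exact: linearDr. Qed.
Lemma innerZl a x y : inner (a *: x) y = a * inner x y.
Proof. exact: (@linearZl_LR _ _ _ _ _ _ (inner : {dot H for Num.conj})). Qed.
Lemma innerZr a x y : inner x (a *: y) = a^* * inner x y.
Proof. exact: (@linearZr_LR _ _ _ _ _ _ (inner : {dot H for Num.conj})). Qed.
Lemma innerNl x y : inner (- x) y = - inner x y.
Proof. exact: linearNl. Qed.
Lemma innerNr x y : inner x (- y) = - inner x y.
Proof. exact: linearNr. Qed.
Lemma innerBl x y z : inner (x - y) z = inner x z - inner y z.
Proof. by rewrite innerDl innerNl. Qed.
Lemma innerBr x y z : inner x (y - z) = inner x y - inner x z.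
Proof. by rewrite innerDr innerNr. Qed.
Lemma inner0r x : inner x 0 = 0.
Proof. exact: linear0r. Qed.
Lemma inner_conj x y : (inner x y)^* = inner y x.
Proof.
by rewrite [RHS](@hermitian_subproof _ _ _ _ (inner : {dot H for Num.conj})) expr0 mul1r.
Qed.

Lemma inner_nrm x : inner x x = (nrm x ^+ 2)%:C%C.
Proof. by rewrite -inner_norm normE rmorphXn. Qed.

Lemma inner_sumr (I : Type) (s : seq I) (P : pred I) (F : I -> H) x :
  inner x (\sum_(i <- s | P i) F i) = \sum_(i <- s | P i) inner x (F i).
Proof. exact: linear_sumr. Qed.

Lemma inner_suml (I : Type) (s : seq I) (P : pred I) (F : I -> H) x :
  inner (\sum_(i <- s | P i) F i) x = \sum_(i <- s | P i) inner (F i) x.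
Proof. exact: linear_sumlz. Qed.

Lemma nrmD_sqr x y :
  nrm (x + y) ^+ 2 = nrm x ^+ 2 + 2 * complex.Re (inner x y) + nrm y ^+ 2.
Proof.
apply: complexI; rewrite -inner_nrm innerDl !innerDr !inner_nrm -(inner_conj x y).
by apply: complex_ext; rewrite ?(ReD, ImD) ?Re_conj ?Im_conj /=; ring.
Qed.

Lemma nrmB_sqr x y :
  nrm (x - y) ^+ 2 = nrm x ^+ 2 - 2 * complex.Re (inner x y) + nrm y ^+ 2.
Proof. by rewrite nrmD_sqr innerNr ReN nrmN; ring. Qed.

Lemma parallelogram x y :
  nrm (x + y) ^+ 2 + nrm (x - y) ^+ 2 = 2 * nrm x ^+ 2 + 2 * nrm y ^+ 2.
Proof. by rewrite nrmD_sqr nrmB_sqr; ring. Qed.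

Lemma cauchy_schwarz x y : nrm (inner x y) <= nrm x * nrm y.
Proof.
have [->|y0] := eqVneq y 0; first by rewrite inner0r !nrm0 mulr0.
have ny : 0 < nrm y by rewrite nrm_gt0.
rewrite -(@ler_pXn2r _ 2) ?nnegrE ?mulr_ge0 ?nrm_ge0 //.
set c := inner x y; pose t := c / (nrm y ^+ 2)%:C%C.
have /eqP := nrmB_sqr x (t *: y).
have h : 0 <= nrm (x - t *: y) ^+ 2 by rewrite exprn_ge0 ?nrm_ge0.
rewrite nrmZ innerZr -/c /t.
have -> : (c / (nrm y ^+ 2)%:C%C)^* * c = (nrm c ^+ 2 / nrm y ^+ 2)%:C%C.
  by rewrite -fmorphV [(c * _)^*]rmorphM /= conj_real mulrC mulrA mul_conj -rmorphM.
rewrite Re_real nrmM nrmV nrm_real ger0_norm ?exprn_ge0 ?nrm_ge0 // => /eqP e.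
rewrite {}e in h.
have {}h : 0 <= nrm x ^+ 2 - nrm c ^+ 2 / nrm y ^+ 2.
  apply: le_trans h _; rewrite le_eqVlt; apply/orP; left; apply/eqP; field.
  by rewrite gt_eqF.
by rewrite subr_ge0 ler_pdivrMr ?exprn_gt0 // in h; rewrite exprMn.
Qed.

Lemma inner_ext y y' : (forall x, inner x y = inner x y') -> y = y'.
Proof.
move=> h; apply/eqP; rewrite -subr_eq0; apply/eqP/nrm0_eq0.
have : inner (y - y') (y - y') = 0 by rewrite innerBr h subrr.
by rewrite inner_nrm => /complexI/eqP; rewrite expf_eq0 => /eqP.
Qed.

End HilbertBasics.

Section SequenceLimits.
Context {R : realType}.

Definition seq_lim {V : normedModType R[i]} (u : nat -> V) (l : V) :=
  forall e : R, 0 < e -> exists N, forall n, (N <= n)%N -> nrm (u n - l) < e.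

Lemma seq_lim_unique {V : normedModType R[i]} (u : nat -> V) (l l' : V) :
  seq_lim u l -> seq_lim u l' -> l = l'.
Proof.
move=> h h'; apply/eqP; rewrite -subr_eq0; apply/eqP; apply: nrm_le_eps => e e0.
have e2 : 0 < e / 2 by lra.
have [N hN] := h _ e2; have [N' hN'] := h' _ e2.
have := hN _ (leq_maxl N N'); have := hN' _ (leq_maxr N N').
set n := maxn _ _ => h1 h2.
have -> : l - l' = (u n - l') - (u n - l).
  by rewrite opprB [RHS]addrC addrA subrK.
by rewrite (le_trans (nrmB _ _)) //; lra.
Qed.

Context {H : hilbertType R}.
Implicit Types (x y : H) (u : nat -> H).

Lemma hilbert_complete u :
  (forall e : R, 0 < e -> exists N, forall m n, (N <= m)%N -> (N <= n)%N ->
     nrm (u m - u n) < e) -> exists l, seq_lim u l.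
Proof.
move=> cu; have : cauchy (u @ \oo).
  apply/cauchy_exP => e; rewrite gt0_complexE => /andP[/eqP eI eR].
  have -> : e = (complex.Re e)%:C%C by apply: complex_ext.
  have [N hN] := cu _ eR; exists (u N); exists N => // n /= Nn.
  by rewrite -ball_normE /ball_ /= lt_nrm; apply: hN.
move=> /cauchy_cvg /cvg_ex[l hl]; exists l => e e0.
have : (0 : R[i]) < e%:C%C by rewrite ltcR.
move=> e0'; have [N _ hN] := iffLR (cvgrPdist_lt _ _) hl _ e0'.
by exists N => n /hN /=; rewrite lt_nrm nrm_distC.
Qed.

Lemma geometric_sum_bound (q : R) m k : 0 <= q < 1 ->
  \sum_(m <= i < m + k) q ^+ i <= q ^+ m / (1 - q).
Proof.
move=> /andP[q0 q1]; have q2 : 0 < 1 - q by lra.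
suff -> : \sum_(m <= i < m + k) q ^+ i = q ^+ m * (1 - q ^+ k) / (1 - q).
  rewrite ler_pM2r ?invr_gt0 // -[leRHS]mulr1 ler_wpM2l ?exprn_ge0 //.
  by rewrite gerBl exprn_ge0.
elim: k => [|k ih]; first by rewrite addn0 big_geq // expr0 subrr mulr0 mul0r.
rewrite addnS big_nat_recr ?leq_addr //= ih exprS exprD; field.
by apply/eqP; lra.
Qed.

Lemma geometric_cauchy u (C q : R) : 0 <= C -> 0 <= q < 1 ->
  (forall n, nrm (u n.+1 - u n) <= C * q ^+ n) -> exists l, seq_lim u l.
Proof.
move=> C0 q01 hu; apply: hilbert_complete => e e0.
have /andP[q0 q1] := q01; have q2 : 0 < 1 - q by lra.
have hd m k : nrm (u (m + k)%N - u m) <= C * (q ^+ m / (1 - q)).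
  have h1 : nrm (u (m + k)%N - u m) <= \sum_(m <= i < m + k) C * q ^+ i.
    elim: k => [|k ih]; first by rewrite addn0 subrr nrm0 big_geq.
    rewrite addnS big_nat_recr ?leq_addr //=.
    rewrite -(subrK (u (m + k)%N) (u (m + k).+1)) -addrA (le_trans (nrmD _ _)) //.
    by rewrite [leRHS]addrC lerD.
  apply: le_trans h1 _; rewrite -mulr_sumr ler_wpM2l //.
  exact: geometric_sum_bound.
have : `|q| < 1 by rewrite ger0_norm.
have C1 : 0 < (C + 1) / (1 - q) by rewrite divr_gt0 //; lra.
have e3 : 0 < e / 3 by lra.
move=> /cvg_expr /cvgrPdist_lt /(_ _ (divr_gt0 e3 C1)) [N _ hN].
have key m : (N <= m)%N -> nrm (u m - u N) < e / 2.
  move=> Nm; rewrite -(subnKC Nm) (le_lt_trans (hd _ _)) //.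
  have := hN N (leqnn N); rewrite /= sub0r normrN normrX (ger0_norm q0).
  rewrite ltr_pdivlMr // => h; apply: (@le_lt_trans _ _ (e / 3)); last lra.
  apply: le_trans (ltW h); rewrite mulrCA ler_wpM2l ?exprn_ge0 // ler_pM2r ?invr_gt0 //.
  lra.
exists N => m n Nm Nn.
have -> : u m - u n = (u m - u N) - (u n - u N) by rewrite opprB addrA subrK.
by rewrite (le_lt_trans (nrmB _ _)) //; have := key _ Nm; have := key _ Nn; lra.
Qed.

Lemma seq_lim_inner u l y : seq_lim u l -> seq_lim (fun n => inner (u n) y) (inner l y).
Proof.
move=> hu e e0; have y1 : 0 < nrm y + 1 by have := nrm_ge0 y; lra.
have [N hN] := hu _ (divr_gt0 e0 y1); exists N => n /hN h.
rewrite -innerBl (le_lt_trans (cauchy_schwarz _ _)) //.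
rewrite ltr_pdivlMr // in h; apply: le_lt_trans h.
by rewrite ler_wpM2l ?nrm_ge0 //; lra.
Qed.

End SequenceLimits.

(** * Riesz representation and inversion of coercive operators *)

Section RieszLaxMilgram.
Context {R : realType} {H : hilbertType R}.
Implicit Types (x y z : H) (a c : R[i]) (u : nat -> H).

(* The representer is the minimizer of [|x|^2 - 2 Re (phi x)]. *)
Lemma riesz (phi : H -> R[i]) (C : R) : 0 <= C ->
  (forall x y, phi (x + y) = phi x + phi y) ->
  (forall a x, phi (a *: x) = a * phi x) ->
  (forall x, nrm (phi x) <= C * nrm x) ->
  exists y, forall x, phi x = inner x y.
Proof.
move=> C0 phiD phiZ phib.
have phiN x : phi (- x) = - phi x by rewrite -scaleN1r phiZ mulN1r.
pose F x := nrm x ^+ 2 - 2 * complex.Re (phi x).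
have F_ge x : - C ^+ 2 <= F x.
  have h1 := le_trans (le_trans (ler_norm _) (Re_le_nrm _)) (phib x).
  have : 0 <= (nrm x - C) ^+ 2 by rewrite sqr_ge0.
  rewrite /F; nra.
have hi : has_inf (range F).
  by split; [exists (F 0), 0|exists (- C ^+ 2) => _ [x _ <-]].
set m := inf (range F).
have mF x : m <= F x by apply: ge_inf; [exact: hi.2|exists x].
have Fa (e : R) : 0 < e -> exists x, F x < m + e.
  by move=> e0; have [_ [x _ <-] hx] := inf_adherent e0 hi; exists x.
have [u hu] : exists u, forall n, F (u n) < m + n.+1%:R^-1.
  have h n : exists x, F x < m + n.+1%:R^-1 by apply: Fa; rewrite invr_gt0.
  by have [u hu] := choice h; exists u.
(* Since [F] at the midpoint is at least [m], two near-minimizers are close to each other, and a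
   minimizing sequence is Cauchy. *)
have Fpar x y : nrm (x - y) ^+ 2 = 2 * F x + 2 * F y - 4 * F (2^-1 *: (x + y)).
  rewrite /F phiZ phiD nrmZ nrmV.
  have -> : nrm (2 : R[i]) = 2 by rewrite -(rmorph_nat (real_complex R) 2) nrm_real normr_nat.
  have -> : (2 : R[i])^-1 = (2^-1)%:C%C by rewrite fmorphV rmorph_nat.
  have := parallelogram x y; rewrite ReM Re_real Im_real mul0r subr0 ReD exprMn.
  have -> : (2^-1 : R) ^+ 2 = 4^-1 by field.
  move=> h; lra.
have inv_small (e : R) : 0 < e -> exists N, forall n, (N <= n)%N -> n.+1%:R^-1 < e.
  move=> e0; exists (Num.Def.archi_bound e^-1) => n hn.
  rewrite -[e]invrK ltf_pV2 ?posrE ?invr_gt0 //.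
  apply: (lt_le_trans (archi_boundP _)); first by rewrite invr_ge0 ltW.
  by rewrite ler_nat ltnW.
have [y hy] : exists l, seq_lim u l.
  apply: hilbert_complete => e e0.
  have e8 : 0 < e ^+ 2 / 4 by rewrite divr_gt0 // exprn_gt0.
  have [N hN] := inv_small _ e8; exists N => p q /hN hp /hN hq.
  rewrite -(@ltr_pXn2r _ 2) ?nnegrE ?nrm_ge0 ?(ltW e0) // Fpar.
  have := mF (2^-1 *: (u p + u q)); have := hu p; have := hu q.
  by move: hp hq; set P := p.+1%:R^-1; set Q := q.+1%:R^-1; move=> *; lra.
exists y => x; apply/eqP; rewrite eq_sym -subr_eq0; apply/eqP.
pose K := nrm x ^+ 2 + 1.
have K1 : 1 <= K by rewrite /K lerDr exprn_ge0 // nrm_ge0.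
have bound n : nrm (inner x (u n) - phi x) ^+ 2 <= K * n.+1%:R^-1.
  set c := inner x (u n) - phi x.
  have cE : inner x (u n) = c + phi x by rewrite /c subrK.
  clearbody c.
  (* This step from [u n] along [x] lowers [F] by at least [nrm c ^+ 2 / K], while [F (u n)] exceeds
     the infimum by less than [n.+1%:R^-1]. *)
  have := mF (u n - (K^-1)%:C%C *: (c^* *: x)); have := hu n.
  rewrite /F nrmB_sqr phiD phiN !phiZ !nrmZ nrm_conj nrm_real !innerZr conj_real.
  rewrite conjCK -(inner_conj x) cE.
  have n0 : 0 < n.+1%:R^-1 :> R by rewrite invr_gt0.
  have cc := nrm_sqr c.
  rewrite ger0_norm; last by rewrite invr_ge0; lra.
  rewrite !(ReM, ImM, ReD, ImD, Re_conj, Im_conj, ReN, ImN, Re_real, Im_real) !exprMn.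
  set N := n.+1%:R^-1 in n0 *; set k := K^-1.
  have kK : k * K = 1 by rewrite mulVf // gt_eqF //; lra.
  set X := complex.Re c in cc *; set Y := complex.Im c in cc *.
  set A := complex.Re (phi x); set B := complex.Im (phi x).
  set A' := complex.Re (phi (u n)); set U := nrm (u n) ^+ 2.
  have k0 : 0 < k by rewrite invr_gt0; lra.
  move=> h1 h2.
  have e1 : k ^+ 2 * (nrm c ^+ 2 * nrm x ^+ 2) = k * nrm c ^+ 2 - k ^+ 2 * nrm c ^+ 2.
    have -> : nrm x ^+ 2 = K - 1 by rewrite /K addrK.
    have -> : k ^+ 2 * (nrm c ^+ 2 * (K - 1)) = k * (k * K) * nrm c ^+ 2 - k ^+ 2 * nrm c ^+ 2 by ring.
    by rewrite kK mulr1.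
  have q0 : 0 <= k ^+ 2 * nrm c ^+ 2 by rewrite mulr_ge0 // exprn_ge0 // ?nrm_ge0 // ltW.
  have h3 : k * nrm c ^+ 2 <= N.
    rewrite e1 in h2; rewrite cc in h2 q0 *.
    by lra.
  have -> : nrm c ^+ 2 = K * (k * nrm c ^+ 2) by rewrite mulrA (mulrC K) kK mul1r.
  by rewrite ler_wpM2l // (le_trans ler01).
apply: nrm_le_eps => e e0.
have lim : seq_lim (fun n => inner x (u n) - phi x) (inner x y - phi x).
  move=> d d0; have [N hN] := seq_lim_inner x hy d0; exists N => n /hN.
  by rewrite opprB addrA subrK -nrm_conj rmorphB /= !inner_conj.
have e2 : 0 < e / 2 by lra.
have [N hN] := lim _ e2.
have K0 : 0 < K by lra.
have e4 : 0 < (e / 2) ^+ 2 / K by rewrite divr_gt0 // exprn_gt0.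
have [N' hN'] := inv_small _ e4.
have h1 := hN _ (leq_maxl N N'); have := hN' _ (leq_maxr N N').
set n := maxn N N' in h1 *; rewrite ltr_pdivlMr // mulrC => h2.
have h3 : nrm (inner x (u n) - phi x) < e / 2.
  rewrite -(@ltr_pXn2r _ 2) ?nnegrE ?nrm_ge0 ?(ltW e2) //.
  exact: le_lt_trans (bound n) h2.
have -> : inner x y - phi x = (inner x (u n) - phi x) - (inner x (u n) - phi x - (inner x y - phi x)).
  by ring.
by rewrite (le_trans (nrmB _ _)) //; lra.
Qed.

Lemma adjointE (A : {linear H -> H}) : bounded_operator A ->
  forall x y, inner (A x) y = inner x (adjoint A y).
Proof.
move=> [K hK] x y.
suff /(xgetPex 0) /(_ x) : exists y', [set y' | forall x, inner (A x) y = inner x y'] y'.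
  by [].
have [||||w hw] := @riesz (fun x => inner (A x) y) (`|K| * nrm y).
- by rewrite mulr_ge0 // nrm_ge0.
- by move=> x1 x2; rewrite linearD innerDl.
- by move=> a x1; rewrite linearZ innerZl.
- move=> x1; rewrite (le_trans (cauchy_schwarz _ _)) // mulrAC ler_wpM2r ?nrm_ge0 //.
  have := hK x1; rewrite !normE -rmorphM /= lecR => /le_trans; apply.
  by rewrite ler_wpM2r ?nrm_ge0 // ler_norm.
by exists w => x1 /=; exact: hw.
Qed.

Lemma bounded_operatorP (T : H -> H) : bounded_operator T <->
  exists2 K : R, 0 < K & forall x, nrm (T x) <= K * nrm x.
Proof.
split; last first.
  by move=> [K _ hK]; exists K => x; rewrite !normE -rmorphM /= lecR.
move=> [K hK]; exists (`|K| + 1) => [|x]; first by have := normr_ge0 K; lra.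
have := hK x; rewrite !normE -rmorphM /= lecR => /le_trans; apply.
by rewrite ler_wpM2r ?nrm_ge0 //; have := ler_norm K; lra.
Qed.

Lemma seq_lim_linear (T : H -> H) (u : nat -> H) l (K : R) : linear T ->
  (forall x, nrm (T x) <= K * nrm x) -> seq_lim u l ->
  seq_lim (fun n => T (u n)) (T l).
Proof.
move=> lT TK hu e e0; have K1 : 0 < `|K| + 1 by have := normr_ge0 K; lra.
have [N hN] := hu _ (divr_gt0 e0 K1); exists N => n /hN h.
have -> : T (u n) - T l = T (u n - l) by rewrite addrC -scaleN1r -lT scaleN1r addrC.
rewrite ltr_pdivlMr // mulrC in h; apply: le_lt_trans h.
rewrite (le_trans (TK _)) // ler_wpM2r ?nrm_ge0 //.
by have := ler_norm K; lra.
Qed.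

Lemma coercive_injective (T : H -> H) c (g : R) : 0 < g ->
  (forall x, g * nrm x ^+ 2 <= complex.Re (c * inner (T x) x)) ->
  forall x, g * nrm x <= nrm c * nrm (T x).
Proof.
move=> g0 hT x; have [->|x0] := eqVneq x 0.
  by rewrite nrm0 mulr0 mulr_ge0 ?nrm_ge0.
have nx : 0 < nrm x by rewrite nrm_gt0.
rewrite -(@ler_pM2r _ (nrm x)) // -mulrA -expr2 (le_trans (hT x)) //.
rewrite (le_trans (ler_norm _)) // (le_trans (Re_le_nrm _)) // nrmM -mulrA.
by rewrite ler_wpM2l ?nrm_ge0 // cauchy_schwarz.
Qed.

(** The solution is the fixed point of [x - t c (T x - y)]. If [L] bounds [c T], the square of the
    contraction constant is at most [1 - 2 t g + t^2 L^2], which is least at [t = g / L^2], where it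
    equals [1 - (g / L)^2]. Including [g] in [L] guarantees [g <= L], hence a nonnegative value. *)
Lemma coercive_surjective (T : H -> H) c (g K : R) : linear T -> c != 0 -> 0 < g ->
  (forall x, nrm (T x) <= K * nrm x) ->
  (forall x, g * nrm x ^+ 2 <= complex.Re (c * inner (T x) x)) ->
  forall y, exists x, T x = y.
Proof.
move=> lT c0 g0 TK hT y.
have TB x x' : T (x - x') = T x - T x' by rewrite addrC -scaleN1r lT scaleN1r addrC.
have TZ a x : T (a *: x) = a *: T x.
  have T0 : T 0 = 0 by have := TB 0 0; rewrite !subrr.
  by have := lT a x 0; rewrite !addr0 T0 addr0.
have nc : 0 < nrm c by rewrite nrm_gt0.
pose L := nrm c * `|K| + g.
have L0 : 0 < L by have := mulr_ge0 (ltW nc) (normr_ge0 K); rewrite /L; lra.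
have gL : g <= L by rewrite /L lerDr mulr_ge0 // ltW.
have cT x : nrm (c *: T x) <= L * nrm x.
  rewrite nrmZ (@le_trans _ _ (nrm c * (`|K| * nrm x))) //.
    by rewrite ler_wpM2l ?(ltW nc) // (le_trans (TK x)) // ler_wpM2r ?nrm_ge0 // ler_norm.
  by rewrite mulrA ler_wpM2r ?nrm_ge0 // /L; lra.
pose t := g / L ^+ 2.
have t0 : 0 < t by rewrite divr_gt0 // exprn_gt0.
pose q2 := 1 - (g / L) ^+ 2.
have gL1 : g / L <= 1 by rewrite ler_pdivrMr // mul1r.
have gL0 : 0 < g / L by rewrite divr_gt0.
have q20 : 0 <= q2 by rewrite subr_ge0 expr_le1 // ltW.
have q21 : q2 < 1 by rewrite /q2 ltrBlDr ltrDl exprn_gt0.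
have contr x : nrm (x - t%:C%C *: (c *: T x)) ^+ 2 <= q2 * nrm x ^+ 2.
  rewrite nrmB_sqr nrmZ nrm_real (gtr0_norm t0) innerZr conj_real ReM Re_real Im_real mul0r subr0.
  rewrite innerZr -(inner_conj (T x) x) -rmorphM /= Re_conj.
  have h1 := hT x; have h2 := cT x.
  have h3 : nrm (c *: T x) ^+ 2 <= L ^+ 2 * nrm x ^+ 2.
    by rewrite -exprMn ler_pXn2r // ?nnegrE ?nrm_ge0 // mulr_ge0 ?nrm_ge0 // ltW.
  rewrite exprMn.
  have e1 : t ^+ 2 * L ^+ 2 = (g / L) ^+ 2 by rewrite /t; field; rewrite gt_eqF.
  have e2 : t * g = (g / L) ^+ 2 by rewrite /t; field; rewrite gt_eqF.
  have h4 : t ^+ 2 * nrm (c *: T x) ^+ 2 <= (g / L) ^+ 2 * nrm x ^+ 2.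
    by rewrite -e1 -mulrA ler_wpM2l ?exprn_ge0 // ltW.
  have h5 : (g / L) ^+ 2 * nrm x ^+ 2 <= t * complex.Re (c * inner (T x) x).
    by rewrite -e2 -mulrA ler_wpM2l // ltW.
  rewrite /q2; move: h4 h5; set a := (g / L) ^+ 2; set b := nrm x ^+ 2.
  set d := t * _; set f := t ^+ 2 * _ => *; lra.
pose q := Num.sqrt q2.
have q01 : 0 <= q < 1 by rewrite sqrtr_ge0 /= -sqrtr1 ltr_sqrt ?ltr01.
have contr' x : nrm (x - t%:C%C *: (c *: T x)) <= q * nrm x.
  rewrite -(@ler_pXn2r _ 2) ?nnegrE ?mulr_ge0 ?nrm_ge0 //; last by case/andP: q01.
  by rewrite exprMn sqr_sqrtr.
pose u := fix u n := if n is m.+1 then u m - t%:C%C *: (c *: (T (u m) - y)) else 0 : H.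
have uS n : u n.+1 = u n - t%:C%C *: (c *: (T (u n) - y)) by [].
have du n : u n.+2 - u n.+1 = (u n.+1 - u n) - t%:C%C *: (c *: T (u n.+1 - u n)).
  have e1 m : u m.+1 - u m = - (t%:C%C *: (c *: (T (u m) - y))).
    by rewrite uS addrAC subrr add0r.
  have e2 : T (u n.+1 - u n) = (T (u n.+1) - y) - (T (u n) - y).
    by rewrite TB opprB addrA subrK.
  rewrite e2 !e1; move: (T (u n.+1) - y) (T (u n) - y) => X Y.
  by rewrite !scalerBr opprB addrA addNr add0r.
have gc n : nrm (u n.+1 - u n) <= nrm (u 1%N - u 0%N) * q ^+ n.
  elim: n => [|n ih]; first by rewrite expr0 mulr1.
  rewrite du (le_trans (contr' _)) // exprS mulrCA ler_wpM2l //.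
  by case/andP: q01.
have [x hx] := geometric_cauchy (nrm_ge0 _) q01 gc.
exists x; apply: (seq_lim_unique (seq_lim_linear lT TK hx)) => e e0.
have [|N hN] := hx (e * (t * nrm c) / 2); first exact: (divr_gt0 (mulr_gt0 e0 (mulr_gt0 t0 nc)) (ltr0Sn _ _)).
exists N => n Nn; have h1 := hN _ Nn; have h2 := hN _ (leq_trans Nn (leqnSn _)).
have : nrm (u n.+1 - u n) < e * (t * nrm c).
  have -> : u n.+1 - u n = (u n.+1 - x) - (u n - x) by rewrite opprB addrA subrK.
  by rewrite (le_lt_trans (nrmB _ _)) //; lra.
rewrite uS addrAC subrr add0r nrmN !nrmZ nrm_real (gtr0_norm t0) mulrA mulrC.
by rewrite ltr_pM2r // mulr_gt0.
Qed.

Lemma coercive_inverse (T : H -> H) c (g K : R) : linear T -> c != 0 -> 0 < g ->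
  (forall x, nrm (T x) <= K * nrm x) ->
  (forall x, g * nrm x ^+ 2 <= complex.Re (c * inner (T x) x)) ->
  exists B : {linear H -> H}, [/\ forall y, g * nrm (B y) <= nrm c * nrm y,
     cancel T B & cancel B T].
Proof.
move=> lT c0 g0 TK hT.
have inj := coercive_injective g0 hT.
have surj := coercive_surjective lT c0 g0 TK hT.
have [B hB] := choice surj.
have TB x x' : T (x - x') = T x - T x' by rewrite addrC -scaleN1r lT scaleN1r addrC.
have Tinj x x' : T x = T x' -> x = x'.
  move=> e; apply/eqP; rewrite -subr_eq0; apply/eqP/nrm0_eq0.
  have := inj (x - x'); rewrite TB e subrr nrm0 mulr0 pmulr_rle0 // => h.
  by apply/eqP; rewrite eq_le h nrm_ge0.
have lB : linear B by move=> a x y; apply: Tinj; rewrite lT !hB.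
pose B' : {linear H -> H} := HB.pack B (GRing.isLinear.Build R[i] H H *:%R B lB).
exists B'; split=> [y|x|y] /=.
- by have := inj (B y); rewrite hB.
- by apply: Tinj; rewrite hB.
- exact: hB.
Qed.

End RieszLaxMilgram.

(** * Resolvents *)

Section Resolvent.
Context {R : realType} {H : hilbertType R}.
Implicit Types (x y : H) (a c z w : R[i]) (A S : {linear H -> H}).

Lemma resolvent_eq A z x y : resolvent_set A z -> A x - z *: x = y ->
  resolvent A z y = x.
Proof.
move=> [B [_ B1 B2]] e.
have : [set x | A x - z *: x = y] (resolvent A z y) by apply: (xgetPex 0); exists x.
by move=> /= e2; rewrite -[LHS]B1 -[RHS]B1 /= e2 e.
Qed.

Lemma resolventK A z y : resolvent_set A z ->
  A (resolvent A z y) - z *: resolvent A z y = y.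
Proof.
move=> [B [_ B1 B2]].
have : [set x | A x - z *: x = y] (resolvent A z y).
  by apply: (xgetPex 0); exists (B y); exact: B2.
by [].
Qed.

Lemma resolvent_linear A z : resolvent_set A z -> linear (resolvent A z).
Proof.
move=> rz a x y; apply: resolvent_eq => //.
rewrite linearP scalerDr opprD addrACA resolventK //; congr (_ + _).
by rewrite scalerA mulrC -scalerA -scalerBr resolventK.
Qed.

Lemma resolventD A z x y : resolvent_set A z ->
  resolvent A z (x + y) = resolvent A z x + resolvent A z y.
Proof. by move=> rz; have := resolvent_linear rz 1 x y; rewrite !scale1r. Qed.

Lemma resolvent0 A z : resolvent_set A z -> resolvent A z 0 = 0.
Proof. by move=> rz; apply: resolvent_eq => //; rewrite linear0 scaler0 subrr. Qed.

Lemma resolventZ A z a x : resolvent_set A z ->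
  resolvent A z (a *: x) = a *: resolvent A z x.
Proof.
by move=> rz; have := resolvent_linear rz a x 0; rewrite resolvent0 // !addr0.
Qed.

Lemma resolvent_bounded A z : resolvent_set A z ->
  exists2 K : R, 0 < K & forall y, nrm (resolvent A z y) <= K * nrm y.
Proof.
move=> rz; case: (rz) => B [/bounded_operatorP[K K0 hK] B1 B2]; exists K => // y.
by have -> : resolvent A z y = B y by apply: resolvent_eq => //; exact: B2.
Qed.

Lemma resolvent_identity A z w y : resolvent_set A z -> resolvent_set A w ->
  resolvent A z y - resolvent A w y
    = (z - w) *: resolvent A w (resolvent A z y).
Proof.
move=> rz rw; have := resolventK y rz; move: (resolvent A z y) => u hu.
have {1}-> : u = resolvent A w (y + (z - w) *: u).
  by apply/esym/resolvent_eq => //; rewrite -hu scalerBl addrA subrK.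
by rewrite resolventD // addrAC subrr add0r resolventZ.
Qed.

(** The single source of resolvent points below: [c] rotates the numerical range of [A - z] into a
    right half-plane. It is minus the conjugate of [z] for large [z], [- 'i] for dissipative [A] and
    [z] in the lower half-plane, and ['i] or [- 'i] for symmetric operators. *)
Lemma coercive_resolvent A z c (g : R) : bounded_operator A -> c != 0 -> 0 < g ->
  (forall x, g * nrm x ^+ 2 <= complex.Re (c * inner (A x - z *: x) x)) ->
  resolvent_set A z /\ forall y, g * nrm (resolvent A z y) <= nrm c * nrm y.
Proof.
move=> /bounded_operatorP[K K0 hK] c0 g0 co.
have lT : linear (fun x => A x - z *: x).
  move=> a x y; rewrite linearP scalerDr opprD addrACA; congr (_ + _).
  by rewrite scalerA mulrC -scalerA -scalerBr.
have TK x : nrm (A x - z *: x) <= (K + nrm z) * nrm x.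
  by rewrite (le_trans (nrmB _ _)) // mulrDl nrmZ lerD.
have [B [b1 b2 b3]] := coercive_inverse lT c0 g0 TK co.
have rz : resolvent_set A z.
  exists B; split => //; apply/bounded_operatorP.
  exists ((nrm c + 1) / g) => [|y].
    by rewrite divr_gt0 //; have := nrm_ge0 c; lra.
  rewrite mulrAC ler_pdivlMr // mulrC (le_trans (b1 _)) // ler_wpM2r ?nrm_ge0 //.
  lra.
split=> // y; have -> : resolvent A z y = B y by apply: resolvent_eq => //; exact: b3.
exact: b1.
Qed.

Lemma resolvent_large A (K : R) z : (forall x, nrm (A x) <= K * nrm x) ->
  0 <= K -> K < nrm z -> resolvent_set A z /\
  forall y, (nrm z - K) * nrm (resolvent A z y) <= nrm y.
Proof.
move=> hK K0 Kz; have z0 : 0 < nrm z by apply: le_lt_trans Kz.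
have bA : bounded_operator A.
  apply/bounded_operatorP; exists (K + 1); first lra.
  by move=> x; rewrite (le_trans (hK x)) // ler_wpM2r ?nrm_ge0 //; lra.
have d0 : 0 < nrm z * (nrm z - K) by rewrite mulr_gt0 // subr_gt0.
have [|x|rz hz] := @coercive_resolvent A z (- z^*) _ bA _ d0.
- by rewrite oppr_eq0 -nrm_gt0 nrm_conj.
- rewrite innerBl innerZl inner_nrm; move: (inner (A x) x) (cauchy_schwarz (A x) x) => v hv.
  have -> : - z^* * (v - z * (nrm x ^+ 2)%:C%C) = z * z^* * (nrm x ^+ 2)%:C%C - z^* * v.
    by ring.
  rewrite mul_conj ReB -rmorphM Re_real.
  have : complex.Re (z^* * v) <= nrm z * (K * nrm x ^+ 2).
    rewrite (le_trans (ler_norm _)) // (le_trans (Re_le_nrm _)) // nrmM nrm_conj.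
    rewrite ler_wpM2l ?(ltW z0) // (le_trans hv) //.
    by rewrite expr2 mulrA ler_wpM2r ?nrm_ge0.
  by set p := complex.Re _; set q := nrm x ^+ 2; nra.
split=> // y; have := hz y; rewrite nrmN nrm_conj -mulrA.
by rewrite ler_pM2l.
Qed.

Lemma resolvent_dissipative A z : bounded_operator A ->
  (forall x, 0 <= complex.Im (inner (A x) x)) -> complex.Im z < 0 ->
  resolvent_set A z.
Proof.
move=> bA dA z0.
have [//| |x|//] := @coercive_resolvent A z (- 'i) (- complex.Im z) bA.
- by rewrite oppr_eq0 neq0Ci.
- by rewrite oppr_gt0.
have -> (u : R[i]) : complex.Re (- 'i * u) = complex.Im u.
  by rewrite -complexiE; case: u => a b /=; ring.
rewrite innerBl innerZl inner_nrm ImB ImM Im_real Re_real mulr0 add0r mulNr.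
by have := dA x; move: (complex.Im (inner _ _)) (complex.Im z * _) => *; lra.
Qed.

Lemma resolvent_symmetric S z : bounded_operator S ->
  (forall x y, inner (S x) y = inner x (S y)) -> complex.Im z != 0 ->
  resolvent_set S z.
Proof.
move=> bS sS z0.
have rS x : complex.Im (inner (S x) x) = 0.
  have := sS x x; rewrite -(inner_conj (S x)) => /(congr1 (@complex.Im R)).
  by rewrite Im_conj; lra.
(* The sign turns the coercive term into [|Im z| * nrm x ^+ 2]. *)
pose s : R := if 0 < complex.Im z then 1 else -1.
have [||x|//] := @coercive_resolvent S z (s%:C%C * 'i) `|complex.Im z| bS.
- rewrite mulf_neq0 ?neq0Ci // -nrm_gt0 nrm_real /s.
  by case: ifP => _; rewrite ?normrN normr1.
- by rewrite normr_gt0.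
have -> (u : R[i]) : complex.Re (s%:C%C * 'i * u) = - (s * complex.Im u).
  by rewrite -complexiE; case: u => a b /=; ring.
rewrite innerBl innerZl inner_nrm ImB ImM Im_real Re_real mulr0 add0r rS.
rewrite sub0r mulrN opprK /s; case: ltrP => h.
  by rewrite (gtr0_norm h) mul1r.
by rewrite ler0_norm // mulN1r mulNr.
Qed.

(** As [z] is assumed to be a resolvent point, no Neumann series is needed: the resolvent identity
    bounds the resolvent at [z] by the one at [z0] plus half of itself. *)
Lemma resolvent_near_bound A z0 : resolvent_set A z0 ->
  exists2 K : R, 0 < K & forall z x, resolvent_set A z -> nrm (z - z0) * K <= 1 / 2 ->
    nrm (resolvent A z x) <= 2 * K * nrm x /\
    nrm (resolvent A z0 x) <= K * nrm x.
Proof.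
move=> r0; have [K K0 hK] := resolvent_bounded r0; exists K => // z x rz h.
split; last exact: hK.
have e := resolvent_identity x rz r0.
have : nrm (resolvent A z x) <= nrm (resolvent A z0 x)
    + nrm (z - z0) * (K * nrm (resolvent A z x)).
  rewrite -[X in nrm X <= _](subrK (resolvent A z0 x)) e addrC.
  rewrite (le_trans (nrmD _ _)) // lerD // nrmZ ler_wpM2l ?nrm_ge0 //.
rewrite mulrA; have h2 := hK x.
have : nrm (z - z0) * K * nrm (resolvent A z x) <= 1 / 2 * nrm (resolvent A z x).
  by rewrite ler_wpM2r ?nrm_ge0.
rewrite -(mulrA 2) => h3 h4.
have gen (p q r X : R) : q <= r + X -> X <= 1 / 2 * q -> r <= p -> q <= 2 * p.
  by clear; move=> *; lra.
exact: gen h4 h3 h2.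
Qed.

(** The estimate is relative to the resolvent set, so it serves at a real point that is approached
    only from below. *)
Lemma resolvent_lipschitz A z0 x y : resolvent_set A z0 ->
  exists C d : R, [/\ 0 < d, 0 <= C & forall z, resolvent_set A z -> nrm (z - z0) < d ->
   nrm (inner (resolvent A z x) y - inner (resolvent A z0 x) y) <= C * nrm (z - z0)].
Proof.
move=> r0; have [K K0 hK] := resolvent_near_bound r0.
exists (K * (2 * K * nrm x) * nrm y), (1 / 2 / K); split.
- by rewrite divr_gt0 //; lra.
- by rewrite !mulr_ge0 ?nrm_ge0 //; lra.
move=> z rz; rewrite ltr_pdivlMr // => h.
have [h1 _] := hK z x rz (ltW h).
have [_ h2] := hK z (resolvent A z x) rz (ltW h).
rewrite -innerBl resolvent_identity // innerZl nrmM mulrC ler_wpM2r ?nrm_ge0 //.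
rewrite (le_trans (cauchy_schwarz _ _)) // ler_wpM2r ?nrm_ge0 //.
by rewrite (le_trans h2) // ler_wpM2l // ltW.
Qed.

Lemma cdiff_resolvent A z0 x y : (exists2 d : R, 0 < d &
    forall z, nrm (z - z0) < d -> resolvent_set A z) ->
  cdiff (fun z => inner (resolvent A z x) y) z0.
Proof.
move=> [d d0 hd].
have r0 : resolvent_set A z0 by apply: hd; rewrite subrr nrm0.
pose B := resolvent A z0; have [K K0 hK] := resolvent_bounded r0.
have [K1 K10 hK1] := resolvent_near_bound r0.
apply/cdiffP; exists (inner (B (B x)) y) => e e0.
pose C := K * (K * (2 * K1 * nrm x)) * nrm y + 1.
have C0 : 0 < C.
  have : 0 <= K * (K * (2 * K1 * nrm x)) * nrm y.
    by rewrite !mulr_ge0 ?nrm_ge0 // ltW.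
  by rewrite /C; lra.
pose d' := Num.min d (Num.min (1 / 2 / K1) (e / C)).
have d'0 : 0 < d' by rewrite !lt_min d0 !divr_gt0 //; lra.
exists d' => // w; rewrite !lt_min => /andP[wd /andP[wK we]].
have rw := hd _ wd.
have hw : nrm (w - z0) * K1 <= 1 / 2 by rewrite -ler_pdivlMr // ltW.
have [h1 _] := hK1 w x rw hw.
(* The derivative is the matrix element of the squared resolvent; two uses of the resolvent identity
   leave a remainder of second order in [w - z0]. *)
have -> : inner (resolvent A w x) y - inner (resolvent A z0 x) y
    - inner (B (B x)) y * (w - z0)
   = (w - z0) * ((w - z0) * inner (B (B (resolvent A w x))) y).
  rewrite -innerBl resolvent_identity // innerZl mulrC -mulrBl mulrC; congr (_ * _).
  rewrite -innerBl -/B.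
  have -> : B (resolvent A w x) - B (B x) = B (resolvent A w x - B x).
    by rewrite /B -scaleN1r -resolventZ // -resolventD // scaleN1r.
  by rewrite resolvent_identity // /B resolventZ // innerZl.
rewrite !nrmM mulrC ler_wpM2r ?nrm_ge0 //.
have h3 : nrm (inner (B (B (resolvent A w x))) y) <= C.
  rewrite (le_trans (cauchy_schwarz _ _)) // (@le_trans _ _ (K * (K * (2 * K1 * nrm x)) * nrm y)) //.
    rewrite ler_wpM2r ?nrm_ge0 // (le_trans (hK _)) // ler_wpM2l ?(ltW K0) //.
    by rewrite (le_trans (hK _)) // ler_wpM2l ?(ltW K0).
  by rewrite /C lerDl.
apply: (@le_trans _ _ (nrm (w - z0) * C)); first by rewrite ler_wpM2l ?nrm_ge0.
by rewrite -ler_pdivlMr // ltW.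
Qed.

(** The inverse [B] is given by the Sherman-Morrison formula, whose denominator is [q]. *)
Lemma rank_one_perturbation A S z k g : resolvent_set S z ->
  (forall x, A x = S x + (k * inner x g) *: g) ->
  1 + k * inner (resolvent S z g) g != 0 -> resolvent_set A z.
Proof.
move=> rz AE q0; set q := 1 + _ in q0.
have [K K0 hK] := resolvent_bounded rz.
pose T := resolvent S z.
have TD x y : T (x + y) = T x + T y by exact: resolventD.
have TZ a x : T (a *: x) = a *: T x by exact: resolventZ.
pose B y := T y - (k * inner (T y) g / q) *: T g.
have lB : linear B.
  move=> a x y; rewrite /B TD TZ innerDl innerZl scalerBr [RHS]addrACA scalerA.
  congr (_ + _); rewrite -opprD -scalerDl; congr (- (_ *: _)).
  by move: q^-1 => r; ring.
pose B' : {linear H -> H} := HB.pack B (GRing.isLinear.Build R[i] H H *:%R B lB).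
exists B'; split=> [|x|y] /=.
- apply/bounded_operatorP; exists (K + nrm (k / q) * (K * nrm g) * (K * nrm g)).
    by rewrite ltr_wpDr // !mulr_ge0 ?nrm_ge0 // ltW.
  move=> y; rewrite /B (le_trans (nrmB _ _)) // mulrDl lerD // nrmZ.
  have -> : k * inner (T y) g / q = k / q * inner (T y) g by ring.
  rewrite nrmM -!mulrA ler_wpM2l ?nrm_ge0 // [leRHS]mulrA.
  have h1 : nrm (inner (T y) g) <= K * nrm y * nrm g.
    by rewrite (le_trans (cauchy_schwarz _ _)) // ler_wpM2r ?nrm_ge0.
  have h2 : nrm (T g) <= K * nrm g by exact: hK.
  rewrite (le_trans (ler_pM _ _ h1 h2)) ?nrm_ge0 // le_eqVlt; apply/orP; left.
  by apply/eqP; ring.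
- rewrite /B AE addrAC TD TZ.
  have -> : T (S x - z *: x) = x by apply: resolvent_eq.
  rewrite innerDl innerZl.
  have -> : k * (inner x g + k * inner x g * inner (T g) g) / q = k * inner x g.
    by have -> : inner x g + k * inner x g * inner (T g) g = inner x g * q;
      [rewrite /q; ring|rewrite mulrA mulfK].
  by rewrite addrK.
- rewrite AE; have -> : inner (B y) g = inner (T y) g / q.
    rewrite /B innerBl innerZl; move: q0; rewrite /q -/(T g).
    by move: (inner (T y) g) (inner (T g) g) => u v q0; field.
  rewrite /B linearB linearZ /=.
  have SK u : S (T u) = u + z *: T u.
    by have := resolventK u rz; move=> /(canRL (subrK _)).
  rewrite !SK scalerBr mulrA; move: (k * inner (T y) g / q) => m.
  rewrite scalerDr !scalerA (mulrC m) opprD opprB !addrA.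
  rewrite -!(addrAC _ (- (m *: g))) -!(addrAC _ (m *: g)).
  by rewrite addrK subrK addrK.
Qed.

End Resolvent.

(** * Weyl functions and characteristic functions *)

Section ImaginaryPart.
Context {R : realType} {H : hilbertType R}.
Variable A : {linear H -> H}.
Hypothesis bA : bounded_operator A.
Implicit Types (x y : H).

Lemma two_i_neq0 : (2 : R[i]) * 'i != 0.
Proof. by rewrite mulf_neq0 ?neq0Ci // pnatr_eq0. Qed.

Lemma adjointE_left x y : inner (adjoint A x) y = inner x (A y).
Proof. by rewrite -inner_conj -adjointE // inner_conj. Qed.

Lemma imag_partE x y : inner (A x) y - inner x (A y)
  = 2 * 'i * inner (imag_part A x) y.
Proof.
rewrite /imag_part innerZl mulrA mulfV ?two_i_neq0 // mul1r.
by rewrite innerBl adjointE_left.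
Qed.

Lemma imag_part_sym x y : inner (imag_part A x) y = inner x (imag_part A y).
Proof.
apply: (mulfI two_i_neq0); rewrite -imag_partE.
rewrite -[inner x (imag_part A y)]inner_conj.
have -> : 2 * 'i * (inner (imag_part A y) x)^* = - (2 * 'i * inner (imag_part A y) x)^* :> R[i].
  by rewrite !rmorphM /= conjCi rmorph_nat; ring.
by rewrite -imag_partE rmorphB /= !inner_conj opprB.
Qed.

Lemma dissipativeP : dissipative A -> forall x, 0 <= complex.Im (inner (A x) x).
Proof.
move=> dA x; have := dA x; have := imag_partE x x.
rewrite -[inner x (A x)]inner_conj subC_conj => /(mulfI two_i_neq0) <-.
by rewrite ler0c.
Qed.

Lemma adjoint_sub x : A x - adjoint A x = (2 * 'i) *: imag_part A x.
Proof. by rewrite /imag_part scalerA mulfV ?two_i_neq0 // scale1r. Qed.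

(** The unit vector [e] spans the one-dimensional range, so [imag_part A x] is its own component
    along [e]; symmetry of the imaginary part moves that component onto [inner x e], with factor
    [inner (imag_part A e) e]. *)
Lemma rank_one_imag_part x0 e : dissipative A -> rank_one (imag_part A) ->
  e = A x0 - adjoint A x0 -> nrm e = 1 ->
  exists2 k : R, 0 < k & (forall x, imag_part A x = (k%:C%C * inner x e) *: e)
     /\ complex.Im (inner (A e) e) = k.
Proof.
move=> dA [g0 g00 rg] eE e1.
have ee : inner e e = 1 by rewrite inner_nrm e1 expr1n rmorph1.
have e_neq0 : e != 0 by rewrite -nrm_gt0 e1.
have [c0 c0E] : exists c0, imag_part A x0 = c0 *: g0.
  have : range (imag_part A) (imag_part A x0) by exists x0.
  by rewrite rg => -[c _ <-]; exists c.
have eE' : e = (2 * 'i * c0) *: g0 by rewrite eE adjoint_sub c0E scalerA.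
have c00 : 2 * 'i * c0 != 0.
  by apply: contraNneq e_neq0 => h; rewrite eE' h scale0r.
have g0E : g0 = (2 * 'i * c0)^-1 *: e by rewrite eE' scalerA mulVf // scale1r.
have GE x : imag_part A x = inner (imag_part A x) e *: e.
  have : range (imag_part A) (imag_part A x) by exists x.
  rewrite rg => -[c _ <-]; rewrite g0E scalerA innerZl ee mulr1 //.
pose k := complex.Re (inner (imag_part A e) e).
have kE : inner (imag_part A e) e = k%:C%C.
  by have := dA e; rewrite ge0_complexE => /andP[/eqP h _]; apply: complex_ext.
have k0 : 0 <= k by have := dA e; rewrite kE ler0c.
have GE' x : imag_part A x = (k%:C%C * inner x e) *: e.
  rewrite {1}GE; congr (_ *: _); rewrite imag_part_sym.
  by rewrite GE kE innerZr conj_real.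
exists k.
  rewrite lt_neqAle k0 andbT eq_sym; apply: contraNneq e_neq0 => kz.
  by rewrite eE adjoint_sub GE' kz mul0r scale0r scaler0.
split=> //; apply: complexI; rewrite -kE; apply: (mulfI two_i_neq0).
by rewrite -imag_partE -[inner e (A e)]inner_conj subC_conj.
Qed.

End ImaginaryPart.

Section Expansion.
Context {R : realType}.
Implicit Types (D : set R[i]) (M : R[i] -> R[i]).

Lemma bounded_set_nrm D : bounded_set D ->
  exists2 r : R, 0 < r & forall z, r < nrm z -> ~ D z.
Proof.
move=> [K [Kreal hK]]; exists (nrm K + 1) => [|z zr Dz]; first by have := nrm_ge0 K; lra.
have /hK/(_ z Dz) : K < (nrm K + 1)%:C%C.
  rewrite -(RRe_real Kreal) ltcR nrm_real; have := ler_norm (complex.Re K); lra.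
by rewrite /= le_nrm; lra.
Qed.

Lemma expansionP M b : expansion_at_infinity M b <->
  exists K r : R, [/\ 0 < r, 0 < K & forall z : R[i], r < nrm z ->
    nrm (M z - (- z^-1 - b / z ^+ 2)) <= K / nrm z ^+ 3].
Proof.
split.
- move=> [K [r hr]]; exists (`|K| + 1), (`|r| + 1).
  have kk := normr_ge0 K; have rr := normr_ge0 r.
  split; [lra|lra|] => z rz.
  have z0 : 0 < nrm z by lra.
  have rz' : (r%:C%C < `|z|)%R by rewrite normE ltcR; have := ler_norm r; lra.
  have := hr z rz'; rewrite !normE -rmorphXn -fmorphV -rmorphM /= lecR => /le_trans; apply.
  rewrite ler_wpM2r ?invr_ge0 ?exprn_ge0 ?nrm_ge0 //; have := ler_norm K; lra.
- move=> [K [r [r0 K0 h]]]; exists K, r => z; rewrite normE ltcR => /h.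
  by rewrite !normE -rmorphXn -fmorphV -rmorphM /= lecR.
Qed.

End Expansion.

Section WeylToCharacteristic.
Context {R : realType}.
Implicit Types (D : set R[i]) (M : R[i] -> R[i]).

(** Two uses of [z y = A y - e] give the remainder exactly, as [inner (A (A y)) e / z ^+ 2]. For
    [nrm z > 2 K] one has [nrm y <= 2 / nrm z], which explains the 2 in the constant. *)
Lemma resolvent_expansion {H : hilbertType R} (A : {linear H -> H}) e (K : R) z :
  (forall x, nrm (A x) <= K * nrm x) -> 0 < K -> nrm e = 1 -> 2 * K < nrm z ->
  nrm (inner (resolvent A z e) e - (- z^-1 - inner (A e) e / z ^+ 2))
    <= (2 * K ^+ 2) / nrm z ^+ 3.
Proof.
move=> hK K0 e1 Kz; have z0 : 0 < nrm z by lra.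
have zn : z != 0 by rewrite -nrm_gt0.
have ee : inner e e = 1 by rewrite inner_nrm e1 expr1n rmorph1.
have [rz hz] := @resolvent_large _ _ A K z hK (ltW K0) ltac:(lra).
set y := resolvent A z e; have yE := resolventK e rz; rewrite -/y in yE.
have i1 : z * inner y e = inner (A y) e - 1.
  have := congr1 (fun v => inner v e) yE; rewrite innerBl innerZl ee => <-; ring.
have i2 : z * inner (A y) e = inner (A (A y)) e - inner (A e) e.
  have := congr1 (fun v => inner (A v) e) yE.
  by rewrite linearB linearZ innerBl innerZl => <- /=; ring.
have -> : inner y e - (- z^-1 - inner (A e) e / z ^+ 2) = inner (A (A y)) e / z ^+ 2.
  have -> : inner (A (A y)) e = z * inner (A y) e + inner (A e) e.
    by rewrite i2 subrK.
  have -> : inner (A y) e = z * inner y e + 1 by rewrite i1 subrK.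
  by field.
rewrite nrmM nrmV nrmX ler_pdivrMr ?exprn_gt0 //.
have -> : 2 * K ^+ 2 / nrm z ^+ 3 * nrm z ^+ 2 = 2 * K ^+ 2 / nrm z.
  by field; rewrite gt_eqF.
rewrite (le_trans (cauchy_schwarz _ _)) // e1 mulr1 ler_pdivlMr //.
have := hz e; rewrite -/y e1 => h1.
have h2 : nrm (A (A y)) <= K ^+ 2 * nrm y.
  by rewrite expr2 -mulrA (le_trans (hK _)) // ler_wpM2l // ltW.
have h3 : nrm z * nrm y <= 2.
  have := nrm_ge0 y; set Y := nrm y in h1 *; set Z := nrm z in Kz h1 *; nra.
rewrite (@le_trans _ _ (K ^+ 2 * nrm y * nrm z)) ?ler_wpM2r ?nrm_ge0 //.
by rewrite -mulrA mulrC ler_wpM2r ?exprn_ge0 ?(ltW K0) // mulrC.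
Qed.

Lemma weyl_to_char D M : bounded_set D ->
  (exists (H : hilbertType R) (A : {linear H -> H}),
      [/\ separable H, bounded_operator A, prime_operator A, dissipative A &
          rank_one (imag_part A)] /\
      is_weyl_function (~` D) M A) ->
  exists b : R[i],
      [/\ expansion_at_infinity M b, 0 < 'Im b &
        exists (H : hilbertType R) (A : {linear H -> H}),
          [/\ separable H, bounded_operator A, dissipative A &
              rank_one (imag_part A)] /\
          is_char_function (~` D) (fun z => 1 - 2%:R * 'i * 'Im b * M z) A].
Proof.
move=> bD [H [A [[sH bA pA dA rA] [e [[x0 eE] e1 hM]]]]].
have {}e1 : nrm e = 1 by rewrite /nrm e1.
have [k k0 [GE bE]] := rank_one_imag_part bA dA rA eE e1.
exists (inner (A e) e); rewrite ImC_real bE; split.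
- have [r r0 hr] := bounded_set_nrm bD.
  have [K K0 hK] := iffLR (bounded_operatorP A) bA.
  apply/expansionP; exists (2 * K ^+ 2), (r + 2 * K); split.
  + lra. + by rewrite mulr_gt0 // exprn_gt0.
  move=> z hz; have [rz _] := @resolvent_large _ _ A K z hK (ltW K0) ltac:(lra).
  rewrite hM //; first by apply: resolvent_expansion => //; lra.
  by apply: hr; lra.
- by rewrite ltcR.
exists H, A; split; first by split.
have s0 : 0 <= 2 * k by rewrite mulr_ge0 // ltW.
pose s := (Num.sqrt (2 * k))%:C%C : R[i].
have ss : s * s = 2 * k%:C%C.
  by rewrite -rmorphM -expr2 /= sqr_sqrtr // rmorphM /= rmorph_nat.
exists (s *: e) => [x|z Dz rz].
  by rewrite GE innerZr conj_real !scalerA mulrAC ss mulrA.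
rewrite (hM z Dz rz) /char_function /weyl_function resolventZ // innerZl innerZr.
by rewrite conj_real (mulrA s) ss; ring.
Qed.

End WeylToCharacteristic.

(** * The kernel as a Gram matrix *)

Section CharacteristicToKernel.
Context {R : realType}.
Implicit Types (D : set R[i]) (M : R[i] -> R[i]) (z w : R[i]).

(** In the upper half-plane the points outside the resolvent set are zeros of the holomorphic
    function [q]. If a whole disc consisted of them, the identity theorem would carry the vanishing
    of [q] upwards, whereas [q] tends to 1 at infinity. *)
Lemma resolvent_dense {H : hilbertType R} (A : {linear H -> H}) g :
  bounded_operator A -> dissipative A ->
  (forall x, 2%:R *: imag_part A x = inner x g *: g) ->
  forall z, 'Im z != 0 -> forall d : R, 0 < d ->
    exists2 w, nrm (w - z) < d & resolvent_set A w.
Proof.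
move=> bA dA gE z; rewrite ImC_real -(rmorph0 (real_complex R)) (inj_eq (@complexI R)) => z0 d d0.
have [K K0 hK] := iffLR (bounded_operatorP A) bA.
have [zneg|zpos] := ltrP (complex.Im z) 0.
  exists z; first by rewrite subrr nrm0.
  by apply: resolvent_dissipative => //; exact: dissipativeP.
have {z0 zpos} z0 : 0 < complex.Im z by rewrite lt_neqAle eq_sym z0.
apply: contrapT => nex.
have nrho w : nrm (w - z) < d -> ~ resolvent_set A w by move=> wd rw; apply: nex; exists w.
(* The real part of [A], a symmetric operator of which [A] is a rank one perturbation. *)
pose S0 x := A x - ('i / 2 * inner x g) *: g.
have lS : linear S0.
  move=> a x y; rewrite /S0 linearP innerDl innerZl scalerBr [RHS]addrACA scalerA.
  by congr (_ + _); rewrite -opprD -scalerDl; congr (- (_ *: _)); ring.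
pose S : {linear H -> H} := HB.pack S0 (GRing.isLinear.Build R[i] H H *:%R S0 lS).
have AS x : A x = S x + ('i / 2 * inner x g) *: g by rewrite /= /S0 subrK.
pose L := K + (nrm g * nrm g).
have L0 : 0 < L by rewrite /L ltr_pwDl // mulr_ge0 // nrm_ge0.
have hS x : nrm (S x) <= L * nrm x.
  rewrite /= /S0 (le_trans (nrmB _ _)) // /L mulrDl lerD // nrmZ !nrmM nrm_i mul1r.
  have c := cauchy_schwarz x g; have g0 := nrm_ge0 g.
  have i0 := nrm_ge0 (inner x g).
  have -> : nrm (2^-1 : R[i]) = 2^-1.
    by rewrite nrmV -(rmorph_nat (real_complex R) 2) nrm_real normr_nat.
  have : nrm (inner x g) * nrm g <= nrm x * nrm g * nrm g by rewrite ler_wpM2r.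
  have : 0 <= nrm (inner x g) * nrm g by rewrite mulr_ge0.
  move: (nrm (inner x g)) (nrm g) (nrm x) => a b c'; clear; nra.
have bS : bounded_operator S by apply/bounded_operatorP; exists L.
have sS x y : inner (S x) y = inner x (S y).
  rewrite /= /S0 innerBl innerBr innerZl innerZr; apply/eqP; rewrite -subr_eq0.
  have := imag_partE bA x y; move=> /(canRL (subrK _)) ->.
  have -> : 2 * 'i * inner (imag_part A x) y = 'i * (inner x g * inner g y).
    by rewrite -mulrA (mulrCA 2) -(innerZl 2) gE innerZl.
  rewrite !rmorphM /= fmorphV rmorph_nat conjCi inner_conj.
  by apply/eqP; field.
pose q w := 1 + 'i / 2 * inner (resolvent S w g) g.
have rS w : 0 < complex.Im w -> resolvent_set S w.
  by move=> w0; apply: resolvent_symmetric => //; rewrite gt_eqF.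
have q0 w : nrm (w - z) < d -> 0 < complex.Im w -> q w = 0.
  move=> wd w0; apply/eqP; apply: contrapT => /negP h; apply: (nrho w wd).
  exact: rank_one_perturbation (rS _ w0) AS h.
have dq w : 0 < complex.Im w -> cdiff q w.
  move=> w0; apply: cdiffD; first exact: cdiff_cst.
  apply: cdiffM; first exact: cdiff_cst.
  apply: cdiff_resolvent; exists (complex.Im w) => // u hu; apply: rS.
  have := le_lt_trans (Im_le_nrm _) hu; rewrite ImB ltr_norml; lra.
pose P w := exists2 d : R, 0 < d & forall u, nrm (u - w) < d -> q u = 0.
have Pz : P z.
  exists (Num.min d (complex.Im z)) => [|u]; first by rewrite lt_min d0.
  rewrite lt_min => /andP[ud uz]; apply: q0 => //.
  have := le_lt_trans (Im_le_nrm _) uz; rewrite ImB ltr_norml; lra.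
have step w : 0 < complex.Im w -> P w -> forall s, 0 <= s < complex.Im w ->
    P (w + 'i * s%:C%C).
  move=> w0 [d1 d10 hd1] s /andP[s0 sw].
  have all0 : forall u, nrm (u - w) < complex.Im w -> q u = 0.
    apply: (identity_disc d10 _ hd1) => u hu; apply: dq.
    have := le_lt_trans (Im_le_nrm _) hu; rewrite ImB ltr_norml; lra.
  exists (complex.Im w - s) => [|u hu]; first lra.
  apply: all0; rewrite -(subrK (w + 'i * s%:C%C) u) -addrA (le_lt_trans (nrmD _ _)) //.
  rewrite addrAC subrr add0r nrmM nrm_i mul1r nrm_real ger0_norm //; lra.
have climbq := climb z0 step Pz.
(* At this height [nrm w - L >= 1 + nrm g ^+ 2], so the matrix element in [q w] has modulus below 1
   and [q w] cannot vanish. *)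
pose s := 1 + L + nrm g * nrm g.
have g0 : 0 <= nrm g * nrm g by rewrite mulr_ge0 // nrm_ge0.
have s0 : 0 <= s by rewrite /s; lra.
have [d1 d10 h1] := climbq s s0.
have := h1 (z + 'i * s%:C%C); rewrite subrr nrm0 => /(_ d10).
set w := z + _.
have wI : s <= nrm w.
  have := Im_le_nrm w; rewrite /w ImD ImM Re_i Im_i Re_real Im_real mul0r add0r mul1r.
  by rewrite ger0_norm; lra.
have Lw : L < nrm w by rewrite /s in wI; lra.
have [rw hw] := resolvent_large hS (ltW L0) Lw.
rewrite /q => /eqP; rewrite addr_eq0 eq_sym => /eqP /(congr1 nrm).
rewrite nrmN nrm1 !nrmM nrm_i mul1r.
have -> : nrm (2^-1 : R[i]) = 2^-1.
  by rewrite nrmV -(rmorph_nat (real_complex R) 2) nrm_real normr_nat.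
have F1 := cauchy_schwarz (resolvent S w g) g.
have F2 : (1 + nrm g * nrm g) * (nrm (resolvent S w g) * nrm g) <= nrm g * nrm g.
  rewrite mulrA ler_wpM2r ?nrm_ge0 // (le_trans _ (hw g)) // ler_wpM2r ?nrm_ge0 //.
  by rewrite /s in wI; lra.
have F3 : 0 <= nrm (resolvent S w g) * nrm g by rewrite mulr_ge0 // nrm_ge0.
move: F1 F2 F3 g0.
move: (nrm (inner _ _)) (nrm (resolvent S w g) * nrm g) (nrm g * nrm g) => a b c.
clear; nra.
Qed.

Lemma gram_ge0 {H : hilbertType R} N (lambda : 'I_N -> R[i]) (x : 'I_N -> H) :
  0 <= \sum_(i < N) \sum_(j < N) lambda i * (lambda j)^* * inner (x j) (x i).
Proof.
set w := \sum_(j < N) (lambda j)^* *: x j.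
suff -> : \sum_(i < N) \sum_(j < N) lambda i * (lambda j)^* * inner (x j) (x i) = inner w w.
  by rewrite inner_nrm ler0c exprn_ge0 // nrm_ge0.
rewrite inner_sumr; apply: eq_bigr => i _; rewrite inner_suml; apply: eq_bigr => j _.
by rewrite innerZl innerZr conjCK; ring.
Qed.

(** For [x] and [y] the resolvents of [g] at [z] and [w], the number [inner (A x) y - inner x (A y)]
    is computed in two ways: through [imag_part A], and by substituting [A x = g + z *: x] and
    [A y = g + w *: y]. *)
Lemma kernel_gram {H : hilbertType R} (A : {linear H -> H}) g (k : R) z w m n :
  bounded_operator A -> 0 < k ->
  (forall x, 2%:R *: imag_part A x = inner x g *: g) ->
  resolvent_set A z -> resolvent_set A w -> z - w^* != 0 ->
  1 - 2%:R * 'i * k%:C%C * m = char_function A g z ->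
  1 - 2%:R * 'i * k%:C%C * n = char_function A g w ->
  (m - n^* + 2%:R * 'i * k%:C%C * m * n^*) / (z - w^*)
   = ((2 * k)^-1)%:C%C * inner (resolvent A z g) (resolvent A w g).
Proof.
move=> bA k0 gE rz rw zw hm hn.
set x := resolvent A z g; set y := resolvent A w g.
have kn : k%:C%C != 0 :> R[i] by rewrite fmorph_eq0 gt_eqF.
have xE : A x = g + z *: x.
  by have := resolventK g rz; rewrite -/x => /(canRL (subrK _)).
have yE : A y = g + w *: y.
  by have := resolventK g rw; rewrite -/y => /(canRL (subrK _)).
have key := imag_partE bA x y.
have e1 : 2 * 'i * inner (imag_part A x) y = 'i * (inner x g * inner g y).
  by rewrite -mulrA (mulrCA 2) -(innerZl 2) gE innerZl.
rewrite {}e1 xE yE innerDl innerDr innerZl innerZr in key.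
have i2 : 2%:R * 'i != 0 :> R[i] by exact: two_i_neq0.
have mE : m = inner x g / (2 * k%:C%C).
  move: hm; rewrite /char_function -/x => /(addrI 1) /oppr_inj h.
  apply: (mulfI (mulf_neq0 i2 kn)); rewrite h; field; exact: kn.
have nE : n^* = inner g y / (2 * k%:C%C).
  have -> : n = inner y g / (2 * k%:C%C).
    move: hn; rewrite /char_function -/y => /(addrI 1) /oppr_inj h.
    apply: (mulfI (mulf_neq0 i2 kn)); rewrite h; field; exact: kn.
  by rewrite rmorphM /= inner_conj fmorphV rmorphM /= conj_real rmorph_nat.
have e2 : ((2 * k)^-1)%:C%C = (2 * k%:C%C)^-1 :> R[i].
  by rewrite fmorphV rmorphM /= rmorph_nat.
rewrite mE nE e2; apply: (mulIf zw); rewrite mulfVK //.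
move: key.
move: (inner x g) (inner g y) (inner x y) => a b c key.
have -> : (2 * k%:C%C)^-1 * c * (z - w^*) = (2 * k%:C%C)^-1 * (a - b + 'i * (a * b)).
  by rewrite -key; ring.
by field.
Qed.

Lemma nrm_small_inv (e : R) : 0 < e -> exists N, forall n, (N <= n)%N -> n.+1%:R^-1 < e.
Proof.
move=> e0; exists (Num.Def.archi_bound e^-1) => n hn.
rewrite -[e]invrK ltf_pV2 ?posrE ?invr_gt0 //.
apply: (lt_le_trans (archi_boundP _)); first by rewrite invr_ge0 ltW.
by rewrite ler_nat ltnW.
Qed.

Lemma cvg_nrmP (u : nat -> R[i]) l : u @ \oo --> l <-> seq_lim u l.
Proof.
split.
- move=> h e e0; have e0' : (0 : R[i]) < e%:C%C by rewrite ltcR.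
  have [N _ hN] := iffLR (cvgrPdist_lt _ _) h _ e0'.
  by exists N => n /hN /=; rewrite lt_nrm nrm_distC.
- move=> h; apply/cvgrPdist_lt => e; rewrite gt0_complexE => /andP[/eqP eI eR].
  have -> : e = (complex.Re e)%:C%C by apply: complex_ext.
  by have [N hN] := h _ eR; exists N => // n /hN /=; rewrite lt_nrm nrm_distC.
Qed.

Lemma seq_lim_ge0 (u : nat -> R[i]) l : seq_lim u l -> (forall n, 0 <= u n) -> 0 <= l.
Proof.
move=> hu u0; rewrite ge0_complexE; apply/andP; split.
  rewrite -normr_le0; apply/ler_addgt0Pl => e /hu[N /(_ N (leqnn N)) h].
  have := u0 N; rewrite ge0_complexE => /andP[/eqP uI _].
  have := le_lt_trans (Im_le_nrm _) h; rewrite ImB uI sub0r normrN addr0; exact: ltW.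
apply/ler_addgt0Pl => e /hu[N /(_ N (leqnn N)) h].
have := u0 N; rewrite ge0_complexE => /andP[_ uR].
have := le_lt_trans (Re_le_nrm _) h; rewrite ReB ltr_norml; lra.
Qed.

Lemma cvg_conj (u : nat -> R[i]) l : u @ \oo --> l -> (u n)^* @[n --> \oo] --> l^*.
Proof.
move=> /cvg_nrmP h; apply/cvg_nrmP => e /h[N hN]; exists N => n /hN.
by rewrite -rmorphB nrm_conj.
Qed.

Lemma cvg_bigsum (N : nat) (F : 'I_N -> nat -> R[i]) (l : 'I_N -> R[i]) :
  (forall i, F i @ \oo --> l i) ->
  (fun n => \sum_(i < N) F i n) @ \oo --> \sum_(i < N) l i.
Proof.
elim: N F l => [|N ih] F l h.
  rewrite big_ord0 (_ : (fun n => _) = fun=> 0); first exact: cvg_cst.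
  by apply/funext => n; rewrite big_ord0.
rewrite big_ord_recr (_ : (fun n => _) =
   fun n => \sum_(i < N) F (widen_ord (leqnSn N) i) n + F ord_max n) /=.
  by apply: cvgD; [apply: ih => i; exact: h|exact: h].
by apply/funext => n; rewrite big_ord_recr.
Qed.

Lemma char_to_kernel D M : closed D -> holomorphic_on (~` D) M ->
  (exists b : R[i],
      [/\ expansion_at_infinity M b, 0 < 'Im b &
        exists (H : hilbertType R) (A : {linear H -> H}),
          [/\ separable H, bounded_operator A, dissipative A &
              rank_one (imag_part A)] /\
          is_char_function (~` D) (fun z => 1 - 2%:R * 'i * 'Im b * M z) A]) ->
  exists b : R[i],
      [/\ expansion_at_infinity M b, 0 < 'Im b &
        nonnegative_kernel
          [set p : R[i] * R[i] | [/\ ~ D p.1, ~ D p.2 & p.1 - p.2^* != 0]]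
          (fun z xi =>
             (M z - (M xi)^* + 2%:R * 'i * 'Im b * M z * (M xi)^*)
               / (z - xi^*))].
Proof.
move=> cD hM [b [eb b0 [H [A [[sH bA dA rA] [g gE hW]]]]]]; exists b; split=> //.
move: b0 hW; rewrite ImC_real; set k := complex.Im b; rewrite ltcR => k0 hW.
move=> N z lambda N0 hU.
(* The points [z i] may lie outside the resolvent set, where the characteristic function says
   nothing. The pair with equal indices in [hU] shows that [z i] is not real, so nearby resolvent
   points exist. *)
have near_pt (i : 'I_N) (n : nat) : exists w, [/\ nrm (w - z i) < n.+1%:R^-1, ~ D w & resolvent_set A w].
  have [_ Dz zz] := hU i i; rewrite /= in Dz zz.
  have /nbhs_nrmP[d d0 hd] : nbhs (z i) (~` D) by apply: open_nbhs_nbhs; split => //; exact: closed_openC.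
  have n0 : 0 < n.+1%:R^-1 :> R by rewrite invr_gt0.
  have z0 : 'Im (z i) != 0.
    apply: contraNneq zz; rewrite subC_conj ImC_real => ->; by rewrite mulr0.
  have m0 : 0 < Num.min d n.+1%:R^-1 by rewrite lt_min d0.
  have [w] := resolvent_dense bA dA gE z0 m0; rewrite lt_min => /andP[w1 w2] rw.
  by exists w; split => //; exact: hd.
have [p hp] : exists p : 'I_N -> nat -> R[i], forall i n,
    [/\ nrm (p i n - z i) < n.+1%:R^-1, ~ D (p i n) & resolvent_set A (p i n)].
  have h i : exists q : nat -> R[i], forall n,
     [/\ nrm (q n - z i) < n.+1%:R^-1, ~ D (q n) & resolvent_set A (q n)].
    by have [q hq] := choice (near_pt i); exists q.
  by have [p hp] := choice h; exists p.
have pz i : p i @ \oo --> z i.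
  apply/cvg_nrmP => e /nrm_small_inv[m hm]; exists m => n /hm.
  by apply: lt_trans; case: (hp i n).
have cM i : (fun n => M (p i n)) @ \oo --> M (z i).
  have Dz : ~ D (z i) by case: (hU i i).
  have cm := cdiff_cont (iffLR (derivable_cdiff _ _) (hM _ Dz)).
  exact: (cvg_comp _ _ (pz i) cm).
pose K z xi := (M z - (M xi)^* + 2%:R * 'i * k%:C%C * M z * (M xi)^*) / (z - xi^*).
have zz0 i j : z j - (z i)^* != 0 by case: (hU i j).
have cden i j : (fun n => p j n - (p i n)^*) @ \oo --> z j - (z i)^*.
  exact: (cvgB (pz j) (cvg_conj (pz i))).
have cK i j : (fun n => K (p j n) (p i n)) @ \oo --> K (z j) (z i).
  apply: cvgM; last exact: (cvgV (zz0 i j) (cden i j)).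
  apply: cvgD; first exact: (cvgB (cM j) (cvg_conj (cM i))).
  apply: cvgM; last exact: (cvg_conj (cM i)).
  by apply: cvgM; [exact: cvg_cst|exact: cM].
have cS : (fun n => \sum_(i < N) \sum_(j < N) lambda i * (lambda j)^* * K (p j n) (p i n))
    @ \oo --> \sum_(i < N) \sum_(j < N) lambda i * (lambda j)^* * K (z j) (z i).
  apply: cvg_bigsum => i; apply: cvg_bigsum => j.
  by apply: cvgM; [exact: cvg_cst|exact: cK].
(* The Gram identity needs nonzero denominators at the approximating points as well; they hold from
   a common rank [m] on, and the sequences are shifted by it. *)
have [m hm] : exists m, forall n, (m <= n)%N -> forall i j, p j n - (p i n)^* != 0.
  have hij i j : exists m, forall n, (m <= n)%N -> p j n - (p i n)^* != 0.
    have d0 : 0 < nrm (z j - (z i)^*) by rewrite nrm_gt0.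
    have [m hm] := iffLR (cvg_nrmP _ _) (cden i j) _ d0; exists m => n /hm h.
    by apply: contraTneq h => ->; rewrite sub0r nrmN ltxx.
  have [f hf] := choice (fun ij : 'I_N * 'I_N => hij ij.1 ij.2).
  exists (\max_(ij : 'I_N * 'I_N) f ij) => n hn i j.
  apply: (hf (i, j)); apply: leq_trans hn; exact: (leq_bigmax (i, j)).
apply: (@seq_lim_ge0 (fun n => \sum_(i < N) \sum_(j < N)
    lambda i * (lambda j)^* * K (p j (m + n)%N) (p i (m + n)%N))).
  move=> e /(iffLR (cvg_nrmP _ _) cS)[n0 h]; exists n0 => n hn.
  by apply: h; rewrite (leq_trans hn) // leq_addl.
move=> n; pose x (i : 'I_N) := resolvent A (p i (m + n)%N) g.
have -> : \sum_(i < N) \sum_(j < N) lambda i * (lambda j)^* * K (p j (m + n)%N) (p i (m + n)%N)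
   = ((2 * k)^-1)%:C%C * \sum_(i < N) \sum_(j < N) lambda i * (lambda j)^* * inner (x j) (x i).
  rewrite mulr_sumr; apply: eq_bigr => i _; rewrite mulr_sumr; apply: eq_bigr => j _.
  have [_ D1 r1] := hp j (m + n)%N; have [_ D2 r2] := hp i (m + n)%N.
  have hmn : p j (m + n)%N - (p i (m + n)%N)^* != 0 by apply: hm; rewrite leq_addr.
  have -> : K (p j (m + n)%N) (p i (m + n)%N) = ((2 * k)^-1)%:C%C * inner (x j) (x i).
    exact: (kernel_gram bA k0 gE r1 r2 hmn (hW _ D1 r1) (hW _ D2 r2)).
  by rewrite mulrCA.
by rewrite mulr_ge0 ?gram_ge0 // ler0c invr_ge0; lra.
Qed.

End CharacteristicToKernel.

(** * From the kernel to Herglotz-Nevanlinna functions *)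

Section KernelToHerglotz.
Context {R : realType}.
Implicit Types (D : set R[i]) (M V : R[i] -> R[i]) (z w b : R[i]).

Lemma expansion_asymp M b : expansion_at_infinity M b ->
  forall e : R, 0 < e -> exists2 r : R, 0 < r & forall z, r < nrm z ->
    nrm (z * M z + 1) <= e.
Proof.
move=> /expansionP[K [r [r0 K0 h]]] e e0.
have nb := nrm_ge0 b.
pose s := r + 1 + (nrm b + K) / e.
have s1 : 0 < (nrm b + K) / e by rewrite divr_gt0 //; lra.
exists s => [|z zs]; first by rewrite /s; lra.
have z1 : 1 < nrm z by rewrite /s in zs; lra.
have z0 : 0 < nrm z by lra.
have zn : z != 0 by rewrite -nrm_gt0.
have hz := h z ltac:(rewrite /s in zs; lra).
have -> : z * M z + 1 = z * (M z - (- z^-1 - b / z ^+ 2)) - b / z by field.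
rewrite (le_trans (nrmB _ _)) // !nrmM nrmV.
have h1 : nrm z * nrm (M z - (- z^-1 - b / z ^+ 2)) <= K / nrm z.
  apply: (@le_trans _ _ (nrm z * (K / nrm z ^+ 3))); first by rewrite ler_wpM2l ?(ltW z0).
  have -> : nrm z * (K / nrm z ^+ 3) = K / nrm z * (nrm z)^-1.
    by field; rewrite gt_eqF.
  rewrite -[leRHS]mulr1 ler_wpM2l ?divr_ge0 ?(ltW z0) ?(ltW K0) //.
  by rewrite invf_le1 // ltW.
have h2 : (nrm b + K) / nrm z <= e.
  by rewrite ler_pdivrMr // mulrC -ler_pdivrMr //; rewrite /s in zs; lra.
by move: h2; rewrite mulrDl; lra.
Qed.

Lemma expansion_neq0 M b : expansion_at_infinity M b ->
  exists2 r : R, 0 < r & forall z, r < nrm z -> M z != 0.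
Proof.
move=> eM; have [|r r0 h] := expansion_asymp eM (e := 1 / 2); first lra.
exists r => // z /h; apply: contraTneq => ->.
by rewrite mulr0 add0r nrm1 -ltNge; lra.
Qed.

Lemma Im_ratio u z : (u - u^*) / (z - z^*) = (complex.Im u / complex.Im z)%:C%C :> R[i].
Proof.
by rewrite !subC_conj -mulf_div mulfV ?two_i_neq0 // mul1r rmorphM fmorphV.
Qed.

Lemma real_segment_Im c d z : complex.Im z != 0 -> ~ real_segment c d z.
Proof. by move=> h [t _ tz]; move: h; rewrite -tz eqxx. Qed.

Lemma not_real_segment (r : R) z : complex.Im z = 0 -> ~ real_segment (- r) r z -> r < nrm z.
Proof.
move=> z0 h; rewrite ltNge; apply/negP => zr; apply: h; exists (complex.Re z).
  have := le_trans (Re_le_nrm z) zr; rewrite ler_norml => /andP[h1 h2].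
  by rewrite /= in_itv /= h1.
exact: complex_ext.
Qed.

Section Kernel.
Variables (D : set R[i]) (M : R[i] -> R[i]) (k : R).
Let K z xi := (M z - (M xi)^* + 2%:R * 'i * k%:C%C * M z * (M xi)^*) / (z - xi^*).
Hypothesis psd : nonnegative_kernel
  [set p : R[i] * R[i] | [/\ ~ D p.1, ~ D p.2 & p.1 - p.2^* != 0]] K.

Lemma kernel_herm z w : (K z w)^* = K w z.
Proof.
rewrite /K rmorphM /= fmorphV rmorphB /= rmorphD rmorphB /= !rmorphM /= !conjCK.
rewrite conjCi conj_real rmorph_nat.
by rewrite -(opprB w) invrN mulrN -mulNr; congr (_ / _); ring.
Qed.

(** The principal 2 x 2 minor of the kernel at the points [z] and [w] is nonnegative. *)
Lemma kernel_cauchy_schwarz z w : ~ D z -> ~ D w ->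
  z - z^* != 0 -> w - w^* != 0 -> z - w^* != 0 ->
  [/\ 0 <= K z z, 0 <= K w w &
  nrm (K z w) ^+ 2 <= complex.Re (K z z) * complex.Re (K w w)].
Proof.
move=> Dz Dw zz ww zw.
have wz : w - z^* != 0.
  by rewrite -(conjCK w) -rmorphB fmorph_eq0 -oppr_eq0 opprB.
pose pp (i : 'I_2) := if i == ord0 then z else w.
have hU i j : [set p : R[i] * R[i] | [/\ ~ D p.1, ~ D p.2 & p.1 - p.2^* != 0]] (pp j, pp i).
  by rewrite /pp /=; case: ifP => _; case: ifP => _; split.
have main (l0 l1 : R[i]) : 0 <= l0 * l0^* * K z z + l0 * l1^* * K w z
   + (l1 * l0^* * K z w + l1 * l1^* * K w w).
  have := @psd 2 pp (fun i => if i == ord0 then l0 else l1) isT hU.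
  by rewrite !big_ord_recl !big_ord0 /= !addr0.
have a0 : 0 <= K z z.
  have := main 1 0; rewrite conjC1 conjC0.
  by have -> : 1 * 1 * K z z + 1 * 0 * K w z + (0 * 1 * K z w + 0 * 0 * K w w) = K z z by ring.
have c0 : 0 <= K w w.
  have := main 0 1; rewrite conjC1 conjC0.
  by have -> : 0 * 0 * K z z + 0 * 1 * K w z + (1 * 0 * K z w + 1 * 1 * K w w) = K w w by ring.
split=> //; set x := K z w.
have aE : K z z = (complex.Re (K z z))%:C%C.
  by move: a0; rewrite ge0_complexE => /andP[/eqP h _]; apply: complex_ext.
have cE : K w w = (complex.Re (K w w))%:C%C.
  by move: c0; rewrite ge0_complexE => /andP[/eqP h _]; apply: complex_ext.
set a := complex.Re (K z z) in aE *; set c := complex.Re (K w w) in cE *.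
have ca : 0 <= a by move: a0; rewrite aE ler0c.
have cc : 0 <= c by move: c0; rewrite cE ler0c.
(* The quadratic form at the vector with entries 1 and [- s] times the conjugate of [x]. For [c > 0]
   the best choice is [s = c^-1]; for [c = 0] a large [s] forces [x = 0]. *)
have key (s : R) : 0 <= a - 2 * s * nrm x ^+ 2 + s ^+ 2 * nrm x ^+ 2 * c.
  have := main 1 (- s%:C%C * x^*).
  rewrite -(kernel_herm z w) -/x aE cE rmorph1 !mul1r mulr1 rmorphM /= rmorphN /= conj_real conjCK.
  have -> : a%:C%C + - s%:C%C * x * x^* +
     (- s%:C%C * x^* * x + - s%:C%C * x^* * (- s%:C%C * x) * c%:C%C)
    = a%:C%C - 2 * s%:C%C * (x * x^*) + s%:C%C * s%:C%C * (x * x^*) * c%:C%C by ring.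
  rewrite mul_conj -(rmorph_nat (real_complex R) 2) -!rmorphM -rmorphB -rmorphD /= ler0c.
  by rewrite -expr2.
move: (nrm x ^+ 2) (exprn_ge0 2 (nrm_ge0 x)) key => n n0 key.
have [c_gt|c_le] := ltrP 0 c.
  have := key c^-1; have -> : c^-1 ^+ 2 * n * c = c^-1 * n by field; rewrite gt_eqF.
  have -> : a - 2 * c^-1 * n + c^-1 * n = a - n / c by ring.
  by rewrite subr_ge0 ler_pdivrMr.
have -> : c = 0 by lra.
rewrite mulr0 leNgt; apply/negP => n_gt.
have := key ((a + 1) / n); have -> : c = 0 by lra.
by rewrite mulr0 addr0 -mulrA mulfVK ?gt_eqF //; lra.
Qed.

Hypothesis D_upper : forall z, D z -> 0 <= 'Im z.
Variable b : R[i].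
Hypothesis bk : complex.Im b = k.
Hypothesis eM : expansion_at_infinity M b.
Hypothesis hM : holomorphic_on (~` D) M.

Lemma lower_notD z : complex.Im z < 0 -> ~ D z.
Proof. by move=> z0 /D_upper; rewrite ImC_real ler0c; lra. Qed.

Lemma nonreal_sub z : complex.Im z != 0 -> z - z^* != 0.
Proof.
move=> z0; rewrite subC_conj mulf_neq0 ?two_i_neq0 //.
by rewrite -(rmorph0 (real_complex R)) (inj_eq (@complexI R)).
Qed.

Lemma nonconj_sub z w : complex.Im z + complex.Im w != 0 -> z - w^* != 0.
Proof.
apply: contraNneq => /eqP; rewrite subr_eq0 => /eqP ->.
by rewrite Im_conj addNr.
Qed.

(** If [M z = 0] then [K z z = 0], and the minors make [K w z], hence [M w], vanish for [w] in the
    lower half-plane; but [M] has no zero near infinity. *)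
Lemma kernel_lower_neq0 z : complex.Im z < 0 -> M z != 0.
Proof.
move=> z0; apply/eqP => Mz.
have [r r0 hr] := expansion_neq0 eM.
pose w : R[i] := (0 -i* (r + 1))%C.
have wI : complex.Im w < 0 by rewrite /w /=; lra.
have [|||||_ _ h] := @kernel_cauchy_schwarz w z.
- exact: lower_notD.
- exact: lower_notD.
- by apply: nonreal_sub; rewrite lt_eqF.
- by apply: nonreal_sub; rewrite lt_eqF.
- by apply: nonconj_sub; rewrite lt_eqF //; lra.
have Kzz : K z z = 0 by rewrite /K Mz rmorph0 subr0 mulr0 addr0 mul0r.
move: h; rewrite Kzz mulr0 => h.
have : K w z = 0.
  apply: nrm0_eq0; apply/eqP; rewrite -sqrf_eq0 eq_le h exprn_ge0 //.
  exact: nrm_ge0.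
rewrite /K Mz rmorph0 subr0 mulr0 addr0 => /eqP.
rewrite mulf_eq0 invr_eq0 => /orP[|].
  apply/negP/hr; apply: (@lt_le_trans _ _ `|complex.Im w|); last exact: Im_le_nrm.
  by rewrite /w /= normrN ger0_norm; lra.
by apply/negP/nonconj_sub; rewrite lt_eqF //; lra.
Qed.

(** The left side is the numerator of [K] at a pair where the denominator is zero. Approaching the
    conjugate of [z] by points [p n], the diagonal values of [K] stay bounded, so the minors bound
    the numerator by a constant times the distance, and it vanishes in the limit. *)
Lemma kernel_reflection z : 0 < complex.Im z -> ~ D z ->
  M z^* - (M z)^* + 2%:R * 'i * k%:C%C * M z^* * (M z)^* = 0.
Proof.
move=> z0 Dz.
have wI : complex.Im z^* < 0 by rewrite Im_conj; lra.
pose p (n : nat) : R[i] := z^* - 'i * (n.+1%:R^-1)%:C%C.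
have n0 n : 0 < n.+1%:R^-1 :> R by rewrite invr_gt0.
have pI n : complex.Im (p n) < 0.
  rewrite /p ImB ImM Re_i Im_i Re_real Im_real mul0r add0r mul1r Im_conj.
  by rewrite subr_lt0 (lt_trans _ (n0 n)) // oppr_lt0.
have pz : p @ \oo --> z^*.
  apply/cvg_nrmP => e /nrm_small_inv[N hN]; exists N => n /hN.
  by rewrite /p addrAC subrr add0r nrmN nrmM nrm_i mul1r nrm_real gtr0_norm.
have cM : (fun n => M (p n)) @ \oo --> M z^*.
  have cm := cdiff_cont (iffLR (derivable_cdiff _ _) (hM (lower_notD wI))).
  exact: (cvg_comp _ _ pz cm).
pose N w := M w - (M z)^* + 2%:R * 'i * k%:C%C * M w * (M z)^*.
have cN : (fun n => N (p n)) @ \oo --> N z^*.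
  apply: cvgD; first exact: (cvgB cM (cvg_cst _)).
  exact: (cvgM (cvgM (cvg_cst _) cM) (cvg_cst _)).
have ww : z^* - z^*^* != 0 by apply: nonreal_sub; rewrite lt_eqF.
have cK : (fun n => K (p n) (p n)) @ \oo --> K z^* z^*.
  apply: cvgM; last exact: (cvgV ww (cvgB pz (cvg_conj pz))).
  apply: cvgD; first exact: (cvgB cM (cvg_conj cM)).
  exact: (cvgM (cvgM (cvg_cst _) cM) (cvg_conj cM)).
have bnd n : nrm (N (p n)) ^+ 2
   <= complex.Re (K (p n) (p n)) * complex.Re (K z z) * n.+1%:R^-1 ^+ 2.
  have pzn : p n - z^* != 0.
    by rewrite -nrm_gt0 /p addrAC subrr add0r nrmN nrmM nrm_i mul1r nrm_real gtr0_norm.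
  have [|||||_ _ h] := @kernel_cauchy_schwarz (p n) z.
  - exact: lower_notD.
  - exact: Dz.
  - by apply: nonreal_sub; rewrite lt_eqF.
  - by apply: nonreal_sub; rewrite gt_eqF.
  - exact: pzn.
  have -> : N (p n) = K (p n) z * (p n - z^*) by rewrite /K mulfVK.
  rewrite nrmM exprMn.
  have -> : nrm (p n - z^*) = n.+1%:R^-1.
    by rewrite /p addrAC subrr add0r nrmN nrmM nrm_i mul1r nrm_real gtr0_norm.
  by rewrite ler_wpM2r ?exprn_ge0 // ltW.
apply: nrm_le_eps => e e0; have e2 : 0 < e / 2 by lra.
have [N1 hN1] := iffLR (cvg_nrmP _ _) cN _ e2.
have [N2 hN2] := iffLR (cvg_nrmP _ _) cK _ ltr01.
pose C := (nrm (K z^* z^*) + 1) * nrm (K z z) + 1.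
have C0 : 0 < C.
  have : 0 <= (nrm (K z^* z^*) + 1) * nrm (K z z).
    by rewrite mulr_ge0 ?nrm_ge0 // addr_ge0 // nrm_ge0.
  by rewrite /C; lra.
have e3 : 0 < (e / 2) / C by rewrite divr_gt0.
have e4 : 0 < Num.min ((e / 2) / C) (e / 2) by rewrite lt_min e3.
have [N3 hN3] := nrm_small_inv e4.
pose n := maxn N1 (maxn N2 N3).
have h1 := hN1 n (leq_maxl _ _).
have h2 := hN2 n (leq_trans (leq_maxl _ _) (leq_maxr _ _)).
have := hN3 n (leq_trans (leq_maxr _ _) (leq_maxr _ _)).
rewrite lt_min => /andP[h3 h4].
have h5 : nrm (N (p n)) <= e / 2.
  rewrite -(@ler_pXn2r _ 2) ?nnegrE ?nrm_ge0 ?(ltW e2) // (le_trans (bnd n)) //.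
  have h6 : complex.Re (K (p n) (p n)) * complex.Re (K z z) <= C.
    have a1 : `|complex.Re (K (p n) (p n))| <= nrm (K z^* z^*) + 1.
      rewrite (le_trans (Re_le_nrm _)) //.
      by have := nrm_ler_distB (K (p n) (p n)) (K z^* z^*); lra.
    rewrite (le_trans (ler_norm _)) // normrM.
    by rewrite (le_trans (ler_pM _ _ a1 (Re_le_nrm _))) // /C lerDl.
  apply: (@le_trans _ _ (C * n.+1%:R^-1 ^+ 2)).
    by rewrite ler_wpM2r ?exprn_ge0 // ltW.
  rewrite expr2 mulrA [leRHS]expr2 ler_pM ?mulr_ge0 ?(ltW C0) ?(ltW (n0 n)) ?(ltW h4) //.
  by rewrite mulrC -ler_pdivlMr // ltW.
rewrite -/(N z^*).
have -> : N z^* = N (p n) - (N (p n) - N z^*) by ring.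
by rewrite (le_trans (nrmB _ _)) //; lra.
Qed.

Lemma kernel_reflection_inv z : 0 < complex.Im z -> ~ D z ->
  M z != 0 /\ (b - (M z^*)^-1)^* = b - (M z)^-1.
Proof.
move=> z0 Dz; have h := kernel_reflection z0 Dz.
have m0 : M z^* != 0 by apply: kernel_lower_neq0; rewrite Im_conj; lra.
have mz : M z != 0.
  apply: contraNneq m0 => mz; move: h.
  by rewrite mz rmorph0 subr0 mulr0 addr0 => ->.
split=> //; apply: (can_inj conjCK); rewrite conjCK !rmorphB /= fmorphV.
have mc : (M z)^* != 0 by rewrite fmorph_eq0.
have bb : b - b^* = 2 * 'i * k%:C%C by rewrite subC_conj bk.
apply: (mulfI m0); apply: (mulfI mc); apply/eqP; rewrite -subr_eq0; apply/eqP.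
rewrite -[RHS]h -bb; field.
by rewrite m0 mc.
Qed.

Lemma kernel_to_herglotz : bounded_set D ->
  has_HN_continuation (~` D) [set z | M z != 0] (fun z => - (M z)^-1 + b).
Proof.
move=> bD; have [r1 r10 hr1] := bounded_set_nrm bD.
have [r2 r20 hr2] := expansion_neq0 eM.
pose r := r1 + r2; have r0 : 0 < r by rewrite /r; lra.
have farD z : r < nrm z -> ~ D z by move=> zr; apply: hr1; rewrite /r in zr; lra.
have farM z : r < nrm z -> M z != 0 by move=> zr; apply: hr2; rewrite /r in zr; lra.
pose F z := b - (M z)^-1.
(* Real points take the value of [F]. Beyond [r] a full neighbourhood lies outside [D], where [VF]
   identifies [V] with [F], so [V] is holomorphic across the real axis there. *)
pose V z := if complex.Im z <= 0 then F z else (F z^*)^*.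
have dM z : ~ D z -> cdiff M z by move=> /hM /derivable_cdiff.
have dF z : ~ D z -> M z != 0 -> cdiff F z.
  move=> Dz mz; apply: cdiffB; first exact: cdiff_cst.
  by apply: cdiffV => //; exact: dM.
have VF z : complex.Im z != 0 \/ r < nrm z -> ~ D z -> M z != 0 /\ V z = F z.
  move=> hz Dz; rewrite /V; case: lerP => h; last exact: kernel_reflection_inv.
  split=> //; case: hz => [z0|]; last exact: farM.
  by apply: kernel_lower_neq0; rewrite lt_neqAle z0.
have dlow z : complex.Im z < 0 -> cdiff F z.
  by move=> z0; apply: dF; [exact: lower_notD|exact: kernel_lower_neq0].
have dV z : complex.Im z != 0 \/ r < nrm z -> cdiff V z.
  case: (ltgtP (complex.Im z) 0) => [zneg _|zpos _|z0].
  - apply: cdiff_near (dlow _ zneg); exists (- complex.Im z) => [|w hw]; first lra.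
    rewrite /V ifT //; have := le_lt_trans (Im_le_nrm _) hw.
    by rewrite ImB ltr_norml; lra.
  - have zc : complex.Im z^* < 0 by rewrite Im_conj; lra.
    apply: cdiff_near (cdiff_conj (dlow _ zc)); exists (complex.Im z) => [//|w hw].
    rewrite /V ifF //; apply/negbTE; rewrite -ltNge; have := le_lt_trans (Im_le_nrm _) hw.
    by rewrite ImB ltr_norml; lra.
  - case=> // zr; apply: cdiff_near (dF _ (farD _ zr) (farM _ zr)).
    exists (nrm z - r) => [|w hw]; first lra.
    have wr : r < nrm w by have := nrm_ler_distB z w; rewrite nrm_distC in hw; lra.
    by have [_ ->] := VF w (or_intror wr) (farD _ wr).
have Vsym z : complex.Im z != 0 -> V z = (V z^*)^*.
  move=> z0; rewrite /V Im_conj oppr_le0; case: (ltgtP (complex.Im z) 0) z0 => // h _.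
  - by rewrite !conjCK.
have Vpos z : complex.Im z != 0 -> 0 <= complex.Im (V z) / complex.Im z.
  have low w : complex.Im w < 0 -> 0 <= complex.Im (F w) / complex.Im w.
    move=> w0; have wn : complex.Im w != 0 by rewrite lt_eqF.
    have Dw := lower_notD w0; have ww := nonreal_sub wn.
    have [kw _ _] := kernel_cauchy_schwarz Dw Dw ww ww ww.
    have mw := kernel_lower_neq0 w0.
    (* Dividing the diagonal of the kernel by [nrm (M w) ^+ 2] turns it into the Nevanlinna quotient
       of [b - 1/M]. *)
    have FK : (F w - (F w)^*) / (w - w^*) = K w w / (M w * (M w)^*).
      rewrite /F rmorphB /= fmorphV /K.
      have mc : (M w)^* != 0 by rewrite fmorph_eq0.
      have bb : b - b^* = 2 * 'i * k%:C%C by rewrite subC_conj bk.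
      have -> : b - (M w)^-1 - (b^* - (M w)^*^-1) = 2 * 'i * k%:C%C - (M w)^-1 + (M w)^*^-1.
        by rewrite -bb; ring.
      by field; rewrite mw mc ww.
    have : 0 <= K w w / (M w * (M w)^*).
      by rewrite divr_ge0 // mul_conj ler0c exprn_ge0 // nrm_ge0.
    by rewrite -FK Im_ratio ler0c.
  move=> z0; rewrite /V; case: (lerP (complex.Im z) 0) => h.
    by apply: low; rewrite lt_neqAle z0.
  have := low z^*; rewrite !Im_conj => /(_ ltac:(lra)).
  by rewrite invrN mulrN -mulNr.
exists (- r), r, V; split.
- lra.
- split=> z; rewrite /= ImC_real -(rmorph0 (real_complex R)) (inj_eq (@complexI R)) => z0.
  + by apply/derivable_cdiff/dV; left.
  + exact: Vsym.
  + by rewrite Im_ratio rmorph0 ler0c Vpos.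
- move=> z zs; apply/derivable_cdiff/dV.
  by have [/eqP|] := eqVneq (complex.Im z) 0; [right; apply: not_real_segment zs; apply/eqP|left].
- move=> z Dz zs; have [|mz ->] := VF z _ Dz; last by rewrite /F addrC.
  by have [/eqP|] := eqVneq (complex.Im z) 0; [right; apply: not_real_segment zs; apply/eqP|left].
Qed.

End Kernel.
End KernelToHerglotz.

(** * Passage from [b - 1/M] to [Q] *)

Section HerglotzTransform.
Context {R : realType}.
Implicit Types (D : set R[i]) (M V : R[i] -> R[i]) (z w b : R[i]).

Lemma ImC_neq0 z : ('Im z != 0) = (complex.Im z != 0).
Proof. by rewrite ImC_real -(rmorph0 (real_complex R)) (inj_eq (@complexI R)). Qed.

Lemma herglotz_Im V : herglotz_nevanlinna V ->
  forall z, 0 < complex.Im z -> 0 <= complex.Im (V z).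
Proof.
move=> [_ _ hV] z z0; have := hV z; rewrite ImC_neq0 gt_eqF // => /(_ isT).
by rewrite Im_ratio ler0c pmulr_lge0 // invr_gt0.
Qed.

(** A real value at [z] in the upper half-plane would, by the mean value property, make [V] real all
    the way up the vertical line through [z], where [V w] stays close to [w], whose imaginary part
    is large. *)
Lemma herglotz_nonreal V (g : R) (r0 : R) : herglotz_nevanlinna V ->
  (forall z, r0 < nrm z -> 0 < complex.Im z -> nrm (V z - z) <= g + nrm z / 2) ->
  forall z, complex.Im z != 0 -> complex.Im (V z) != 0.
Proof.
move=> hHN hinf; have [dV sV _] := hHN.
have up z : 0 < complex.Im z -> complex.Im (V z) != 0.
  move=> z0; apply/eqP => Vz.
  have step w : 0 < complex.Im w -> complex.Im (V w) = 0 ->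
      forall s, 0 <= s < complex.Im w -> complex.Im (V (w + 'i * s%:C%C)) = 0.
    move=> w0 Vw; apply: mean_value_Im => // u hu.
      apply/derivable_cdiff/dV; rewrite /= ImC_neq0 gt_eqF //.
      have := le_lt_trans (Im_le_nrm _) hu; rewrite ImB ltr_norml; lra.
    apply: herglotz_Im => //.
    have := le_lt_trans (Im_le_nrm _) hu; rewrite ImB ltr_norml; lra.
  have all0 := @climb _ (fun w => complex.Im (V w) = 0) z z0 step Vz.
  (* If [V w] is real, then [Im w <= nrm (V w - w) <= g + nrm w / 2]; with [nrm w <= |Re z| + Im w]
     this fails as soon as [Im w > 2 * g + |Re z|]. *)
  pose s := `|r0| + 2 * `|g| + `|complex.Re z| + 1.
  have [n1 n2 n3] : [/\ 0 <= `|r0|, 0 <= `|g| & 0 <= `|complex.Re z|] by split.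
  have s0 : 0 <= s by rewrite /s; lra.
  have := all0 s s0; set w := z + _ => Vw.
  have wI : complex.Im w = complex.Im z + s.
    by rewrite /w ImD ImM Re_i Im_i Re_real Im_real mul0r add0r mul1r.
  have wR : complex.Re w = complex.Re z.
    by rewrite /w ReD ReM Re_i Im_i Re_real Im_real mul0r mulr0 subr0 addr0.
  have wn : complex.Im z + s <= nrm w.
    by rewrite -wI (le_trans (ler_norm _)) // Im_le_nrm.
  have wn2 : nrm w <= `|complex.Re z| + (complex.Im z + s).
    by rewrite (le_trans (nrm_le_ReIm _)) // wR wI lerD2l ger0_norm //; lra.
  have rw : r0 < nrm w by have := ler_norm r0; rewrite /s in wn; lra.
  have w0 : 0 < complex.Im w by rewrite wI; lra.
  have := hinf w rw w0; have := Im_le_nrm (V w - w).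
  rewrite ImB Vw wI sub0r normrN ger0_norm; last lra.
  have := ler_norm g; rewrite /s in wn2 *; lra.
move=> z; rewrite neq_lt => /orP[z0|]; last exact: up.
rewrite sV; last by rewrite ImC_neq0 lt_eqF.
by rewrite Im_conj oppr_eq0; apply: up; rewrite Im_conj; lra.
Qed.

Lemma herglotz_inverse V : herglotz_nevanlinna V -> forall a : R,
  (forall z, complex.Im z != 0 -> complex.Im (V z) != 0) ->
  herglotz_nevanlinna (fun z => - (V z - a%:C%C)^-1).
Proof.
move=> [dV sV pV] a nV.
have n0 z : complex.Im z != 0 -> V z - a%:C%C != 0.
  by move=> /nV; apply: contraNneq => h; rewrite -(subrK a%:C%C (V z)) h add0r.
split=> z; rewrite /= ImC_neq0 => z0.
- apply/derivable_cdiff/cdiffN; apply: cdiffV; first exact: n0.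
  apply: cdiffB; last exact: cdiff_cst.
  by apply/derivable_cdiff/dV; rewrite /= ImC_neq0.
- rewrite (sV z); last by rewrite ImC_neq0.
  by rewrite rmorphN /= fmorphV rmorphB /= conj_real.
- have := pV z; rewrite ImC_neq0 => /(_ z0); rewrite !Im_ratio !ler0c => h.
  set u := V z - a%:C%C; have u0 : u != 0 := n0 z z0.
  have uI : complex.Im u = complex.Im (V z) by rewrite /u ImB Im_real subr0.
  have -> : complex.Im (- u^-1) = complex.Im u / nrm u ^+ 2.
    have -> : - u^-1 = - u^* * ((nrm u ^+ 2)^-1)%:C%C.
      have -> : ((nrm u ^+ 2)^-1)%:C%C = (u * u^*)^-1 :> R[i].
        by rewrite mul_conj; exact: fmorphV.
      field.
      by rewrite u0 fmorph_eq0 u0.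
    by rewrite ImM Re_real Im_real mulr0 add0r ImN Im_conj opprK.
  by rewrite uI mulrAC mulr_ge0 // invr_ge0 exprn_ge0 // nrm_ge0.
Qed.

Lemma herglotz_transform D M b : bounded_set D -> holomorphic_on (~` D) M ->
  expansion_at_infinity M b -> 0 < 'Im b ->
  has_HN_continuation (~` D) [set z | M z != 0] (fun z => - (M z)^-1 + b) ->
  has_HN_continuation (~` D) [set z | 'i + 'Im b * M z != 0]
          (fun z => 'i * M z / ('i + 'Im b * M z)).
Proof.
move=> bD hM eM; rewrite ImC_real ltcR; set k := complex.Im b => k0.
move=> [c [d [V [cd hHN dV VM]]]].
have [r1 r10 hr1] := bounded_set_nrm bD.
(* With [z * M z] within 1/4 of [-1], the quotient [(z * M z + 1) / M z] has modulus at most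
   [nrm z / 2], as [herglotz_nonreal] requires. *)
have e4 : 0 < 1 / 4 :> R by lra.
have [r2 r20 hr2] := expansion_asymp eM e4.
have far z : r2 < nrm z -> nrm (M z) <= 2 / nrm z.
  move=> zr; rewrite ler_pdivlMr; last lra.
  rewrite mulrC -nrmM; have := hr2 z zr.
  have := nrm_ler_distB (z * M z) (- 1); rewrite opprK nrmN nrm1; lra.
(* The term [2 * k] gives [nrm (k * M z) < 1] beyond [r], so the denominator of [Q] has no zero
   there. *)
pose r := r1 + r2 + 2 * k + `|c| + `|d|.
have [c0 d0] : 0 <= `|c| /\ 0 <= `|d| by split.
have r0 : 0 < r by rewrite /r; lra.
have farD z : r < nrm z -> ~ D z by move=> zr; apply: hr1; rewrite /r in zr; lra.
have farS z : r < nrm z -> ~ real_segment c d z.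
  move=> zr [t]; rewrite /= in_itv /= => /andP[ct td] tz; move: zr.
  rewrite -tz nrm_real /r; have := ler_norm d; have := ler_norm (- c); rewrite normrN.
  by have [t0|t0] := lerP 0 t; [rewrite (ger0_norm t0)|rewrite (ltr0_norm t0)]; lra.
(* As [b = Re b + 'i k], the denominator of [Q] is a nonzero multiple of [V z - Re b]. It is used in
   both directions: near infinity to see that [V z - Re b] is nonzero, elsewhere to see that [Q] is
   defined. *)
have kE z : M z != 0 -> V z = - (M z)^-1 + b ->
    'i + k%:C%C * M z = - 'i * M z * (V z - (complex.Re b)%:C%C).
  move=> mz ->; have -> : b = (complex.Re b)%:C%C + 'i * k%:C%C := complexReIm b.
  have -> (x : R) : complex.Re (x%:C%C + 'i * k%:C%C) = x.
    by rewrite ReD ReM Re_i Im_i Re_real Re_real Im_real mul0r mulr0 subr0 addr0.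
  have : 'i * 'i = -1 :> R[i] by rewrite -expr2 sqrCi.
  move: ('i : R[i]) => j jj.
  have -> : - j * M z * (- (M z)^-1 + ((complex.Re b)%:C%C + j * k%:C%C) - (complex.Re b)%:C%C)
    = j - (j * j) * k%:C%C * M z by field.
  by rewrite jj; ring.
have nV : forall z, complex.Im z != 0 -> complex.Im (V z) != 0.
  apply: (@herglotz_nonreal V (nrm b) (r1 + r2)) => // z zr z0.
  have Dz : ~ D z by apply: hr1; lra.
  have Sz : ~ real_segment c d z by apply: real_segment_Im; rewrite gt_eqF.
  have [mz ->] := VM z Dz Sz.
  have -> : - (M z)^-1 + b - z = b - (z * M z + 1) / M z by field.
  rewrite (le_trans (nrmB _ _)) // lerD2l nrmM nrmV ler_pdivrMr ?nrm_gt0 //.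
  have h := hr2 z ltac:(lra); rewrite (le_trans h) //.
  have := nrm_ler_distB (1 : R[i]) (z * M z + 1).
  have -> : 1 - (z * M z + 1) = - (z * M z) by ring.
  rewrite nrmN nrm1 nrmM; move: h; rewrite mulrAC; move: (nrm z * nrm (M z)) (nrm (z * M z + 1)) => p q; clear; lra.
have nVR z : complex.Im z != 0 \/ r < nrm z -> V z - (complex.Re b)%:C%C != 0.
  move=> [z0|zr].
    by have := nV z z0; apply: contraNneq => h; rewrite -(subrK (complex.Re b)%:C%C (V z)) h add0r.
  have [mz Vz] := VM z (farD z zr) (farS z zr).
  have : 'i + k%:C%C * M z != 0.
    have mk : nrm (k%:C%C * M z) < 1.
      rewrite nrmM nrm_real gtr0_norm //.
      have zr2 : r2 < nrm z by rewrite /r in zr; lra.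
      have z0 : 0 < nrm z by lra.
      apply: (@le_lt_trans _ _ (k * (2 / nrm z))).
        by rewrite ler_wpM2l ?(ltW k0) // far.
      by rewrite mulrA ltr_pdivrMr // mul1r; rewrite /r in zr; lra.
    apply: contraTneq mk => /eqP; rewrite addrC addr_eq0 => /eqP ->.
    by rewrite nrmN nrm_i ltxx.
  by rewrite (kE z mz Vz) mulf_eq0 negb_or => /andP[].
exists (- r), r, (fun z => - (V z - (complex.Re b)%:C%C)^-1); split.
- lra.
- exact: herglotz_inverse.
- move=> z zs; have hz : complex.Im z != 0 \/ r < nrm z.
    by have [/eqP|] := eqVneq (complex.Im z) 0; [right; apply: not_real_segment zs; apply/eqP|left].
  apply/derivable_cdiff/cdiffN; apply: cdiffV; first exact: nVR.
  apply: cdiffB; last exact: cdiff_cst.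
  apply/derivable_cdiff/dV; case: hz => [z0|]; [exact: real_segment_Im|exact: farS].
- move=> z Dz zs; have hz : complex.Im z != 0 \/ r < nrm z.
    by have [/eqP|] := eqVneq (complex.Im z) 0; [right; apply: not_real_segment zs; apply/eqP|left].
  have Sz : ~ real_segment c d z.
    by case: hz => [z0|]; [exact: real_segment_Im|exact: farS].
  have [mz Vz] := VM z Dz Sz; have n1 := nVR z hz.
  rewrite /= (kE z mz Vz); split.
    by rewrite !mulf_neq0 // oppr_eq0 neq0Ci.
  have := neq0Ci R[i]; move: ('i : R[i]) => j j0; move: (V z - _) n1 => v v0.
  by field; rewrite j0 mz v0.
Qed.

End HerglotzTransform.

(** * The Hilbert space of square summable sequences *)

Section ComplexCompleteness.
Context {R : realType}.

Definition nrm_cauchy {V : normedModType R[i]} (u : nat -> V) :=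
  forall e : R, 0 < e -> exists N, forall m n, (N <= m)%N -> (N <= n)%N ->
     nrm (u m - u n) < e.

Lemma real_complete (a : nat -> R) :
  (forall e : R, 0 < e -> exists N, forall m n, (N <= m)%N -> (N <= n)%N ->
     `|a m - a n| < e) ->
  exists l, forall e : R, 0 < e -> exists N, forall n, (N <= n)%N -> `|a n - l| < e.
Proof.
move=> ca; have : cauchy (a @ \oo).
  apply/cauchy_exP => e e0; have [N hN] := ca _ e0; exists (a N), N => // n /= Nn.
  by rewrite -ball_normE /ball_ /=; apply: hN.
move=> /cauchy_cvg /cvg_ex[l hl]; exists l => e e0.
have [N _ hN] := iffLR (cvgrPdist_lt _ _) hl _ e0.
by exists N => n /hN /=; rewrite distrC.
Qed.

Lemma complex_complete (u : nat -> R[i]) : nrm_cauchy u -> exists l, seq_lim u l.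
Proof.
move=> cu.
have [e e0|x hx] := @real_complete (fun n => complex.Re (u n)).
  have [N hN] := cu _ e0; exists N => m n h1 h2; rewrite -ReB.
  exact: le_lt_trans (Re_le_nrm _) (hN _ _ h1 h2).
have [e e0|y hy] := @real_complete (fun n => complex.Im (u n)).
  have [N hN] := cu _ e0; exists N => m n h1 h2; rewrite -ImB.
  exact: le_lt_trans (Im_le_nrm _) (hN _ _ h1 h2).
exists (x +i* y)%C => e e0; have e2 : 0 < e / 2 by lra.
have [N hN] := hx _ e2; have [N' hN'] := hy _ e2.
exists (maxn N N') => n; rewrite geq_max => /andP[/hN h1 /hN' h2].
by rewrite (le_lt_trans (nrm_le_ReIm _)) // ReB ImB /=; lra.
Qed.

(** A Cauchy filter contains a ball of radius [1 / (k + 1)] for every [k]; the centres form a Cauchy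
    sequence, and its limit is the limit of the filter. *)
Lemma seq_complete_complete (V : normedModType R[i]) :
  (forall u : nat -> V, nrm_cauchy u -> exists l, seq_lim u l) ->
  forall F : set_system V, ProperFilter F -> cauchy F -> cvg F.
Proof.
move=> sc F FF /cauchyP cF.
have h (k : nat) : exists x, F (ball x (k.+1%:R^-1)%:C%C).
  by apply: cF; rewrite ltcR invr_gt0.
have [u hu] := choice h.
have near2 k m : nrm (u k - u m) <= k.+1%:R^-1 + m.+1%:R^-1.
  have [x [xk xm]] := filter_ex (filterI (hu k) (hu m)).
  move: xk xm; rewrite -!ball_normE /ball_ /= !lt_nrm => xk xm.
  have -> : u k - u m = (u k - x) - (u m - x) by rewrite opprB addrA subrK.
  by rewrite (le_trans (nrmB _ _)) // lerD // ltW.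
have [e e0|l hl] := sc u.
  have e2 : 0 < e / 2 by lra.
  have [N hN] := nrm_small_inv e2; exists N => m n /hN h1 /hN h2.
  apply: le_lt_trans (near2 m n) _; move: h1 h2.
  by move: (m.+1%:R^-1) (n.+1%:R^-1) => a b; clear; lra.
apply/cvg_ex; exists l; apply/cvgrPdist_lt => e.
rewrite gt0_complexE => /andP[/eqP eI eR].
have -> : e = (complex.Re e)%:C%C by apply: complex_ext.
set d := complex.Re e in eR *; have d2 : 0 < d / 2 by lra.
have [N hN] := nrm_small_inv d2; have [N' hN'] := hl _ d2.
have h1 := hN _ (leq_maxl N N'); have h2 := hN' _ (leq_maxr N N').
set n := maxn N N' in h1 h2; apply: filterS (hu n) => x.
rewrite -ball_normE /ball_ /= !lt_nrm => xn.
have -> : l - x = (u n - x) - (u n - l) by rewrite opprB [RHS]addrC addrA subrK.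
rewrite (le_lt_trans (nrmB _ _)) //.
by move: h1 h2 xn; move: (n.+1%:R^-1) (nrm (u n - l)) (nrm (u n - x)) => a b c; clear; lra.
Qed.

Lemma seq_limD (V : normedModType R[i]) (u v : nat -> V) a b :
  seq_lim u a -> seq_lim v b -> seq_lim (fun n => u n + v n) (a + b).
Proof.
move=> hu hv e e0; have e2 : 0 < e / 2 by lra.
have [N hN] := hu _ e2; have [N' hN'] := hv _ e2.
exists (maxn N N') => n; rewrite geq_max => /andP[/hN h1 /hN' h2].
by rewrite opprD addrACA (le_lt_trans (nrmD _ _)) //; lra.
Qed.

Lemma seq_limM (u : nat -> R[i]) a c : seq_lim u a -> seq_lim (fun n => c * u n) (c * a).
Proof.
move=> hu e e0; have c1 : 0 < nrm c + 1 by have := nrm_ge0 c; lra.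
have [N hN] := hu _ (divr_gt0 e0 c1); exists N => n /hN.
rewrite ltr_pdivlMr // mulrC -mulrBr nrmM; apply: le_lt_trans.
by rewrite ler_wpM2r ?nrm_ge0 //; lra.
Qed.

Lemma seq_lim_conj (u : nat -> R[i]) a : seq_lim u a -> seq_lim (fun n => (u n)^*) a^*.
Proof. by move=> hu e /hu[N hN]; exists N => n /hN; rewrite -rmorphB nrm_conj. Qed.

Lemma seq_lim_cst (V : normedModType R[i]) (a : V) : seq_lim (fun=> a) a.
Proof. by move=> e e0; exists 0%N => n _; rewrite subrr nrm0. Qed.

Lemma nondecreasing_bounded_cauchy (s : nat -> R) (C : R) :
  (forall n, s n <= s n.+1) -> (forall n, s n <= C) ->
  forall e : R, 0 < e -> exists N, forall n, (N <= n)%N -> sup (range s) - e < s n <= sup (range s).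
Proof.
move=> sm sC e e0.
have hs : has_sup (range s) by split; [exists (s 0%N), 0%N|exists C => _ [m _ <-]].
have [_ [N _ <-] hN] := sup_adherent e0 hs; exists N => n Nn.
have sm' m k : s m <= s (m + k)%N.
  by elim: k => [|k ih]; rewrite ?addn0 // addnS (le_trans ih).
have := sm' N (n - N)%N; rewrite subnKC // => h.
rewrite (lt_le_trans hN h) /=; apply: ub_le_sup; [exact: hs.2|by exists n].
Qed.

Lemma abs_series_lim (a : nat -> R[i]) (C : R) :
  (forall N, \sum_(i < N) nrm (a i) <= C) ->
  exists l, seq_lim (fun N => \sum_(i < N) a i) l.
Proof.
move=> aC; apply: complex_complete => e e0; have e2 : 0 < e / 2 by lra.
pose s N := \sum_(i < N) nrm (a i).
have sm n : s n <= s n.+1 by rewrite /s big_ord_recr /= lerDl nrm_ge0.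
have [N hN] := nondecreasing_bounded_cauchy sm aC e0; exists N.
suff key m n : (N <= m)%N -> (m <= n)%N -> nrm (\sum_(i < m) a i - \sum_(i < n) a i) < e.
  move=> m n Nm Nn; have [mn|nm] := leqP m n; first exact: key.
  by rewrite nrm_distC; apply: key => //; exact: ltnW.
move=> Nm mn; have Nn := leq_trans Nm mn.
have hm := hN _ Nm; have hn := hN _ Nn.
apply: (@le_lt_trans _ _ (s n - s m)); last by move: hm hn; clear; lra.
rewrite nrm_distC -(subnKC mn) /s; elim: (n - m)%N => [|k ih].
  by rewrite addn0 !subrr nrm0.
rewrite addnS !big_ord_recr /= addrAC (le_trans (nrmD _ _)) //.
by rewrite addrAC lerD.
Qed.

Definition csum (a : nat -> R[i]) : R[i] :=
  xget 0 [set l | seq_lim (fun N => \sum_(i < N) a i) l].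

Lemma csum_eq (a : nat -> R[i]) l : seq_lim (fun N => \sum_(i < N) a i) l -> csum a = l.
Proof.
move=> h; apply: (seq_lim_unique _ h).
have : [set l | seq_lim (fun N => \sum_(i < N) a i) l] (csum a).
  by apply: (xgetPex 0); exists l.
by [].
Qed.

End ComplexCompleteness.

(** * The spaces [l2] and their Hilbert structure *)

Section SquareSummable.
Context {R : realType} (P : pred nat).
Implicit Types (u v : nat -> R[i]) (a : R[i]).

Definition sqsum u N : R := \sum_(i < N) nrm (u i) ^+ 2.

(** Sequences vanish off [P], so that finite and infinite dimensions are treated by one type without
    reindexing. *)
Definition square_summable u :=
  (forall n, ~~ P n -> u n = 0) /\ exists C : R, forall N, sqsum u N <= C.

Lemma sqsum_ge0 u N : 0 <= sqsum u N.
Proof. by apply: sumr_ge0 => i _; rewrite exprn_ge0 // nrm_ge0. Qed.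

Lemma sqsum_mono u N : sqsum u N <= sqsum u N.+1.
Proof. by rewrite /sqsum big_ord_recr /= lerDl exprn_ge0 // nrm_ge0. Qed.

Lemma sqsumD u v N : sqsum (fun n => u n + v n) N <= 2 * sqsum u N + 2 * sqsum v N.
Proof.
rewrite /sqsum !mulr_sumr -big_split /=; apply: ler_sum => i _.
have h := nrmD (u i) (v i); have h0 := nrm_ge0 (u i + v i).
apply: (@le_trans _ _ ((nrm (u i) + nrm (v i)) ^+ 2)).
  by rewrite ler_pXn2r ?nnegrE // addr_ge0 ?nrm_ge0.
have := sqr_ge0 (nrm (u i) - nrm (v i)).
by move: (nrm (u i)) (nrm (v i)) => x y; clear; nra.
Qed.

Lemma sqsumZ a u N : sqsum (fun n => a * u n) N = nrm a ^+ 2 * sqsum u N.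
Proof. by rewrite /sqsum mulr_sumr; apply: eq_bigr => i _; rewrite nrmM exprMn. Qed.

Record l2 := L2 { l2val :> nat -> R[i]; l2P : square_summable l2val }.

Lemma l2_ext (x y : l2) : (forall n, x n = y n) -> x = y.
Proof.
case: x y => [u hu] [v hv] /= /funext uv; move: hv; rewrite -uv => hv.
by congr L2; exact: Prop_irrelevance.
Qed.

HB.instance Definition _ := gen_eqMixin l2.
HB.instance Definition _ := gen_choiceMixin l2.

Lemma l2_add_subproof (x y : l2) : square_summable (fun n => x n + y n).
Proof.
case: x y => [u [u0 [C uC]]] [v [v0 [E vE]]] /=; split=> [n Pn|].
  by rewrite u0 // v0 // addr0.
exists (2 * C + 2 * E) => N; rewrite (le_trans (sqsumD _ _ _)) //.
by rewrite lerD // ler_pM2l.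
Qed.
Definition l2_add x y := L2 (l2_add_subproof x y).

Lemma l2_scale_subproof a (x : l2) : square_summable (fun n => a * x n).
Proof.
case: x => [u [u0 [C uC]]] /=; split=> [n Pn|]; first by rewrite u0 // mulr0.
by exists (nrm a ^+ 2 * C) => N; rewrite sqsumZ ler_wpM2l // exprn_ge0 // nrm_ge0.
Qed.
Definition l2_scale a x := L2 (l2_scale_subproof a x).

Lemma l2_zero_subproof : square_summable (fun=> 0 : R[i]).
Proof.
split=> //; exists 0 => N; rewrite /sqsum big1 // => i _.
by rewrite nrm0 expr0n.
Qed.
Definition l2_zero := L2 l2_zero_subproof.
Definition l2_opp x := l2_scale (-1) x.

Lemma l2_addA : associative l2_add.
Proof. by move=> x y z; apply: l2_ext => n /=; rewrite addrA. Qed.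
Lemma l2_addC : commutative l2_add.
Proof. by move=> x y; apply: l2_ext => n /=; rewrite addrC. Qed.
Lemma l2_add0 : left_id l2_zero l2_add.
Proof. by move=> x; apply: l2_ext => n /=; rewrite add0r. Qed.
Lemma l2_addN : left_inverse l2_zero l2_opp l2_add.
Proof. by move=> x; apply: l2_ext => n /=; rewrite mulN1r addNr. Qed.

HB.instance Definition _ := GRing.isZmodule.Build l2 l2_addA l2_addC l2_add0 l2_addN.

Lemma l2_scaleA a c x : l2_scale a (l2_scale c x) = l2_scale (a * c) x.
Proof. by apply: l2_ext => n /=; rewrite mulrA. Qed.
Lemma l2_scale1 : left_id 1 l2_scale.
Proof. by move=> x; apply: l2_ext => n /=; rewrite mul1r. Qed.
Lemma l2_scaleDr : right_distributive l2_scale +%R.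
Proof. by move=> a x y; apply: l2_ext => n /=; rewrite mulrDr. Qed.
Lemma l2_scaleDl x : {morph l2_scale^~ x : a c / a + c}.
Proof. by move=> a c; apply: l2_ext => n /=; rewrite mulrDl. Qed.

HB.instance Definition _ := GRing.Zmodule_isLmodule.Build R[i] l2
  l2_scaleA l2_scale1 l2_scaleDr l2_scaleDl.

Lemma l2D (x y : l2) n : (x + y) n = x n + y n. Proof. by []. Qed.
Lemma l20 n : (0 : l2) n = 0. Proof. by []. Qed.
Lemma l2N (x : l2) n : (- x) n = - x n. Proof. by rewrite /= mulN1r. Qed.
Lemma l2B (x y : l2) n : (x - y) n = x n - y n. Proof. by rewrite l2D l2N. Qed.
Lemma l2_sum (I : Type) (s : seq I) (F : I -> l2) n :
  (\sum_(i <- s) F i) n = \sum_(i <- s) F i n.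
Proof. by elim: s => [|i s ih]; rewrite ?big_nil // !big_cons l2D ih. Qed.

Definition l2nsq (x : l2) : R := sup (range (sqsum x)).

Lemma l2nsq_sup (x : l2) : has_sup (range (sqsum x)).
Proof.
case: x => u [_ [C uC]] /=; split; first by exists (sqsum u 0), 0%N.
by exists C => _ [N _ <-].
Qed.

Lemma sqsum_le (x : l2) N : sqsum x N <= l2nsq x.
Proof. by apply: ub_le_sup; [exact: (l2nsq_sup x).2|exists N]. Qed.

Lemma l2nsq_le (x : l2) (c : R) : (forall N, sqsum x N <= c) -> l2nsq x <= c.
Proof. by move=> h; apply: ge_sup; [exact: (l2nsq_sup x).1|move=> _ [N _ <-]]. Qed.

Lemma l2nsq_ge0 (x : l2) : 0 <= l2nsq x.
Proof. exact: le_trans (sqsum_ge0 x 0) (sqsum_le x 0). Qed.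

Lemma coord_le (x : l2) n : nrm (x n) ^+ 2 <= l2nsq x.
Proof.
by apply: le_trans (sqsum_le x n.+1); rewrite /sqsum big_ord_recr /= lerDr sqsum_ge0.
Qed.

Definition l2norm (x : l2) : R := Num.sqrt (l2nsq x).

Lemma l2norm_sqr x : l2norm x ^+ 2 = l2nsq x.
Proof. by rewrite sqr_sqrtr // l2nsq_ge0. Qed.

Lemma l2norm_ge0 x : 0 <= l2norm x. Proof. exact: sqrtr_ge0. Qed.

Lemma l2nsq_eq0 (x : l2) : l2nsq x = 0 -> x = 0.
Proof.
move=> h; apply: l2_ext => n; rewrite l20; apply: nrm0_eq0; apply/eqP.
by rewrite -sqrf_eq0 eq_le exprn_ge0 ?nrm_ge0 // andbT -h coord_le.
Qed.

Lemma l2norm_eq0 (x : l2) : l2norm x = 0 -> x = 0.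
Proof. by move=> h; apply: l2nsq_eq0; rewrite -l2norm_sqr h expr0n. Qed.

Lemma l2norm_le (x : l2) (c : R) : 0 <= c -> (forall N, sqsum x N <= c ^+ 2) -> l2norm x <= c.
Proof.
move=> c0 h; rewrite -(@ler_pXn2r _ 2) ?nnegrE ?l2norm_ge0 // l2norm_sqr.
exact: l2nsq_le.
Qed.

(** Each product satisfies [p q <= b / (2 a) p^2 + a / (2 b) q^2]; with [a] and [b] the two norms,
    the sum is at most [a b]. *)
Lemma prod_sum_le (x y : l2) N :
  \sum_(i < N) nrm (x i) * nrm (y i) <= l2norm x * l2norm y.
Proof.
have x0 := l2norm_ge0 x; have y0 := l2norm_ge0 y.
have [hx|xn] := eqVneq (l2norm x) 0.
  rewrite hx mul0r big1 // => i _; by rewrite (l2norm_eq0 hx) l20 nrm0 mul0r.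
have [hy|yn] := eqVneq (l2norm y) 0.
  rewrite hy mulr0 big1 // => i _; by rewrite (l2norm_eq0 hy) l20 nrm0 mulr0.
have xp : 0 < l2norm x by rewrite lt_neqAle eq_sym xn.
have yp : 0 < l2norm y by rewrite lt_neqAle eq_sym yn.
set a := l2norm x in x0 xn xp *; set b := l2norm y in y0 yn yp *.
have h : \sum_(i < N) nrm (x i) * nrm (y i)
   <= b / (2 * a) * sqsum x N + a / (2 * b) * sqsum y N.
  rewrite /sqsum !mulr_sumr -big_split /=; apply: ler_sum => i _.
  rewrite -subr_ge0; set p := nrm (x i); set q := nrm (y i).
  have -> : b / (2 * a) * p ^+ 2 + a / (2 * b) * q ^+ 2 - p * q
    = (b * p - a * q) ^+ 2 / (2 * a * b) by field; rewrite xn yn.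
  by rewrite divr_ge0 ?sqr_ge0 // !mulr_ge0.
apply: le_trans h _.
have h1 : b / (2 * a) * sqsum x N <= b / (2 * a) * a ^+ 2.
  by rewrite ler_wpM2l ?divr_ge0 ?mulr_ge0 // l2norm_sqr sqsum_le.
have h2 : a / (2 * b) * sqsum y N <= a / (2 * b) * b ^+ 2.
  by rewrite ler_wpM2l ?divr_ge0 ?mulr_ge0 // l2norm_sqr sqsum_le.
apply: le_trans (lerD h1 h2) _; rewrite le_eqVlt; apply/orP; left; apply/eqP.
by field; rewrite xn yn.
Qed.

Lemma l2norm_triangle (x y : l2) : l2norm (x + y) <= l2norm x + l2norm y.
Proof.
apply: l2norm_le => [|N]; first by rewrite addr_ge0 // l2norm_ge0.
have h := prod_sum_le x y N.
have hx := sqsum_le x N; have hy := sqsum_le y N; rewrite -!l2norm_sqr in hx hy.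
have : sqsum (x + y) N <= sqsum x N + sqsum y N + 2 * \sum_(i < N) nrm (x i) * nrm (y i).
  rewrite /sqsum mulr_sumr -!big_split /=; apply: ler_sum => i _.
  have h1 := nrmD (x i) (y i); have h0 := nrm_ge0 (x i + y i).
  apply: (@le_trans _ _ ((nrm (x i) + nrm (y i)) ^+ 2)).
    by rewrite ler_pXn2r ?nnegrE // addr_ge0 ?nrm_ge0.
  by rewrite le_eqVlt; apply/orP; left; apply/eqP; ring.
move=> h1; apply: le_trans h1 _; rewrite sqrrD -mulr_natl.
by move: hx hy h; move: (\sum_(i < N) _) => s; lra.
Qed.

Lemma l2norm_scale a (x : l2) : l2norm (a *: x) = nrm a * l2norm x.
Proof.
have le c z : l2norm (c *: z) <= nrm c * l2norm z.
  apply: l2norm_le => [|N]; first by rewrite mulr_ge0 ?nrm_ge0 ?l2norm_ge0.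
  rewrite (sqsumZ c z) exprMn ler_wpM2l ?exprn_ge0 ?nrm_ge0 // l2norm_sqr.
  exact: sqsum_le.
apply/eqP; rewrite eq_le le /=.
have [->|a0] := eqVneq a 0; first by rewrite nrm0 mul0r l2norm_ge0.
have := le a^-1 (a *: x); rewrite scalerA mulVf // scale1r nrmV.
by rewrite mulrC ler_pdivlMr ?nrm_gt0 // mulrC.
Qed.

Definition l2normC (x : l2) : R[i] := (l2norm x)%:C%C.

Lemma l2normC_triangle x y : l2normC (x + y) <= l2normC x + l2normC y.
Proof. by rewrite /l2normC -rmorphD lecR l2norm_triangle. Qed.

Lemma l2normC_scale a x : l2normC (a *: x) = `|a| * l2normC x.
Proof. by rewrite /l2normC l2norm_scale normE -rmorphM. Qed.

Lemma l2normC_eq0 x : l2normC x = 0 -> x = 0.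
Proof. by move=> /complexI; exact: l2norm_eq0. Qed.

HB.instance Definition _ := Lmodule_isNormed.Build R[i] l2
  l2normC_triangle l2normC_scale l2normC_eq0.

Lemma nrm_l2 (x : l2) : nrm x = l2norm x.
Proof. by []. Qed.

Lemma coord_nrm (x : l2) n : nrm (x n) <= nrm x.
Proof.
rewrite nrm_l2 -(@ler_pXn2r _ 2) ?nnegrE ?nrm_ge0 ?l2norm_ge0 // l2norm_sqr.
exact: coord_le.
Qed.

(** A bound on partial sums passes to a coordinatewise limit. It is used both to see that the limit
    of a Cauchy sequence is square summable and to estimate its distance to the sequence. *)
Lemma sqsum_lim (u : nat -> nat -> R[i]) v N c : (forall n, seq_lim (fun k => u k n) (v n)) ->
  (exists K, forall k, (K <= k)%N -> sqsum (u k) N <= c) -> sqsum v N <= c.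
Proof.
move=> uv [K hK]; apply/ler_addgt0Pl => e e0.
suff [k Kk hk] : exists2 k, (K <= k)%N & sqsum v N - sqsum (u k) N <= e.
  have := hK k Kk; lra.
have [k0 hk0] : exists k0, forall k, (k0 <= k)%N -> sqsum v N - sqsum (u k) N <= e.
  rewrite /sqsum; elim: N {c K hK} e e0 => [|N ih] e e0.
    by exists 0%N => k _; rewrite !big_ord0 subrr ltW.
  have e2 : 0 < e / 2 by lra.
  have [k1 hk1] := ih _ e2.
  (* If [a - b <= c] with [a = nrm (v N)], then [a^2 - b^2 <= c (2 a + 1)]; the added 1 keeps the
     divisor positive. *)
  have d0 : 0 < e / 2 / (2 * nrm (v N) + 1).
    by rewrite divr_gt0 //; have := nrm_ge0 (v N); lra.
  have [k2 hk2] := uv N _ d0; exists (maxn k1 k2) => k.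
  rewrite geq_max => /andP[/hk1 h1 /hk2 h2]; rewrite !big_ord_recr /= opprD addrACA.
  have -> : e = e / 2 + e / 2 by field.
  apply: lerD => //.
  have a1 := nrm_ler_distB (v N) (u k N); have a2 := nrm_ge0 (u k N).
  have a3 := nrm_ge0 (v N); rewrite nrm_distC in a1.
  have a4 := nrm_ge0 (u k N - v N).
  rewrite ltr_pdivlMr in h2; last lra.
  have gen (a b c f : R) : 0 <= a -> 0 <= b -> 0 <= c -> a - b <= c ->
      c * (2 * a + 1) < f -> 0 < f -> a ^+ 2 - b ^+ 2 <= f.
    clear => a0 b0 c0 ab cf f0; have [ab'|ba] := lerP a b; first by nra.
    have -> : a ^+ 2 - b ^+ 2 = (a - b) * (a + b) by ring.
    have : (a - b) * (a + b) <= c * (a + b) by rewrite ler_wpM2r //; lra.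
    have : c * (a + b) <= c * (2 * a + 1) by rewrite ler_wpM2l //; lra.
    by move: (c * (a + b)) (c * (2 * a + 1)) cf => x y; lra.
  exact: gen a3 a2 a4 a1 h2 e2.
exists (maxn K k0); first exact: leq_maxl.
by apply: hk0; exact: leq_maxr.
Qed.

Lemma l2_seq_complete (u : nat -> l2) : nrm_cauchy u -> exists l, seq_lim u l.
Proof.
move=> cu.
have h n : exists l, seq_lim (fun k => u k n) l.
  apply: complex_complete => e /cu[N hN]; exists N => p q h1 h2.
  by apply: le_lt_trans (hN _ _ h1 h2); rewrite -l2B coord_nrm.
have [v hv] := choice h.
have sv : square_summable v.
  split=> [n Pn|].
    apply: (seq_lim_unique (hv n)) => e e0; exists 0%N => k _.
    by case: (u k) => w [w0 _] /=; rewrite w0 // subrr nrm0.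
  have [N hN] := cu 1 ltr01; exists ((nrm (u N) + 1) ^+ 2) => m.
  apply: sqsum_lim hv _; exists N => k Nk.
  apply: (le_trans (sqsum_le (u k) m)); rewrite -l2norm_sqr -nrm_l2.
  rewrite ler_pXn2r ?nnegrE ?addr_ge0 ?nrm_ge0 //.
  have := hN _ _ Nk (leqnn N); have := nrm_ler_distB (u k) (u N); lra.
exists (L2 sv) => e e0; have e2 : 0 < e / 2 by lra.
have [N hN] := cu _ e2; exists N => n Nn.
apply: (@le_lt_trans _ _ (e / 2)); last lra.
rewrite nrm_l2; apply: l2norm_le => [|m]; first exact: ltW.
apply: (@sqsum_lim (fun k => l2val (u n - u k)) _ m ((e / 2) ^+ 2)).
  move=> k; rewrite l2B /=; apply: seq_limD; first exact: seq_lim_cst.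
  move=> d /(hv k)[p hp]; exists p => q /hp.
  by rewrite mulN1r -opprD nrmN.
exists N => k Nk; apply: (le_trans (sqsum_le (u n - u k) m)).
rewrite -l2norm_sqr -nrm_l2 ler_pXn2r ?nnegrE ?nrm_ge0 ?(ltW e2) //.
by apply: ltW; apply: hN.
Qed.

HB.instance Definition _ := Uniform_isComplete.Build l2
  (seq_complete_complete l2_seq_complete).

Definition l2inner (x y : l2) : R[i] := csum (fun n => x n * (y n)^*).

Lemma l2inner_lim (x y : l2) :
  seq_lim (fun N => \sum_(i < N) x i * (y i)^*) (l2inner x y).
Proof.
have [|l hl] := @abs_series_lim _ (fun n => x n * (y n)^*) (l2norm x * l2norm y).
  move=> N; under eq_bigr do rewrite nrmM nrm_conj.
  exact: prod_sum_le.
by rewrite /l2inner (csum_eq hl).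
Qed.

Lemma l2inner_eq (x y : l2) l :
  seq_lim (fun N => \sum_(i < N) x i * (y i)^*) l -> l2inner x y = l.
Proof. exact: csum_eq. Qed.

Lemma l2inner_herm (x y : l2) : l2inner x y = (l2inner y x)^*.
Proof.
apply: l2inner_eq => e /(seq_lim_conj (l2inner_lim y x))[N hN]; exists N => n /hN.
have -> : (\sum_(i < n) y i * (x i)^*)^* = \sum_(i < n) x i * (y i)^*.
  by rewrite rmorph_sum; apply: eq_bigr => i _; rewrite rmorphM /= conjCK mulrC.
by [].
Qed.

Lemma l2inner_linearl (y : l2) a (x x' : l2) :
  l2inner (a *: x + x') y = a * l2inner x y + l2inner x' y.
Proof.
apply: l2inner_eq => e /(seq_limD (seq_limM a (l2inner_lim x y)) (l2inner_lim x' y))[N hN].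
exists N => n /hN; rewrite mulr_sumr -big_split /=.
have -> // : \sum_(i < n) (a * (x i * (y i)^*) + x' i * (y i)^*)
  = \sum_(i < n) (a *: x + x') i * (y i)^*.
by apply: eq_bigr => i _; rewrite /= mulrA -mulrDl.
Qed.

Lemma l2inner_bilinear : bilinear_for
  (GRing.Scale.Law.clone _ _ *%R _) (GRing.Scale.Law.clone _ _ (Num.conj \; *%R) _)
  l2inner.
Proof.
split=> [y a x x'|x a y y'] /=; first exact: l2inner_linearl.
by rewrite l2inner_herm l2inner_linearl rmorphD rmorphM /= -!l2inner_herm.
Qed.

HB.instance Definition _ := bilinear_isBilinear.Build R[i] l2 l2 _ _ _ l2inner
  l2inner_bilinear.

Lemma l2inner_herm' (x y : l2) : l2inner x y = (-1) ^+ false * (l2inner y x)^*.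
Proof. by rewrite expr0 mul1r l2inner_herm. Qed.

HB.instance Definition _ := @isHermitianSesquilinear.Build R[i] l2 false Num.conj l2inner
  l2inner_herm'.

Lemma l2inner_nsq (x : l2) : l2inner x x = (l2nsq x)%:C%C.
Proof.
apply: l2inner_eq => e e0.
have [N hN] := nondecreasing_bounded_cauchy (sqsum_mono x) (sqsum_le x) e0.
exists N => n /hN; rewrite -/(l2nsq x).
under eq_bigr do rewrite mul_conj.
rewrite -rmorph_sum -rmorphB /= nrm_real -/(sqsum x n) => h.
rewrite ltr_norml; lra.
Qed.

Lemma l2inner_gt0 (x : l2) : x != 0 -> 0 < l2inner x x.
Proof.
move=> x0; rewrite l2inner_nsq ltcR lt_neqAle l2nsq_ge0 andbT eq_sym.
by apply: contraNneq x0 => /l2nsq_eq0 ->.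
Qed.

HB.instance Definition _ := @isDotProduct.Build R[i] l2 l2inner l2inner_gt0.

Lemma l2inner_norm (x : l2) : `|x| ^+ 2 = l2inner x x.
Proof. by rewrite l2inner_nsq normE -rmorphXn nrm_l2 l2norm_sqr. Qed.

HB.instance Definition _ := @isHilbert.Build R l2 l2inner l2inner_norm.

End SquareSummable.

Section SquareSummableBasis.
Context {R : realType} (P : pred nat).
Notation l2 := (@l2 R P).
Implicit Types (x y : l2).

Lemma l2delta_subproof n : square_summable P (fun m => ((m == n) && P n)%:R : R[i]).
Proof.
split=> [m Pm|]; first by case: eqP => //= <-; rewrite (negbTE Pm).
exists 1 => N; elim: N => [|N ih]; first by rewrite /sqsum big_ord0.
have [Nn|Nn] := leqP N n.
  rewrite /sqsum big_ord_recr /= big1 => [|i _].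
    by rewrite add0r; case: (_ && _); rewrite ?nrm1 ?nrm0 ?expr1n ?expr0n.
  by rewrite ltn_eqF ?nrm0 ?expr0n // (leq_trans (ltn_ord i)).
by rewrite /sqsum big_ord_recr /= gtn_eqF // nrm0 expr0n addr0; exact: ih.
Qed.
(** The zero vector when [n] is outside [P]; expansions may thus run over all indices. *)
Definition l2delta n : l2 := L2 (l2delta_subproof n).

Lemma inner_l2delta x n : inner x (l2delta n) = x n.
Proof.
change (l2inner x (l2delta n) = x n); apply: l2inner_eq => e e0.
exists n.+1 => N nN; rewrite (bigD1 (Ordinal nN)) //= big1 => [|i /eqP ne].
  rewrite eqxx /= addr0; case Pn : (P n); first by rewrite conjC1 mulr1 subrr nrm0.
  by rewrite rmorph0 mulr0; case: x => u [u0 _] /=; rewrite u0 ?Pn // subr0 nrm0.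
rewrite (_ : (val i == n) = false) ?rmorph0 ?mulr0 //.
by apply/negP => /eqP h; apply: ne; apply: val_inj.
Qed.

Definition l2trunc x N : l2 := \sum_(i < N) x i *: l2delta i.

Lemma l2truncE x N n : l2trunc x N n = if (n < N)%N then x n else 0.
Proof.
rewrite /l2trunc l2_sum; case: ifP => nN.
  rewrite (bigD1 (Ordinal nN)) //= big1 => [|i /eqP ne].
    rewrite eqxx /= addr0; case Pn : (P n); first by rewrite mulr1.
    by rewrite mulr0; case: x => u [u0 _] /=; rewrite u0 ?Pn.
  rewrite (_ : (n == i) = false) ?mulr0 //.
  by apply/negP => /eqP h; apply: ne; apply: val_inj.
rewrite big1 // => i _ /=; rewrite (_ : (n == i) = false) ?mulr0 //.
by apply/negP => /eqP h; move: nN; rewrite h ltn_ord.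
Qed.

Lemma l2trunc_lim x : seq_lim (l2trunc x) x.
Proof.
move=> e e0; have e2 : 0 < (e / 2) ^+ 2 by rewrite exprn_gt0 //; lra.
have [N hN] := nondecreasing_bounded_cauchy (sqsum_mono x) (sqsum_le x) e2.
exists N => n Nn; apply: (@le_lt_trans _ _ (e / 2)); last lra.
rewrite nrm_distC nrm_l2; apply: l2norm_le => [|m]; first lra.
have h : sqsum (x - l2trunc x n) m <= l2nsq x - sqsum x n.
  have [mn|nm] := leqP m n.
    rewrite /sqsum big1 => [|i _]; first by rewrite subr_ge0 sqsum_le.
    by rewrite l2B l2truncE (leq_trans (ltn_ord i) mn) subrr nrm0 expr0n.
  rewrite lerBrDr; apply: le_trans (sqsum_le x m); rewrite -(subnKC (ltnW nm)).
  elim: (m - n)%N => [|k ih].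
    rewrite addn0 /sqsum big1 ?add0r // => i _.
    by rewrite l2B l2truncE ltn_ord subrr nrm0 expr0n.
  have sqS (y : l2) M : sqsum y M.+1 = sqsum y M + nrm (y M) ^+ 2.
    by rewrite /sqsum big_ord_recr.
  by rewrite addnS !sqS addrAC lerD // l2B l2truncE ltnNge leq_addr /= subr0.
by apply: le_trans h _; have /andP[h1 _] := hN n Nn; rewrite -/(l2nsq x) in h1; lra.
Qed.

Lemma nrm_l2delta n : nrm (l2delta n) <= 1.
Proof.
rewrite nrm_l2; apply: l2norm_le => // N; rewrite expr1n.
elim: N => [|N ih]; first by rewrite /sqsum big_ord0.
have [Nn|Nn] := leqP N n.
  rewrite /sqsum big_ord_recr /= big1 => [|i _].
    by rewrite add0r; case: (_ && _); rewrite ?nrm1 ?nrm0 ?expr1n ?expr0n.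
  by rewrite ltn_eqF ?nrm0 ?expr0n // (leq_trans (ltn_ord i)).
by rewrite /sqsum big_ord_recr /= gtn_eqF // nrm0 expr0n addr0; exact: ih.
Qed.

Definition ratc (q : rat * rat) : R[i] := (ratr q.1 +i* ratr q.2)%C.

Lemma ratc_dense (a : R[i]) (e : R) : 0 < e -> exists q, nrm (a - ratc q) < e.
Proof.
move=> e0; have e2 : 0 < e / 2 by lra.
have [p] := @rat_in_itvoo _ (complex.Re a - e / 2) (complex.Re a + e / 2) ltac:(lra).
have [q] := @rat_in_itvoo _ (complex.Im a - e / 2) (complex.Im a + e / 2) ltac:(lra).
rewrite !in_itv /= => /andP[q1 q2] /andP[p1 p2]; exists (p, q).
rewrite (le_lt_trans (nrm_le_ReIm _)) // ReB ImB /=.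
have h1 : `|complex.Re a - ratr p| < e / 2 by rewrite ltr_norml; lra.
have h2 : `|complex.Im a - ratr q| < e / 2 by rewrite ltr_norml; lra.
lra.
Qed.

Lemma l2_separable : separable l2.
Proof.
pose f (s : seq (rat * rat)) : l2 :=
  \sum_(i < size s) ratc (nth (0, 0) s i) *: l2delta i.
exists (range f).
  by apply: (card_le_trans (card_image_le _ _)); exact: countableP.
move=> O [x Ox] oO.
have /nbhs_nrmP[d d0 hd] : nbhs x O by exact: open_nbhs_nbhs.
have d2 : 0 < d / 2 by lra.
have [N hN] := l2trunc_lim x d2; have {}hN := hN N (leqnn N).
have e0 : 0 < d / 2 / N.+1%:R by rewrite divr_gt0.
have [q hq] := choice (fun n => ratc_dense (x n) e0).
pose s := mkseq q N; exists (f s); split; last by exists s.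
apply: hd; have -> : f s - x = (l2trunc x N - x) - (l2trunc x N - f s).
  by rewrite opprB [RHS]addrC addrA subrK.
apply: (@lt_le_trans _ _ (d / 2 + d / 2)); last lra.
apply: (le_lt_trans (nrmB _ _)); apply: ltr_leD => //.
have -> : l2trunc x N - f s = \sum_(i < N) (x i - ratc (q i)) *: l2delta i.
  rewrite /f /l2trunc size_mkseq -sumrB; apply: eq_bigr => i _.
  by rewrite nth_mkseq // scalerBl.
apply: (le_trans (nrm_sum _ _ _)).
apply: (@le_trans _ _ (\sum_(i < N) d / 2 / N.+1%:R)).
  apply: ler_sum => i _; rewrite nrmZ -[leRHS]mulr1.
  by rewrite ler_pM ?nrm_ge0 ?nrm_l2delta // ltW.
rewrite sumr_const card_ord -[_ *+ N]mulr_natr -(mulrA (d / 2)) ler_piMr ?(ltW d2) //.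
by rewrite mulrC ler_pdivrMr // mul1r ler_nat.
Qed.

End SquareSummableBasis.

(** * The operator of a positive functional on polynomials *)

Section PolynomialSpace.
Context {R : realType}.
Variables (B : {poly R[i]} -> {poly R[i]} -> R[i]) (K : R).
Implicit Types (p q r : {poly R[i]}) (a c : R[i]).
Hypothesis BDl : forall p q r, B (p + q) r = B p r + B q r.
Hypothesis BZl : forall a p r, B (a *: p) r = a * B p r.
Hypothesis Bherm : forall p q, B q p = (B p q)^*.
Hypothesis Bpos : forall p, 0 <= B p p.
Hypothesis BX : forall p q, B ('X * p) q = B p ('X * q).
Hypothesis K0 : 0 < K.
Hypothesis Bbound : forall p,
  complex.Re (B ('X * p) ('X * p)) <= K ^+ 2 * complex.Re (B p p).

Lemma BDr p q r : B p (q + r) = B p q + B p r.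
Proof. by rewrite Bherm BDl rmorphD /= -!Bherm. Qed.
Lemma BZr a p r : B p (a *: r) = a^* * B p r.
Proof. by rewrite Bherm BZl rmorphM /= -Bherm. Qed.
Lemma B0l p : B 0 p = 0.
Proof. by have := BZl 0 0 p; rewrite scaler0 mul0r. Qed.
Lemma B0r p : B p 0 = 0.
Proof. by rewrite Bherm B0l rmorph0. Qed.
Lemma BNl p q : B (- p) q = - B p q.
Proof. by rewrite -scaleN1r BZl mulN1r. Qed.
Lemma B_suml (I : Type) (s : seq I) (F : I -> {poly R[i]}) q :
  B (\sum_(i <- s) F i) q = \sum_(i <- s) B (F i) q.
Proof. by elim: s => [|i s ih]; rewrite ?big_nil ?B0l // !big_cons BDl ih. Qed.
Lemma B_sumr (I : Type) (s : seq I) (F : I -> {poly R[i]}) q :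
  B q (\sum_(i <- s) F i) = \sum_(i <- s) B q (F i).
Proof. by elim: s => [|i s ih]; rewrite ?big_nil ?B0r // !big_cons BDr ih. Qed.

Definition bsq p : R := complex.Re (B p p).

Lemma bsqE p : B p p = (bsq p)%:C%C.
Proof. by have := Bpos p; rewrite ge0_complexE => /andP[/eqP h _]; apply: complex_ext. Qed.

Lemma bsq_ge0 p : 0 <= bsq p.
Proof. by have := Bpos p; rewrite bsqE ler0c. Qed.

(** Along the line from [p] in the direction [q] the quadratic term is absent, so nonnegativity
    forces the linear term to vanish. *)
Lemma bsq_eq0 p q : bsq q = 0 -> B p q = 0.
Proof.
move=> q0; set x := B p q.
have key (s : R) : 0 <= bsq p - 2 * s * nrm x ^+ 2.
  have := Bpos (p + (- (s%:C%C * x)) *: q).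
  rewrite BDl !BDr BZl !BZr BZl (bsqE q) q0 (bsqE p) (Bherm p q) -/x rmorph0 !mulr0 addr0.
  rewrite rmorphN rmorphM /= conj_real.
  have -> : (bsq p)%:C%C + - (s%:C%C * x^*) * x + - (s%:C%C * x) * x^*
    = (bsq p)%:C%C - 2 * s%:C%C * (x * x^*) by ring.
  by rewrite mul_conj -(rmorph_nat (real_complex R) 2) -!rmorphM -rmorphB /= ler0c.
apply: nrm0_eq0; apply/eqP; rewrite -sqrf_eq0 eq_le exprn_ge0 ?nrm_ge0 // andbT.
rewrite leNgt; apply/negP => x0.
have := key ((bsq p + 1) / nrm x ^+ 2).
by rewrite -mulrA mulfVK ?gt_eqF //; have := bsq_ge0 p; lra.
Qed.

Definition ortho_monic n e :=
  [/\ e \is monic, size e = n.+1 & forall p, (size p <= n)%N -> B p e = 0].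

Lemma monic_basis (e : nat -> {poly R[i]}) n :
  (forall m, (m < n)%N -> e m \is monic /\ size (e m) = m.+1) ->
  forall p, (size p <= n)%N -> exists a : nat -> R[i], p = \sum_(m < n) a m *: e m.
Proof.
elim: n => [|n ih] he p sp.
  by exists (fun=> 0); rewrite big_ord0; apply/eqP; rewrite -size_poly_leq0.
have [mn sn] := he n (ltnSn n).
have [||a ha] := ih _ (p - p`_n *: e n).
- by move=> m mn'; apply: he; rewrite ltnS ltnW.
- apply/leq_sizeP => j; rewrite leq_eqVlt => /predU1P[<-|nj].
    rewrite coefB coefZ; move: (monicP mn); rewrite lead_coefE sn /= => ->.
    by rewrite mulr1 subrr.
  rewrite coefB coefZ [p`_j]nth_default ?(leq_trans sp) //.
  by rewrite [(e n)`_j]nth_default ?mulr0 ?subrr // sn.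
exists (fun m => if m == n then p`_n else a m).
rewrite big_ord_recr /= eqxx -[LHS](subrK (p`_n *: e n)) ha; congr (_ + _).
by apply: eq_bigr => i _; rewrite ltn_eqF.
Qed.

(** Gram-Schmidt applied to the monomials, for a form that may be degenerate. *)
Lemma ortho_monic_ex n : exists e, ortho_monic n e.
Proof.
elim/ltn_ind: n => n ih.
have [e he] : exists e : nat -> {poly R[i]}, forall m, (m < n)%N -> ortho_monic m (e m).
  have h m : exists e, (m < n)%N -> ortho_monic m e.
    by have [mn|nm] := ltnP m n; [have [e he] := ih m mn; exists e|exists 0].
  by have [e he] := choice h; exists e.
pose s : {poly R[i]} := \sum_(m < n) (B 'X^n (e m) / B (e m) (e m)) *: e m.
have ss : (size s <= n)%N.
  apply: (leq_trans (size_sum _ _ _)); apply/bigmax_leqP => m _.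
  by apply: (leq_trans (size_scale_leq _ _)); have [_ -> _] := he m (ltn_ord m).
have sX : size ('X^n - s) = n.+1.
  by rewrite size_polyDl ?size_polyXn // size_polyN.
exists ('X^n - s); split=> //.
  rewrite monicE lead_coefE sX /= coefB coefXn eqxx nth_default ?subr0 //.
have basis : forall p, (size p <= n)%N -> exists a : nat -> R[i], p = \sum_(m < n) a m *: e m.
  by apply: monic_basis => m /he[].
have oe m : (m < n)%N -> B (e m) ('X^n - s) = 0.
  move=> mn; rewrite Bherm BDl BNl B_suml.
  rewrite (bigD1 (Ordinal mn)) //= big1 => [|k km].
    (* If [e m] is a null vector, the coefficient in [s] is a division by zero, hence 0, and ['X^n]
       is orthogonal to [e m] anyway. *)
    rewrite addr0 BZl; have [z|nz] := eqVneq (B (e m) (e m)) 0.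
      rewrite bsq_eq0; first by rewrite mul0r mul0r subrr rmorph0.
      by rewrite /bsq z.
    by rewrite divfK // subrr rmorph0.
  rewrite BZl; have : val k != m by apply: contraNneq km => h; apply/eqP/val_inj.
  rewrite neq_ltn => /orP[km'|mk].
    have [_ sk _] := he k (ltn_ord k); have [_ _ om] := he m mn.
    by rewrite (om (e k)) ?mulr0 // sk.
  have [_ sm _] := he m mn; have [_ _ ok] := he k (ltn_ord k).
  by rewrite (Bherm (e m) (e k)) (ok (e m)) ?rmorph0 ?mulr0 // sm.
move=> p /basis[a ->]; rewrite B_suml big1 // => m _.
by rewrite BZl oe ?mulr0.
Qed.

(* A sequence of orthogonal polynomials; some of them may have norm [0], and the
   predicate [P] of [cyclic_model] discards these. *)
Lemma cyclic_model : exists (P : pred nat) (Phi : {poly R[i]} -> @l2 R P)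
    (S : {linear @l2 R P -> @l2 R P}),
  [/\ forall p q, inner (Phi p) (Phi q) = B p q,
      forall p, S (Phi p) = Phi ('X * p),
      forall x, nrm (S x) <= K * nrm x,
      forall x y, inner (S x) y = inner x (S y) &
      forall x, (forall p, inner x (Phi p) = 0) -> x = 0].
Proof.
have [e he] := choice ortho_monic_ex.
pose w n := Num.sqrt (bsq (e n)).
have w_ge0 n : 0 <= w n by exact: sqrtr_ge0.
have ww n : w n ^+ 2 = bsq (e n) by rewrite sqr_sqrtr ?bsq_ge0.
pose P n := w n != 0.
have nP n : ~~ P n -> w n = 0 by move/negPn/eqP.
have basis p : exists a : nat -> R[i], p = \sum_(m < size p) a m *: e m.
  by apply: monic_basis => // m _; have [] := he m.
have oe m n : m != n -> B (e m) (e n) = 0.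
  rewrite neq_ltn => /orP[mn|nm].
    by have [_ _ ->] := he n => //; have [_ -> _] := he m.
  by rewrite Bherm; have [_ _ ->] := he m; rewrite ?rmorph0 //; have [_ -> _] := he n.
have Be n : B (e n) (e n) = (w n)%:C%C * (w n)%:C%C.
  by rewrite bsqE -ww expr2 rmorphM.
have Bcoord (a : nat -> R[i]) N n : B (\sum_(m < N) a m *: e m) (e n)
    = if (n < N)%N then a n * ((w n)%:C%C * (w n)%:C%C) else 0.
  rewrite B_suml; case: ifP => nN.
    rewrite (bigD1 (Ordinal nN)) //= big1 => [|k kn]; first by rewrite addr0 BZl Be.
    rewrite BZl oe ?mulr0 //; by apply: contraNneq kn => h; apply/eqP/val_inj.
  rewrite big1 // => k _; rewrite BZl oe ?mulr0 //.
  by apply: contraFneq nN => <-; exact: ltn_ord.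
(* The coordinate of [p] along the normalized [e n]; it is 0 for a null vector, since the inverse of
   0 is 0. *)
pose phi p n : R[i] := B p (e n) / (w n)%:C%C.
have phiE (a : nat -> R[i]) N n : phi (\sum_(m < N) a m *: e m) n
    = if (n < N)%N then a n * (w n)%:C%C else 0.
  rewrite /phi Bcoord; case: ifP => _; last by rewrite mul0r.
  have [w0|w0] := eqVneq (w n) 0; first by rewrite w0 rmorph0 !mulr0 mul0r.
  by rewrite mulrA mulfK // fmorph_eq0.
have phi_big p n : (size p <= n)%N -> phi p n = 0.
  by move=> sp; rewrite /phi; have [_ _ ->] := he n; rewrite ?mul0r.
have phi_sq p : square_summable P (phi p).
  split=> [n /nP wn|]; first by rewrite /phi wn rmorph0 invr0 mulr0.
  exists (sqsum (phi p) (size p)) => N; have [Np|pN] := leqP N (size p).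
    rewrite -(subnKC Np); elim: (_ - _)%N => [|k ih]; first by rewrite addn0.
    by rewrite addnS (le_trans ih) // sqsum_mono.
  rewrite -(subnKC (ltnW pN)); elim: (_ - _)%N => [|k ih]; first by rewrite addn0.
  rewrite addnS /sqsum big_ord_recr /= phi_big ?leq_addr // nrm0 expr0n addr0.
  exact: ih.
pose Phi p : @l2 R P := L2 (phi_sq p).
have PhiP p q : inner (Phi p) (Phi q) = B p q.
  change (l2inner (Phi p) (Phi q) = B p q); apply: l2inner_eq => d d0.
  pose M := maxn (size p) (size q); exists M => N MN.
  suff -> : \sum_(i < N) Phi p i * (Phi q i)^* = B p q by rewrite subrr nrm0.
  have [sp sq] : (size p <= N)%N /\ (size q <= N)%N.
    by move: MN; rewrite geq_max => /andP[].
  have he' : forall m, (m < N)%N -> e m \is monic /\ size (e m) = m.+1.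
    by move=> m _; have [] := he m.
  have [a pE] := monic_basis he' sp; have [b qE] := monic_basis he' sq.
  rewrite {2}qE B_sumr; apply: eq_bigr => i _.
  rewrite /= {1}pE {1}qE !phiE ltn_ord BZr {1}pE Bcoord ltn_ord rmorphM /= conj_real.
  by ring.
have PhiZ a p : Phi (a *: p) = a *: Phi p.
  by apply: l2_ext => n; rewrite /= /phi BZl mulrA.
have PhiD p q : Phi (p + q) = Phi p + Phi q.
  by apply: l2_ext => n; rewrite /= /phi BDl mulrDl.
have Phi_sum (I : Type) (s : seq I) (F : I -> {poly R[i]}) :
    Phi (\sum_(i <- s) F i) = \sum_(i <- s) Phi (F i).
  elim: s => [|i s ih]; last by rewrite !big_cons PhiD ih.
  by rewrite !big_nil; apply: l2_ext => n; rewrite /= /phi B0l mul0r.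
pose c n : R[i] := ((w n)^-1)%:C%C.
pose u n := Phi ('X * (c n *: e n)).
have deltaE n : l2delta P n = Phi (c n *: e n).
  apply: l2_ext => m; rewrite /= /phi BZl /c.
  have [->|mn] := eqVneq m n.
    rewrite Be /P; have [->|w0] := eqVneq (w n) 0.
      by rewrite rmorph0 !mulr0 mul0r.
    by rewrite /= fmorphV; field; rewrite fmorph_eq0.
  by rewrite oe 1?eq_sym // mulr0 mul0r.
(* The [n]-th coordinate of [S x] is prescribed as [x] against ['X] times the [n]-th basis vector.
   This defines [S] on the whole space at once, without extension by density, and symmetry on basis
   vectors is built in. *)
pose s0 (x : @l2 R P) n : R[i] := inner x (u n).
have s0_bound (x : @l2 R P) N : sqsum (s0 x) N <= (K * nrm x) ^+ 2.
  set T := sqsum (s0 x) N.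
  (* For this [r], [T = inner x (Phi ('X * r))] and [bsq r <= T]. Cauchy-Schwarz and [Bbound] give
     [T^2 <= nrm x ^2 K^2 T], and one factor [T] cancels. *)
  pose r := \sum_(n < N) s0 x n *: (c n *: e n).
  have rE : Phi ('X * r) = \sum_(n < N) s0 x n *: u n.
    rewrite /r mulr_sumr Phi_sum; apply: eq_bigr => n _.
    by rewrite -scalerAr PhiZ.
  have TE : inner x (Phi ('X * r)) = T%:C%C.
    rewrite rE inner_sumr /T /sqsum rmorph_sum /=; apply: eq_bigr => n _.
    by rewrite innerZr -/(s0 x n) mulrC mul_conj.
  have T0 : 0 <= T by exact: sqsum_ge0.
  have rr : bsq r <= T.
    rewrite -lecR -bsqE -PhiP.
    have -> : Phi r = \sum_(n < N) s0 x n *: l2delta P n.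
      by rewrite /r Phi_sum; apply: eq_bigr => n _; rewrite PhiZ deltaE.
    rewrite inner_sumr /T /sqsum rmorph_sum /=; apply: ler_sum => n _.
    rewrite innerZr inner_l2delta l2_sum (bigD1 n) //= big1 => [|k kn].
      rewrite eqxx /= addr0; case: (P n); last first.
        by rewrite !mulr0 ler0c exprn_ge0 // nrm_ge0.
      by rewrite mulr1 mulrC mul_conj.
    rewrite (_ : (val n == k) = false) ?mulr0 //.
    by apply/negP => /eqP h; move: kn; rewrite -(inj_eq val_inj) h eqxx.
  have nX : nrm (Phi ('X * r)) ^+ 2 <= K ^+ 2 * T.
    have : (nrm (Phi ('X * r)) ^+ 2)%:C%C = (bsq ('X * r))%:C%C :> R[i].
      by rewrite -inner_nrm PhiP bsqE.
    move=> /complexI ->; apply: (le_trans (Bbound r)).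
    by rewrite ler_wpM2l // exprn_ge0 // ltW.
  have := cauchy_schwarz x (Phi ('X * r)); rewrite TE nrm_real ger0_norm // => h.
  have h2 : T ^+ 2 <= nrm x ^+ 2 * (K ^+ 2 * T).
    apply: (@le_trans _ _ ((nrm x * nrm (Phi ('X * r))) ^+ 2)).
      by rewrite ler_pXn2r ?nnegrE // mulr_ge0 // nrm_ge0.
    by rewrite exprMn ler_wpM2l // exprn_ge0 // nrm_ge0.
  have [->|Tn] := eqVneq T 0; first by rewrite exprn_ge0 // mulr_ge0 ?nrm_ge0 // ltW.
  have Tp : 0 < T by rewrite lt_neqAle eq_sym Tn.
  by rewrite -(ler_pM2r Tp) -expr2 exprMn mulrAC (le_trans h2) // mulrA (mulrC (nrm x ^+ 2)) mulrAC.
have s0_sq x : square_summable P (s0 x).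
  split=> [n /nP wn|]; last by exists ((K * nrm x) ^+ 2); exact: s0_bound.
  rewrite /s0 /u /c wn invr0 rmorph0 scale0r mulr0.
  have -> : Phi 0 = 0 by have := PhiZ 0 0; rewrite scaler0 scale0r.
  exact: inner0r.
pose S0 x : @l2 R P := L2 (s0_sq x).
have lS : linear S0.
  by move=> a x y; apply: l2_ext => n; rewrite /= /s0 innerDl innerZl.
pose S : {linear @l2 R P -> @l2 R P} := HB.pack S0 (GRing.isLinear.Build _ _ _ *:%R S0 lS).
have SPhi p : S (Phi p) = Phi ('X * p).
  apply: l2_ext => n; rewrite /= /s0 /u PhiP -BX /phi BZr /c conj_real fmorphV.
  by rewrite mulrC.
have SK x : nrm (S x) <= K * nrm x.
  rewrite nrm_l2; apply: l2norm_le; first by rewrite mulr_ge0 ?nrm_ge0 // ltW.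
  exact: s0_bound.
have Sdelta x n : inner (S x) (l2delta P n) = inner x (S (l2delta P n)).
  by rewrite inner_l2delta deltaE SPhi.
exists P, Phi, S; split => //.
- move=> x y; have Strunc N : inner (S x) (l2trunc y N) = inner x (S (l2trunc y N)).
    rewrite /l2trunc (linear_sum S) !inner_sumr; apply: eq_bigr => i _.
    by rewrite (linearZ_LR S) !innerZr Sdelta.
  have lim1 : seq_lim (fun N => inner (S x) (l2trunc y N)) (inner (S x) y).
    move=> d /(seq_lim_conj (seq_lim_inner (S x) (l2trunc_lim y)))[N hN].
    by exists N => n /hN; rewrite !inner_conj.
  apply: (seq_lim_unique lim1) => d d0.
  have SB : linear (S : @l2 R P -> @l2 R P) by move=> a z z'; exact: linearP.
  have /(_ _ d0)[N hN] := seq_lim_conj (seq_lim_inner x (seq_lim_linear SB SK (l2trunc_lim y))).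
  by exists N => n /hN; rewrite !inner_conj Strunc.
- move=> x hx; apply: l2_ext => n; rewrite l20 -inner_l2delta deltaE; exact: hx.
Qed.

End PolynomialSpace.

(** * Moments of a Herglotz-Nevanlinna function *)

Section Joukowski.
Context {R : realType}.
Variable h : R.
Hypothesis h0 : 0 < h.
Implicit Types (w z c : R[i]) (g : R[i] -> R[i]) (r s : {poly R[i]}).

Definition jouk w : R[i] := h%:C%C * (w + w^-1).
(** This is [w] times the derivative of [jouk], so [dz = kap w * dw / w]: the mean of
    [g (jouk w) * kap w] is a contour integral of [g] divided by [2 pi i]. For small circles the
    image contour runs clockwise. *)
Definition kap w : R[i] := h%:C%C * (w - w^-1).

Definition off_segment z := complex.Im z != 0 \/ 2 * h < nrm z.

Lemma inv_conj_nrm w : w^-1 = w^* * ((nrm w ^+ 2)^-1)%:C%C.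
Proof.
have [->|w0] := eqVneq w 0; first by rewrite invr0 rmorph0 mul0r.
have -> : ((nrm w ^+ 2)^-1)%:C%C = (w * w^*)^-1 :> R[i] by rewrite mul_conj; exact: fmorphV.
by field; rewrite w0 fmorph_eq0 w0.
Qed.

Lemma Im_jouk w : complex.Im (jouk w)
  = h * complex.Im w * (1 - (nrm w ^+ 2)^-1).
Proof.
rewrite /jouk inv_conj_nrm ImM Re_real Im_real mul0r addr0 ImD ImM Re_real Im_real.
by rewrite mulr0 add0r Im_conj; ring.
Qed.

Lemma jouk_off w : 0 < nrm w < 1 -> off_segment (jouk w).
Proof.
move=> /andP[w0 w1]; have [wI|wI] := eqVneq (complex.Im w) 0; last first.
  left; rewrite Im_jouk; apply: mulf_neq0; first by apply: mulf_neq0 => //; rewrite gt_eqF.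
  by rewrite subr_eq0 lt_eqF // invf_gt1 ?exprn_gt0 // exprn_ilt1 // ltW.
right; have wE : w = (complex.Re w)%:C%C by apply: complex_ext.
set a := complex.Re w in wE; move: w0 w1; rewrite wE nrm_real => a0 a1.
rewrite /jouk -fmorphV -rmorphD nrmM !nrm_real gtr0_norm // mulrC ltr_pM2l //.
have an : a != 0 by rewrite -normr_gt0.
have -> : a + a^-1 = (a ^+ 2 + 1) / a by field.
rewrite normrM normfV ltr_pdivlMr // ger0_norm ?addr_ge0 ?sqr_ge0 //.
rewrite -(real_normK (num_real a)).
have : 0 < (1 - `|a|) ^+ 2 by rewrite exprn_gt0 // subr_gt0.
by move: `|a| => x; clear; nra.
Qed.

(** The equation is quadratic in [w] with roots inverse to each other; none has modulus 1, since
    [jouk] is real on the unit circle. *)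
Lemma jouk_surj z : complex.Im z != 0 -> exists2 w, 0 < nrm w < 1 & jouk w = z.
Proof.
move=> zI; have hn : h%:C%C != 0 :> R[i] by rewrite fmorph_eq0 gt_eqF.
pose p : {poly R[i]} := 'X^2 - (z / h%:C%C) *: 'X + 1.
have [w rw] : exists w, root p w.
  apply: closed_rootP; rewrite /p -addrA size_polyDl ?size_polyXn //.
  rewrite (leq_ltn_trans (size_polyD _ _)) // gtn_max size_poly1 andbT.
  by rewrite size_polyN (leq_ltn_trans (size_scale_leq _ _)) // size_polyX.
have pw : w ^+ 2 - z / h%:C%C * w + 1 = 0.
  by move: rw; rewrite rootE /p !hornerE => /eqP.
have w0 : w != 0.
  apply/negP => /eqP w0; move: pw => /eqP.
  by rewrite w0 expr0n mulr0 subr0 add0r oner_eq0.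
have jw : jouk w = z.
  rewrite /jouk; have -> : w + w^-1 = (w ^+ 2 + 1) / w by field.
  have -> : w ^+ 2 + 1 = z / h%:C%C * w.
    by apply/eqP; rewrite -subr_eq0 -pw; apply/eqP; ring.
  by field; rewrite w0 hn.
have nw : nrm w != 1.
  apply: contraNneq zI => w1; rewrite -jw Im_jouk w1 expr1n invr1 subrr mulr0 //.
have nw0 : 0 < nrm w by rewrite nrm_gt0.
move: nw; rewrite neq_lt => /orP[w1|w1]; first by exists w => //; rewrite nw0.
exists w^-1; last by rewrite -jw /jouk invrK addrC.
by rewrite nrmV invr_gt0 nw0 invf_lt1.
Qed.

Lemma cdiff_jouk w : w != 0 -> cdiff jouk w.
Proof.
move=> w0; apply: cdiffM; first exact: cdiff_cst.
by apply: cdiffD; [exact: cdiff_id|exact: cdiff_inv].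
Qed.

Lemma cdiff_kap w : w != 0 -> cdiff kap w.
Proof.
move=> w0; apply: cdiffM; first exact: cdiff_cst.
by apply: cdiffB; [exact: cdiff_id|exact: cdiff_inv].
Qed.

(** The centre corresponds to infinity. If [z * g z] tends to [- c] there, the product tends to [c],
    because [kap w / jouk w] tends to [-1]. *)
Definition ext g c w := if w == 0 then c else g (jouk w) * kap w.

Lemma cdiff_ext g c w : (forall z, off_segment z -> cdiff g z) ->
  0 < nrm w < 1 -> cdiff (ext g c) w.
Proof.
move=> dg w01; have w0 : w != 0 by rewrite -nrm_gt0; case/andP: w01.
apply: (@cdiff_near _ (fun w => g (jouk w) * kap w)).
  exists (nrm w) => [|u hu]; first by rewrite nrm_gt0.
  rewrite /ext ifF //; apply/negP => /eqP u0; move: hu.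
  by rewrite u0 sub0r nrmN ltxx.
apply: cdiffM; last exact: cdiff_kap.
by apply: (cdiff_comp (cdiff_jouk w0)); apply: dg; exact: jouk_off.
Qed.

Lemma cont_ext g c (C r0 : R) : 0 <= C ->
  (forall z, r0 < nrm z -> nrm (z * g z + c) <= C / nrm z) ->
  {for 0, continuous (ext g c)}.
Proof.
move=> C0 hg; apply/ccontP => e e0.
have c0 := nrm_ge0 c.
(* The numerator found below has norm at most [(nrm c + 5/2 * (C / h)) * nrm w] and the denominator
   is at least 3/4; the factor 4 covers both, and the 1 makes [M] positive. *)
pose M := 4 * (nrm c + C / h) + 1.
have Ch : 0 <= C / h by rewrite divr_ge0 // ltW.
have M0 : 0 < M by rewrite /M; lra.
pose d := Num.min (1 / 2) (Num.min (h / (2 * (`|r0| + 1))) (e / M)).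
have r1 : 0 < `|r0| + 1 by have := normr_ge0 r0; lra.
have d0 : 0 < d by rewrite !lt_min !divr_gt0 ?mulr_gt0 //; lra.
have [d1 d2 d3] : [/\ d <= 1 / 2, d <= h / (2 * (`|r0| + 1)) & d <= e / M].
  by rewrite /d; split; rewrite !ge_min lexx ?orbT.
clearbody d; exists d => // w; rewrite subr0 => wd.
rewrite /ext eqxx; have [_|w0] := eqVneq w 0; first by rewrite subrr nrm0.
have wp : 0 < nrm w by rewrite nrm_gt0.
have w12 : nrm w <= 1 / 2 by rewrite (le_trans (ltW wd)).
have w2 : nrm (w ^+ 2) <= 1 / 4.
  by rewrite nrmX; move: wp w12; clear; move: (nrm w) => x; nra.
have hn : h%:C%C != 0 :> R[i] by rewrite fmorph_eq0 gt_eqF.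
have nw : 3 / 4 <= nrm (1 + w ^+ 2).
  have := nrm_ler_distB (1 : R[i]) (- w ^+ 2); rewrite opprK nrm1 nrmN; lra.
have w2n : 1 + w ^+ 2 != 0 by rewrite -nrm_gt0; lra.
set z := jouk w; have zE : z = h%:C%C * (1 + w ^+ 2) / w.
  by rewrite /z /jouk; field.
have z0 : z != 0 by rewrite zE !mulf_neq0 // invr_neq0.
have nz : h / (2 * nrm w) <= nrm z.
  rewrite zE !nrmM nrmV nrm_real (gtr0_norm h0) invfM mulrA ler_wpM2r ?invr_ge0 ?(ltW wp) //.
  by rewrite ler_wpM2l ?(ltW h0) //; lra.
have zr : r0 < nrm z.
  apply: lt_le_trans nz; rewrite ltr_pdivlMr ?mulr_gt0 //.
  have h1 : nrm w * (2 * (`|r0| + 1)) < h.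
    by rewrite -ltr_pdivlMr ?mulr_gt0 //; lra.
  have h2 : r0 * (2 * nrm w) <= `|r0| * (2 * nrm w).
    by rewrite ler_wpM2r ?ler_norm // mulr_ge0 // ltW.
  by move: h1 h2 wp; move: `|r0| (nrm w) (r0 * _) => x y u; clear; lra.
have := hg z zr; set dl := z * g z + c => hd.
have -> : g z * kap w - c = (- (2 * (c * w ^+ 2)) - dl * (1 - w ^+ 2)) / (1 + w ^+ 2).
  have -> : g z = (dl - c) / z by rewrite /dl addrK mulrC mulKf.
  by rewrite zE /kap; field; rewrite w0 w2n hn.
rewrite nrmM nrmV ltr_pdivrMr; last lra.
have two : nrm (2 : R[i]) = 2.
  by rewrite (_ : 2 = (2 : R)%:C%C) ?nrm_real ?ger0_norm // rmorph_nat.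
apply: le_lt_trans (nrmB _ _) _.
have -> : nrm (- (2 * (c * w ^+ 2))) = 2 * (nrm c * nrm w ^+ 2).
  by rewrite nrmN (nrmM 2) two (nrmM c) nrmX.
rewrite (nrmM dl).
have n1 : nrm (1 - w ^+ 2) <= 5 / 4.
  by apply: le_trans (nrmB _ _) _; rewrite nrm1; lra.
have hd2 : nrm dl <= 2 * (C / h) * nrm w.
  apply: le_trans hd _; rewrite ler_pdivrMr; last by rewrite nrm_gt0.
  have := ler_wpM2l (mulr_ge0 (mulr_ge0 (ler0n R 2) Ch) (ltW wp)) nz.
  apply: le_trans; rewrite le_eqVlt; apply/orP; left; apply/eqP; field.
  by rewrite !gt_eqF.
have wM : M * nrm w < e.
  by rewrite mulrC -ltr_pdivlMr //; apply: lt_le_trans wd _.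
have h3 : nrm dl * nrm (1 - w ^+ 2) <= 2 * (C / h) * nrm w * (5 / 4).
  by apply: ler_pM => //; exact: nrm_ge0.
have h4 : nrm c * nrm w ^+ 2 <= nrm c * (nrm w * (1 / 2)).
  by rewrite ler_wpM2l // expr2 ler_wpM2l // ltW.
have h5 : 0 <= nrm c * nrm w by rewrite mulr_ge0 // ltW.
have h6 : 0 <= (C / h) * nrm w by rewrite mulr_ge0 // ltW.
have h7 : e * (3 / 4) <= e * nrm (1 + w ^+ 2) by rewrite ler_wpM2l // ltW.
apply: lt_le_trans h7; move: h3 h4 h5 h6 wM wp; rewrite /M.
move: (C / h) (nrm w) (nrm dl * _) (nrm c) => x y u v; clear.
move=> h3 h4 h5 h6 h7 yp; have h8 : 4 * (v * y) + 4 * (x * y) + y < e by lra.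
by rewrite mulrCA in h4; lra.
Qed.

End Joukowski.

(** * Positivity of the moment functional *)

Section Trace.
Context {R : realType}.
Implicit Types (w z c : R[i]) (g : R[i] -> R[i]) (r s : {poly R[i]}).

Lemma cint_conj (a b : R) (g : R -> R[i]) : path_integrable g a b ->
  cint a b (fun t => (g t)^*) = (cint a b g)^*.
Proof.
move=> /path_integrableR[g1 g2]; apply: complex_ext.
  by rewrite Re_conj !Re_cint; apply: eq_Rintegral => t _; rewrite Re_conj.
rewrite Im_conj !Im_cint -[RHS]mulN1r -RintegralZl //.
by apply: eq_Rintegral => t _; rewrite Im_conj mulN1r.
Qed.

Lemma cdiff_sum (I : Type) (l : seq I) (F : I -> R[i] -> R[i]) z :
  (forall i, cdiff (F i) z) -> cdiff (fun w => \sum_(i <- l) F i w) z.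
Proof.
move=> dF; elim: l => [|i l ih].
  by under eq_fun do rewrite big_nil; exact: cdiff_cst.
by under eq_fun do rewrite big_cons; exact: cdiffD.
Qed.

Lemma cdiff_horner r z : cdiff (fun w => r.[w]) z.
Proof.
under eq_fun do rewrite horner_coef.
by apply: cdiff_sum => i; apply: cdiffM; [exact: cdiff_cst|apply: cdiffX; exact: cdiff_id].
Qed.

Lemma horner_conj r z : (map_poly Num.conj r).[z] = (r.[z^*])^*.
Proof. by rewrite -[z in LHS]conjCK horner_map. Qed.

Variable h : R.
Hypothesis h0 : 0 < h.
Local Notation jouk := (jouk h).
Local Notation kap := (kap h).

(** After the substitution a polynomial times [kap] is a Laurent polynomial in [w]; this reduces
    [scaled] to finitely many coefficients. *)
Lemma laurent r : exists s (m : nat), forall w, w != 0 ->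
  r.[jouk w] * kap w = s.[w] * w ^- m.
Proof.
elim/poly_ind: r => [|r c [s [m ih]]].
  by exists 0, 0%N => w w0; rewrite !horner0 !mul0r.
exists (s * (h%:C%C *: ('X^2 + 1%:P)) + (c * h%:C%C) *: (('X^2 - 1%:P) * 'X^m)), m.+1 => w w0.
rewrite hornerMXaddC (_ : _ * kap w = r.[jouk w] * kap w * jouk w + c * kap w); last by ring.
rewrite ih // !(hornerD, hornerN, hornerM, hornerZ, hornerXn, hornerX, hornerC) /jouk /kap.
rewrite (exprSr w m) invfM; field.
by rewrite w0 expf_neq0.
Qed.

Lemma jouk_circle t : jouk (polar 1 t) = (2 * h * cos t)%:C%C.
Proof.
rewrite /jouk inv_conj_nrm nrm_polar0 // expr1n invr1 mulr1 /polar mul1r addC_conj /=.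
by apply: complex_ext; rewrite !ReImE /=; ring.
Qed.

Lemma kap_circle t : kap (polar 1 t) = 'i * (2 * h * sin t)%:C%C.
Proof.
rewrite /kap inv_conj_nrm nrm_polar0 // expr1n invr1 mulr1 /polar mul1r subC_conj /=.
by apply: complex_ext; rewrite !ReImE /=; ring.
Qed.

Variables (V : R[i] -> R[i]) (C r0 : R).
Hypothesis dV : forall z, off_segment h z -> cdiff V z.
Hypothesis sV : forall z, complex.Im z != 0 -> V z = (V z^*)^*.
Hypothesis pV : forall z, complex.Im z != 0 -> 0 <= complex.Im (V z) * complex.Im z.

(* If [V z] is the integral of [1 / (t - z)] against a measure in [t] carried by
   [[- 2h, 2h]], then [ell r] is the integral of [r]. *)
Definition ell r := avg (fun w => ext h V 1 w * r.[jouk w]) (1 / 2).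
(** Here [V] is sampled inside the disc, on the circle of radius [x], while the polynomial is taken
    on the unit circle, where [jouk] is real and the sign of [r] is known. *)
Definition scaled r (x : R) :=
  avg (fun w => V (jouk (x%:C%C * w)) * (r.[jouk w] * kap w)) 1.

Lemma cdiff_V_jouk (x : R) w : 0 < x -> 0 < nrm w -> x * nrm w < 1 ->
  cdiff (fun w => V (jouk (x%:C%C * w))) w.
Proof.
move=> x0 w0 xw; have xn : nrm (x%:C%C * w) = x * nrm w by rewrite nrmM nrm_real gtr0_norm.
apply: (@cdiff_comp _ (fun w => jouk (x%:C%C * w)) V).
  apply: (@cdiff_comp _ (fun w => x%:C%C * w) jouk).
    by apply: cdiffM; [exact: cdiff_cst|exact: cdiff_id].
  by apply: cdiff_jouk; rewrite -nrm_gt0 xn mulr_gt0.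
by apply: dV; apply: jouk_off => //; rewrite xn xw andbT mulr_gt0.
Qed.

Lemma ccirc_V_jouk (x y : R) : 0 < x -> 0 < y -> x * y < 1 ->
  ccirc (fun w => V (jouk (x%:C%C * w))) y.
Proof.
move=> x0 y0 xy; apply: ccirc_cdiff => [|w wy]; first exact: ltW.
by apply: cdiff_V_jouk; rewrite // wy.
Qed.

(** No boundary values of [V] are involved: expanding [r] times [kap] into powers of [w], each
    coefficient depends on [x] only through a power of [x], so [scaled r x] is a Laurent polynomial
    [F] in [x], and [ell r] is its value at 1. *)
Lemma scaled_limit r (e : R) : 0 < e -> exists2 d : R, 0 < d &
  forall x, 0 < x -> 1 - d < x < 1 -> nrm (scaled r x - ell r) <= e.
Proof.
move=> e0; have [s [m hs]] := laurent r.
pose T i w : R[i] := w ^+ i * w ^- m.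
have [c cE] : exists c : nat -> R[i], forall i,
    c i = avg (fun w => V (jouk w) * T i w) (1 / 2).
  by exists (fun i => avg (fun w => V (jouk w) * T i w) (1 / 2)).
pose F w := \sum_(i < size s) s`_i * c i * (w ^+ m * w ^- i).
have dT i w : w != 0 -> cdiff (T i) w.
  move=> w0; apply: cdiffM; last exact: cdiff_invX.
  by apply: cdiffX; exact: cdiff_id.
have cT i y : 0 < y -> ccirc (T i) y.
  move=> y0; apply: ccirc_cdiff => [|w wy]; first exact: ltW.
  by apply: dT; rewrite -nrm_gt0 wy.
have dF : cdiff F 1.
  apply: cdiff_sum => i; apply: cdiffM; first exact: cdiff_cst.
  apply: cdiffM; first by apply: cdiffX; exact: cdiff_id.
  by apply: cdiff_invX; exact: oner_neq0.
have exp x y : 0 < x -> 0 < y -> x * y < 1 ->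
    avg (fun w => V (jouk (x%:C%C * w)) * (r.[jouk w] * kap w)) y
    = \sum_(i < size s) s`_i * avg (fun w => V (jouk (x%:C%C * w)) * T i w) y.
  move=> x0 y0 xy; have cV := ccirc_V_jouk x0 y0 xy.
  under [RHS]eq_bigr => i _ do rewrite -(avgZ _ (ccircM cV (cT i y y0))).
  have cc (i : 'I_(size s)) := ccircM (@ccirc_cst _ s`_i y) (ccircM cV (cT i y y0)).
  rewrite -(avg_sum _ cc).
  apply: eq_avg => t _; set w := polar y t.
  have w0 : w != 0 by rewrite -nrm_gt0 nrm_polar0 // ltW.
  rewrite hs // horner_coef mulr_suml mulr_sumr; apply: eq_bigr => i _.
  by rewrite /T; ring.
(* The coefficient [c i] may be computed over the circle of radius [x]; writing its points as [x]
   times a point of the unit circle produces the powers of [x]. *)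
have scale x i : 0 < x -> x < 1 ->
    avg (fun w => V (jouk (x%:C%C * w)) * T i w) 1
    = c i * (x%:C%C ^+ m * x%:C%C ^- i).
  move=> x0 x1; have xn : x%:C%C != 0 :> R[i] by rewrite fmorph_eq0 gt_eqF.
  have ci : c i = avg (fun w => V (jouk w) * T i w) x.
    have dVT z : 0 < nrm z < 1 -> cdiff (fun w => V (jouk w) * T i w) z.
      move=> /andP[z0 z1]; apply: cdiffM; last by apply: dT; rewrite -nrm_gt0.
      have -> : (fun w => V (jouk w)) = (fun w => V (jouk (1%:C%C * w))).
        by apply/funext => w; rewrite rmorph1 mul1r.
      by apply: cdiff_V_jouk; rewrite ?mul1r.
    rewrite cE; have [x2|x2] := leP x (1 / 2).
      apply/esym; apply: avg_const => [|z /andP[z1 z2]]; first by rewrite x0.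
      by apply: dVT; rewrite (lt_le_trans x0 z1) /=; lra.
    apply: avg_const => [|z /andP[z1 z2]]; first by rewrite (ltW x2) andbT; lra.
    by apply: dVT; rewrite (le_lt_trans z2 x1) andbT; lra.
  rewrite mulrC ci -avgZ.
    rewrite /avg; congr (_ * _); apply: eq_cint => t _.
    rewrite /polar rmorph1 mul1r /T !exprMn invfM.
    have := cis_neq0 t; move: (cis t) => q q0.
    by field; rewrite !expf_neq0.
  have := @ccirc_V_jouk 1 x ltr01 x0; rewrite mul1r => /(_ x1) cV.
  have cV' : ccirc (fun w => V (jouk w)) x.
    have <- : (fun w => V (jouk (1%:C%C * w))) = (fun w => V (jouk w)).
      by apply/funext => w; rewrite rmorph1 mul1r.
    exact: cV.
  exact: (ccircM cV' (cT i x x0)).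
have FE x : 0 < x -> x < 1 -> scaled r x = F x%:C%C.
  move=> x0 x1; rewrite /scaled exp ?mulr1 //; apply: eq_bigr => i _.
  by rewrite scale // mulrA.
have one (i : nat) : 1 ^+ m * 1 ^- i = 1 :> R[i] by rewrite !expr1n invr1 mulr1.
  have F1 : ell r = F 1.
  have -> : ell r = avg (fun w => V (jouk (1%:C%C * w)) * (r.[jouk w] * kap w)) (1 / 2).
    apply: eq_avg => t _; rewrite /ext ifF.
      by rewrite rmorph1 (mul1r (polar _ _)) -mulrA [kap _ * _]mulrC.
    by apply/eqP => p0; have := @nrm_polar0 _ (1/2) t; rewrite p0 nrm0; lra.
  rewrite exp //; last lra; apply: eq_bigr => i _.
  rewrite one mulr1; congr (_ * _); rewrite cE.
  by apply: eq_avg => t _; rewrite rmorph1 (mul1r (polar _ _)).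
have [d d0 hd] := iffLR (ccontP _ _) (cdiff_cont dF) _ e0.
exists d => // x x0 /andP[x1 x2]; rewrite FE // F1 ltW //; apply: hd.
rewrite -(rmorph1 (real_complex R)) -rmorphB nrm_real /= ltr0_norm; lra.
Qed.

(** The change [t] to [- t] conjugates each factor: [V] by its symmetry, the polynomial because
    [jouk] is real on the unit circle, and [kap] because it is purely imaginary and odd in [t]. *)
Lemma scaled_conj r (x : R) : 0 < x -> x < 1 ->
  scaled (map_poly Num.conj r) x = (scaled r x)^*.
Proof.
move=> x0 x1; have p0 := @pi0 R.
have cc p : ccirc (fun w => V (jouk (x%:C%C * w)) * (p.[jouk w] * kap w)) 1.
  have x11 : x * 1 < 1 by rewrite mulr1.
  apply: (ccircM (ccirc_V_jouk x0 ltr01 x11)).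
  apply: ccirc_cdiff => [|w w1]; first exact: ler01.
  have w0 : w != 0 by rewrite -nrm_gt0 w1.
  apply: cdiffM; last exact: cdiff_kap.
  apply: (@cdiff_comp _ jouk (fun w => p.[w])); first exact: cdiff_jouk.
  exact: cdiff_horner.
rewrite /scaled /avg rmorphM /= conj_real; congr (_ * _).
rewrite -cint_conj; last exact: (ccirc_path (cc r)).
rewrite -(cint_opp (ltW p0) (ccirc_path (cc (map_poly Num.conj r)))).
have conj3 (a b c : R[i]) : (a * (b * c))^* = a^* * (b^* * c^*) by rewrite !rmorphM.
apply: eq_cint => t _.
rewrite !jouk_circle !kap_circle horner_conj conj_real conj3 sinN cosN.
have [s0|s0] := eqVneq (sin t) 0.
  by rewrite s0 oppr0 !mulr0 rmorph0 !mulr0.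
congr (_ * (_ * _)); last by apply: complex_ext; rewrite !ReImE /=; ring.
have -> : x%:C%C * polar 1 (- t) = (x%:C%C * polar 1 t)^*.
  by rewrite /polar rmorphM /= conj_real rmorph1 !mul1r cisN.
set w := _ * polar _ _.
have -> : jouk w^* = (jouk w)^*.
  rewrite /jouk [RHS]rmorphM [X in _ = _ * X]rmorphD fmorphV.
  by congr (_ * _); exact/esym/conj_real.
suff zI : complex.Im (jouk w) != 0 by rewrite [in RHS](sV zI) conjCK.
rewrite Im_jouk.
have wn : nrm w = x by rewrite nrmM nrm_polar0 // mulr1 nrm_real gtr0_norm.
have wI : complex.Im w = x * sin t by rewrite /w /polar !ReImE /=; ring.
apply: mulf_neq0; last by rewrite wn subr_eq0 lt_eqF // invf_gt1 ?exprn_gt0 // exprn_ilt1 // ltW.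
by rewrite wI !mulf_neq0 // gt_eqF.
Qed.

(** The real part of the integrand is [- 2 h] times [r] times [sin t * Im V]. Inside the disc
    [Im (jouk w)] has the sign of [- sin t], and [Im V] follows the sign of [Im (jouk w)]. *)
Lemma scaled_ge0 r (x : R) : 0 < x -> x < 1 ->
  (forall y, - (2 * h) <= y <= 2 * h -> 0 <= r.[y%:C%C]) -> 0 <= complex.Re (scaled r x).
Proof.
move=> x0 x1 rp; have p0 := @pi0 R.
rewrite /scaled /avg ReM Re_real Im_real mul0r subr0 mulr_ge0 ?invr_ge0 //; first lra.
rewrite Re_cint; apply: Rintegral_ge0 => t _.
rewrite jouk_circle kap_circle.
have : 0 <= r.[(2 * h * cos t)%:C%C].
  have hh : 0 <= 2 * h by rewrite mulr_ge0 // ltW.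
  have c1 := ler_wpM2l hh (cos_le1 t); have c2 := ler_wpM2l hh (cos_geN1 t).
  by apply: rp; rewrite mulrN1 in c2; rewrite mulr1 in c1; rewrite c2.
rewrite ge0_complexE => /andP[/eqP rI rR].
set w := x%:C%C * _.
have wn : nrm w = x by rewrite nrmM nrm_polar0 // mulr1 nrm_real gtr0_norm.
have wI : complex.Im w = x * sin t by rewrite /w /polar !ReImE /=; ring.
have zI : complex.Im (jouk w) = - (h * x * (x ^- 2 - 1)) * sin t.
  by rewrite Im_jouk wn wI; ring.
have k0 : 0 < h * x * (x ^- 2 - 1).
  by rewrite !mulr_gt0 // subr_gt0 invf_gt1 ?exprn_gt0 // exprn_ilt1 // ltW.
have genRe (a b : R[i]) (q : R) : complex.Im b = 0 ->
    complex.Re (a * (b * ('i * q%:C%C))) = - (complex.Re b * q * complex.Im a).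
  by move=> bI; rewrite !ReImE bI /=; ring.
rewrite genRe //.
have [s0|s0] := eqVneq (sin t) 0; first by rewrite s0 !(mulr0, mul0r) oppr0.
have zn : complex.Im (jouk w) != 0.
  by rewrite zI; apply: mulf_neq0 => //; rewrite oppr_eq0 gt_eqF.
have := pV zn; rewrite zI.
move: k0 rR; set k := h * x * _; set v := complex.Im (V _); set y := complex.Re r.[_].
move=> k0 rR hv; have hv' : 0 <= - (v * sin t).
  by rewrite -(pmulr_rge0 _ k0) (_ : k * _ = v * (- k * sin t)) //; ring.
rewrite (_ : - _ = 2 * (y * h * - (v * sin t))); last by ring.
by rewrite !mulr_ge0 // ltW.
Qed.

Lemma ell_conj r : ell (map_poly Num.conj r) = (ell r)^*.
Proof.
apply/eqP; rewrite -subr_eq0; apply/eqP; apply: nrm_le_eps => e e0.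
have e2 : 0 < e / 2 by lra.
have [d1 d10 h1] := scaled_limit r e2.
have [d2 d20 h2] := scaled_limit (map_poly Num.conj r) e2.
have [x [x0 x1 y1 y2]] : exists x : R, [/\ 0 < x, x < 1, 1 - d1 < x & 1 - d2 < x].
  pose d := Num.min (1 / 2) (Num.min (d1 / 2) (d2 / 2)).
  have [a1 a2 a3] : [/\ d <= 1 / 2, d <= d1 / 2 & d <= d2 / 2].
    by rewrite /d; split; rewrite !ge_min lexx ?orbT.
  have d0 : 0 < d by rewrite !lt_min; apply/and3P; split; lra.
  by clearbody d; exists (1 - d); split; lra.
have := h1 x x0 ltac:(by rewrite y1); have := h2 x x0 ltac:(by rewrite y2).
rewrite scaled_conj // -(nrm_conj (_ - ell r)) rmorphB /= => k2 k1.
have := nrmB ((scaled r x)^* - (ell r)^*) ((scaled r x)^* - ell (map_poly Num.conj r)).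
have -> : forall a b c : R[i], a - b - (a - c) = c - b by move=> *; ring.
by move/le_trans; apply; lra.
Qed.

Lemma ell_Re_ge0 r :
  (forall y, - (2 * h) <= y <= 2 * h -> 0 <= r.[y%:C%C]) -> 0 <= complex.Re (ell r).
Proof.
move=> rp; rewrite leNgt; apply/negP => neg.
have e0 : 0 < - complex.Re (ell r) / 2 by lra.
have [d d0 hd] := scaled_limit r e0.
pose y := Num.max (1 / 2) (1 - d / 2).
have [y1 y2] : 1 / 2 <= y /\ 1 - d / 2 <= y by rewrite /y !le_max !lexx orbT.
have y3 : y < 1 by rewrite gt_max; apply/andP; split; lra.
clearbody y; have y0 : 0 < y by lra.
have := hd y y0 ltac:(apply/andP; split; lra).
have := scaled_ge0 y0 y3 rp; have := Re_le_nrm (scaled r y - ell r).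
rewrite ReB ler_norml => /andP[_]; lra.
Qed.

End Trace.

(** * Identification of the function with a resolvent matrix element *)

Section Spectral.
Context {R : realType}.
Implicit Types (w z c : R[i]) (p q r s : {poly R[i]}).
Variable h : R.
Hypothesis h0 : 0 < h.
Local Notation jouk := (jouk h).
Local Notation kap := (kap h).

Lemma cdiff_horner_jouk r w : w != 0 -> cdiff (fun w => r.[jouk w]) w.
Proof.
move=> w0; apply: (@cdiff_comp _ jouk (fun w => r.[w])); first exact: cdiff_jouk.
exact: cdiff_horner.
Qed.

Lemma ccirc_horner_jouk r (x : R) : 0 < x -> ccirc (fun w => r.[jouk w]) x.
Proof.
move=> x0; apply: ccirc_cdiff => [|w wx]; first exact: ltW.
by apply: cdiff_horner_jouk; rewrite -nrm_gt0 wx.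
Qed.

Lemma off_segment_open z : off_segment h z ->
  exists2 d : R, 0 < d & forall w, nrm (w - z) < d -> off_segment h w.
Proof.
case=> hz.
  exists (`|complex.Im z|); first by rewrite normr_gt0.
  move=> w wz; left; apply: contraTneq wz => w0.
  by rewrite -leNgt (le_trans _ (Im_le_nrm _)) // ImB w0 sub0r normrN.
exists (nrm z - 2 * h); first by rewrite subr_gt0.
by move=> w wz; right; have := nrm_ler_distB z w; rewrite nrm_distC; lra.
Qed.

(** A polynomial has no residue at infinity: the circle is moved to the unit circle, where the
    integrand is odd in [t]. *)
Lemma avg_kap_horner r : avg (fun w => kap w * r.[jouk w]) (1 / 2) = 0.
Proof.
have df w : w != 0 -> cdiff (fun w => kap w * r.[jouk w]) w.
  by move=> w0; apply: cdiffM; [exact: cdiff_kap|exact: cdiff_horner_jouk].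
have -> : avg (fun w => kap w * r.[jouk w]) (1 / 2) = avg (fun w => kap w * r.[jouk w]) 1.
  by apply: avg_const => [|z /andP[z1 _]]; [lra|apply: df; rewrite -nrm_gt0; lra].
have cf : ccirc (fun w => kap w * r.[jouk w]) 1.
  by apply: ccirc_cdiff => // w w1; apply: df; rewrite -nrm_gt0 w1.
rewrite /avg; set I := cint _ _ _.
suff /eqP : I = - I by rewrite -subr_eq0 opprK -mulr2n mulrn_eq0 /= => /eqP ->; rewrite mulr0.
rewrite {1}/I -(cint_opp (ltW pi0) (ccirc_path cf)) -(cintN (ccirc_path cf)).
apply: eq_cint => t _; rewrite !jouk_circle !kap_circle sinN cosN.
by rewrite mulrN rmorphN mulrN mulNr.
Qed.

Variables (V : R[i] -> R[i]) (C r0 : R).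
Hypothesis dV : forall z, off_segment h z -> cdiff V z.
Hypothesis sV : forall z, complex.Im z != 0 -> V z = (V z^*)^*.
Hypothesis pV : forall z, complex.Im z != 0 -> 0 <= complex.Im (V z) * complex.Im z.
Hypothesis C0 : 0 <= C.
Hypothesis aV : forall z, r0 < nrm z -> nrm (z * V z + 1) <= C / nrm z.
Local Notation ell := (ell h V).

Lemma ccirc_ext (g : R[i] -> R[i]) (c : R[i]) : (forall z, off_segment h z -> cdiff g z) -> ccirc (ext h g c) (1 / 2).
Proof.
move=> dg; apply: ccirc_cdiff => [|w w12]; first by lra.
by apply: cdiff_ext => //; rewrite w12; lra.
Qed.

Lemma ellD p q : ell (p + q) = ell p + ell q.
Proof.
have h12 : 0 < 1 / 2 :> R by lra.
have cE r := ccircM (@ccirc_ext V 1 dV) (@ccirc_horner_jouk r _ h12).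
rewrite /ell -avgD //.
by apply: eq_avg => t _; rewrite hornerD mulrDr.
Qed.

Lemma ellZ c p : ell (c *: p) = c * ell p.
Proof.
have h12 : 0 < 1 / 2 :> R by lra.
rewrite /ell -avgZ; last exact: (ccircM (@ccirc_ext V 1 dV) (@ccirc_horner_jouk p _ h12)).
by apply: eq_avg => t _; rewrite hornerZ mulrCA.
Qed.

Lemma ell1 : ell 1 = 1.
Proof.
have h12 : 0 < (1 / 2 : R) < 1 by apply/andP; split; lra.
rewrite /ell; have -> : avg (fun w => ext h V 1 w * (1 : {poly R[i]}).[jouk w]) (1 / 2)
    = avg (ext h V 1) (1 / 2).
  by apply: eq_avg => t _; rewrite hornerC mulr1.
rewrite (avg_center h12) /ext ?eqxx //; first exact: (cont_ext h0 C0 aV).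
by move=> z; exact: cdiff_ext.
Qed.

Definition form p q := ell (p * map_poly Num.conj q).

Lemma formDl p q r : form (p + q) r = form p r + form q r.
Proof. by rewrite /form mulrDl ellD. Qed.

Lemma formZl c p r : form (c *: p) r = c * form p r.
Proof. by rewrite /form -scalerAl ellZ. Qed.

Lemma map_poly_conjK p : map_poly Num.conj (map_poly Num.conj p) = p.
Proof. by apply/polyP => i; rewrite !coef_map /= conjCK. Qed.

Lemma form_herm p q : form q p = (form p q)^*.
Proof.
rewrite /form -(ell_conj h0 dV sV) rmorphM /= map_poly_conjK mulrC //.
Qed.

Lemma form_real p : complex.Im (form p p) = 0.
Proof.
have /(congr1 (@complex.Im R)) := form_herm p p; rewrite Im_conj; lra.
Qed.

Lemma form_X p q : form ('X * p) q = form p ('X * q).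
Proof. by rewrite /form rmorphM /= map_polyX mulrCA mulrA. Qed.

Lemma horner_sqr p z : (p * map_poly Num.conj p).[z^*] = p.[z^*] * p.[z]^*.
Proof. by rewrite hornerM horner_conj conjCK. Qed.

Lemma form_ge0 p : 0 <= form p p.
Proof.
rewrite ge0_complexE form_real eqxx /=; apply: (ell_Re_ge0 h0 dV pV) => y _.
by rewrite -conj_real horner_sqr conj_real mul_conj ler0c exprn_ge0 // nrm_ge0.
Qed.

(** The polynomial [(2 h)^2 - 'X^2] is nonnegative on the segment, so [ell] of its product with [p]
    times the conjugate polynomial has nonnegative real part. *)
Lemma form_bound p :
  complex.Re (form ('X * p) ('X * p)) <= (2 * h) ^+ 2 * complex.Re (form p p).
Proof.
rewrite -subr_ge0; pose k : R[i] := ((2 * h) ^+ 2)%:C%C.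
have -> : (2 * h) ^+ 2 * complex.Re (form p p) - complex.Re (form ('X * p) ('X * p))
    = complex.Re (ell ((k%:P - 'X^2) * (p * map_poly Num.conj p))).
  have -> : (k%:P - 'X^2) * (p * map_poly Num.conj p)
      = k *: (p * map_poly Num.conj p) + (- 1) *: ('X^2 * (p * map_poly Num.conj p)).
    by rewrite mulrBl mul_polyC scaleN1r.
  rewrite ellD !ellZ mulN1r ReB ReM Re_real Im_real mul0r subr0.
  by rewrite /form rmorphM /= map_polyX; congr (_ - complex.Re (ell _)); ring.
apply: (ell_Re_ge0 h0 dV pV) => y yh.
rewrite hornerM -{2}conj_real horner_sqr conj_real mul_conj.
rewrite hornerD hornerN hornerC hornerXn -rmorphXn -rmorphB -rmorphM ler0c.
rewrite mulr_ge0 // ?exprn_ge0 ?nrm_ge0 // subr_ge0.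
rewrite -(real_normK (num_real y)) ler_pXn2r ?nnegrE ?ler_norml //.
by rewrite mulr_ge0 // ltW.
Qed.

Section Identification.
Variables (H : hilbertType R) (S : {linear H -> H}) (Phi : {poly R[i]} -> H).
Hypothesis SK : forall x, nrm (S x) <= 2 * h * nrm x.
Hypothesis Ssym : forall x y, inner (S x) y = inner x (S y).
Hypothesis SPhi : forall p, S (Phi p) = Phi ('X * p).
Hypothesis PhiE : forall p, inner (Phi p) (Phi 1) = ell p.
Implicit Types (x y : H).
Let e := Phi 1.
Let f x z := inner (resolvent S z x) e.
Let E x := ext h (f x) (inner x e).

Lemma resolvent_off_segment z : off_segment h z -> resolvent_set S z.
Proof.
have h2 : 0 <= 2 * h by rewrite mulr_ge0 // ltW.
case=> hz; last by case: (resolvent_large SK h2 hz).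
apply: resolvent_symmetric => //; apply/bounded_operatorP.
by exists (2 * h) => //; rewrite mulr_gt0.
Qed.

Lemma cdiff_f x z : off_segment h z -> cdiff (f x) z.
Proof.
move=> /off_segment_open[d d0 hd]; apply: cdiff_resolvent; exists d => // w /hd.
exact: resolvent_off_segment.
Qed.

Lemma f_S x z : off_segment h z -> f (S x) z = inner x e + z * f x z.
Proof.
move=> /resolvent_off_segment rz; rewrite /f.
have -> : resolvent S z (S x) = x + z *: resolvent S z x.
  by rewrite -{1}(subrK (z *: x) (S x)) resolventD // resolventZ // (resolvent_eq rz erefl).
by rewrite innerDl innerZl.
Qed.

Lemma f_asymp x z : 4 * h < nrm z ->
  nrm (z * f x z + inner x e) <= 4 * h * nrm x * nrm e / nrm z.
Proof.
move=> hz; have h2 : 0 <= 2 * h by rewrite mulr_ge0 // ltW.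
have z2 : 2 * h < nrm z by lra.
have [rz bz] := resolvent_large SK h2 z2.
have := resolventK x rz; have := bz x; rewrite /f; move: (resolvent S z x) => y hy yE.
have -> : z * inner y e + inner x e = inner (S y) e.
  by rewrite -yE innerBl innerZl addrC subrK.
apply: (le_trans (cauchy_schwarz _ _)).
have z0 : 0 < nrm z by lra.
rewrite ler_pdivlMr // mulrAC ler_wpM2r ?nrm_ge0 //.
apply: (le_trans (ler_wpM2r (ltW z0) (SK y))).
have yz : nrm z * nrm y <= 2 * nrm x.
  apply: le_trans (ler_wpM2l _ hy) => //.
  rewrite mulrA ler_wpM2r ?nrm_ge0 //; lra.
have := ler_wpM2l h2 yz; lra.
Qed.

Lemma cont_E x : {for 0, continuous (E x)}.
Proof.
apply: (cont_ext h0 _ (@f_asymp x)).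
by rewrite !mulr_ge0 ?nrm_ge0 // ltW.
Qed.

Lemma cdiff_E x w : 0 < nrm w < 1 -> cdiff (E x) w.
Proof. by apply: cdiff_ext => // z; exact: cdiff_f. Qed.

Lemma avg_E x : avg (E x) (1 / 2) = inner x e.
Proof.
have h12 : 0 < (1 / 2 : R) < 1 by apply/andP; split; lra.
rewrite (avg_center h12 (@cont_E x)); first by rewrite /E /ext eqxx.
by move=> z; exact: cdiff_E.
Qed.

(** By induction on [r], each factor ['X] is transferred to [p] through [f_S]; the correction is a
    constant times a polynomial times [kap], whose mean is zero. *)
Lemma avg_E_horner p r : avg (fun w => E (Phi p) w * r.[jouk w]) (1 / 2) = ell (p * r).
Proof.
have h12 : 0 < 1 / 2 :> R by lra.
have cE x := @ccirc_ext (f x) (inner x e) (cdiff_f x).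
have ckap : ccirc kap (1 / 2).
  apply: ccirc_cdiff => [|w w12]; first exact: ltW.
  by apply: cdiff_kap; rewrite -nrm_gt0 w12.
elim/poly_ind: r p => [|r c ih] p.
  have -> : ell (p * 0) = 0 by rewrite mulr0 -(scale0r 0) ellZ mul0r.
  rewrite -[RHS](@avg_cst R 0 (1 / 2)).
  by apply: eq_avg => t _; rewrite horner0 mulr0.
pose F1 w := E (Phi ('X * p)) w * r.[jouk w].
pose F2 w := inner (Phi p) e * (kap w * r.[jouk w]).
pose F3 w := c * E (Phi p) w.
have c1 : ccirc F1 (1 / 2) := ccircM (cE _) (@ccirc_horner_jouk r _ h12).
have c2' := ccircM ckap (@ccirc_horner_jouk r _ h12).
have c2 : ccirc F2 (1 / 2) := ccircM (@ccirc_cst _ _ _) c2'.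
have c3 : ccirc F3 (1 / 2) := ccircM (@ccirc_cst _ c (1 / 2)) (cE (Phi p)).
have -> : avg (fun w => E (Phi p) w * (r * 'X + c%:P).[jouk w]) (1 / 2)
    = avg (fun w => F1 w - F2 w + F3 w) (1 / 2).
  apply: eq_avg => t _; set w := polar _ _.
  have w12 : nrm w = 1 / 2 by rewrite nrm_polar0 // ltW.
  have w0 : w != 0 by rewrite -nrm_gt0 w12.
  rewrite /F1 /F2 /F3 /E /ext (negPf w0) -SPhi f_S.
    by rewrite hornerMXaddC; ring.
  by apply: jouk_off; rewrite // w12; lra.
rewrite (avgD (ccircB c1 c2) c3) (avgB c1 c2) /F1 ih /F2 (avgZ _ c2') avg_kap_horner.
rewrite mulr0 subr0 /F3 (avgZ _ (cE _)) avg_E.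
rewrite PhiE -ellZ -ellD; congr ell.
by rewrite -mul_polyC; ring.
Qed.

(** The difference [G] of the two sides, as a function of [w], is zero at the centre and has zero
    mean against every power of [jouk]; from this all its means against [w ^- n] vanish, so [G = 0].
    The factor [kap w] can be divided out because it vanishes only for [w ^+ 2 = 1]. *)
Lemma resolvent_formula z : complex.Im z != 0 -> V z = inner (resolvent S z e) e.
Proof.
move=> zI; have h12 : 0 < 1 / 2 :> R by lra.
pose G w := ext h V 1 w - E e w.
have dG w : 0 < nrm w < 1 -> cdiff G w.
  by move=> w01; apply: cdiffB; [exact: cdiff_ext|exact: cdiff_E].
have cG : {for 0, continuous G} := contB (cont_ext h0 C0 aV) (@cont_E e).
have G0 : G 0 = 0 by rewrite /G /E /ext eqxx PhiE ell1 subrr.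
have ccG : ccirc G (1 / 2).
  by apply: ccirc_cdiff => [|w w12]; [exact: ltW|apply: dG; rewrite w12; lra].
have mom n : avg (fun w => G w * jouk w ^+ n) (1 / 2) = 0.
  have cj := @ccirc_horner_jouk 'X^n _ h12.
  have c1 := ccircM (@ccirc_ext V 1 dV) cj.
  have c2 := ccircM (@ccirc_ext (f e) (inner e e) (cdiff_f e)) cj.
  have e1 := avg_E_horner 1 'X^n; rewrite (mul1r 'X^n) in e1.
  rewrite -[RHS](subrr (ell 'X^n)) -{2}e1 -(avgB c1 c2).
  by apply: eq_avg => t _; rewrite hornerXn mulrBl.
have pos n : avg (fun w => G w * w ^+ n) (1 / 2) = 0.
  have h121 : 0 < (1 / 2 : R) < 1 by apply/andP; split; lra.
  rewrite (avg_center h121); first by rewrite G0 mul0r.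
    exact: (contM cG (cdiff_cont (cdiffX n (cdiff_id 0)))).
  by move=> w w01; apply: cdiffM; [exact: dG|apply: cdiffX; exact: cdiff_id].
have cwn (i j : nat) : ccirc (fun w => G w * (w ^+ i * w ^- j)) (1 / 2).
  have cX : ccirc (fun w : R[i] => w ^+ i) (1 / 2).
    by move=> t _; apply/cdiff_cont/cdiffX/cdiff_id.
  have cXV : ccirc (fun w : R[i] => w ^+ i * w ^- j) (1 / 2).
    exact: (ccircM cX (@ccirc_invX R j _ h12)).
  exact: (ccircM ccG cXV).
(* In the binomial expansion of [jouk w ^+ n] the exponents are [n - 2 i]: [i = n] is the term
   wanted, a nonnegative exponent falls under [pos], and the other negative ones under the induction
   hypothesis. *)
have neg n : avg (fun w => G w * w ^- n) (1 / 2) = 0.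
  elim/ltn_ind: n => n ih.
  have hn : h%:C%C ^+ n != 0 :> R[i] by rewrite expf_neq0 // fmorph_eq0 gt_eqF.
  pose T i w := (h%:C%C ^+ n * 'C(n, i)%:R) * (G w * (w ^+ (n - i) * w ^- i)).
  have cT (i : 'I_n.+1) : ccirc (T i) (1 / 2) := ccircM (@ccirc_cst _ _ _) (cwn (n - i)%N i).
  have : \sum_(i < n.+1) avg (T i) (1 / 2) = 0.
    rewrite -(avg_sum _ cT) -[RHS](mom n); apply: eq_avg => t _; set w := polar _ _.
    rewrite /jouk exprMn exprDn mulr_sumr mulr_sumr; apply: eq_bigr => i _.
    by rewrite /T exprVn -mulr_natl; ring.
  rewrite big_ord_recr big1 /= => [|i _].
    rewrite add0r /T (avgZ _ (cwn _ _)) binn (mulr1 (_ ^+ n)) => /eqP.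
    rewrite mulf_eq0 (negPf hn) /= => /eqP <-.
    by apply: eq_avg => t _; rewrite subnn expr0 (mul1r (_ ^- n)).
  rewrite /T (avgZ _ (cwn _ _)); apply/eqP; rewrite mulf_eq0; apply/orP; right; apply/eqP.
  have [ni|ni] := leqP i (n - i).
    rewrite -[RHS](pos (n - i - i)%N); apply: eq_avg => t _; set w := polar _ _.
    have w0 : w != 0 by rewrite -nrm_gt0 nrm_polar0 // ltW.
    by congr (_ * _); rewrite -{1}(subnK ni) exprD mulfK // expf_neq0.
  rewrite -[RHS](ih (i - (n - i))%N) => [|]; last first.
    by rewrite (leq_ltn_trans (leq_subr _ _)).
  apply: eq_avg => t _; set w := polar _ _.
  have w0 : w != 0 by rewrite -nrm_gt0 nrm_polar0 // ltW.
  congr (_ * _); rewrite -[X in _ / w ^+ X](subnK (ltnW ni)) exprD.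
  by field; rewrite !expf_neq0.
have coef (n : nat) (x : R) : 0 < x < 1 -> avg (fun w => G w * w ^- n) x = 0.
  move=> /andP[x0 x1]; rewrite -[RHS](neg n).
  have dn w : 0 < nrm w < 1 -> cdiff (fun w => G w * w ^- n) w.
    move=> w01; apply: cdiffM; first exact: dG.
    by apply: cdiff_invX; rewrite -nrm_gt0; case/andP: w01.
  have [x2|x2] := leP x (1 / 2).
    by apply: avg_const => [|w hw]; [rewrite x0|apply: dn; lra].
  by apply/esym; apply: avg_const => [|w hw]; [rewrite ltW // andbT|apply: dn; lra].
have [w w01 jw] := jouk_surj h0 zI.
have w0 : w != 0 by rewrite -nrm_gt0; case/andP: w01.
have /andP[_ w1] := w01; have := holo_coef_eq0 cG G0 dG coef w1.
rewrite /G /E /ext (negPf w0) jw -mulrBl => /eqP; rewrite mulf_eq0 subr_eq0.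
case/orP => /eqP // k0; exfalso.
have hn : h%:C%C != 0 :> R[i] by rewrite fmorph_eq0 gt_eqF.
move: k0 => /eqP; rewrite /kap mulf_eq0 (negPf hn) /= subr_eq0 => /eqP wV.
have : w ^+ 2 = 1 by rewrite expr2 {2}wV mulfV.
move=> /(congr1 (@nrm _ _)); rewrite nrmX nrm1 => /eqP; rewrite lt_eqF //.
by rewrite exprn_ilt1 // ?nrm_ge0 //; case/andP: w01.
Qed.

End Identification.
End Spectral.

(** * Construction of the dissipative operator *)

Section HerglotzToWeyl.
Context {R : realType}.
Implicit Types (z w c : R[i]) (p q r : {poly R[i]}).

(** Cyclicity of [e] is recorded in the form in which primeness uses it: an [S]-invariant set
    orthogonal to [e] contains no nonzero vector. *)
Lemma herglotz_resolvent V (c d C r0 : R) : herglotz_nevanlinna V ->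
  holomorphic_on (~` real_segment c d) V -> 0 <= C ->
  (forall z, r0 < nrm z -> nrm (z * V z + 1) <= C / nrm z) ->
  exists (P : pred nat) (S : {linear @l2 R P -> @l2 R P}) (e : @l2 R P),
  [/\ bounded_operator S, forall x y, inner (S x) y = inner x (S y), inner e e = 1,
      forall T : set (@l2 R P), invariant_subspace S T ->
        (forall x, T x -> inner x e = 0) -> forall x, T x -> x = 0 &
      forall z, complex.Im z != 0 -> V z = inner (resolvent S z e) e].
Proof.
move=> HN dV C0 aV; have [_ sV pV] := HN.
pose h := `|c| + `|d| + 1.
have [c0 d0] : 0 <= `|c| /\ 0 <= `|d| by split; exact: normr_ge0.
have h0 : 0 < h by rewrite /h; lra.
have dV' z : off_segment h z -> cdiff V z.
  move=> hz; apply/derivable_cdiff/dV => -[t]; rewrite /= in_itv /= => /andP[ct td] tz.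
  case: hz; first by rewrite -tz Im_real eqxx.
  rewrite -tz nrm_real; have : `|t| <= `|c| + `|d|.
    rewrite ler_norml; apply/andP; split.
      have := ler_norm (- c); rewrite normrN; lra.
    have := ler_norm d; lra.
  by rewrite /h; lra.
have sV' z : complex.Im z != 0 -> V z = (V z^*)^*.
  by move=> hz; apply: sV; rewrite ImC_neq0.
have pV' z : complex.Im z != 0 -> 0 <= complex.Im (V z) * complex.Im z.
  move=> hz; have := pV z; rewrite ImC_neq0 hz Im_ratio => /(_ isT); rewrite ler0c.
  move=> hr; have -> : complex.Im (V z) * complex.Im z
      = complex.Im (V z) / complex.Im z * complex.Im z ^+ 2.
    by rewrite expr2 mulrA divfK.
  by rewrite mulr_ge0 // sqr_ge0.
have h2 : 0 < 2 * h by rewrite mulr_gt0.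
have fb := form_bound h0 dV' pV'.
have [P [Phi [S [PhiP SPhi SK Ssym Phi0]]]] := cyclic_model
  (formDl h0 dV') (formZl h0 dV') (form_herm h0 dV' sV')
  (form_ge0 h0 dV' sV' pV') (form_X h V) h2 fb.
exists P, S, (Phi 1).
have PhiE p : inner (Phi p) (Phi 1) = ell h V p.
  by rewrite PhiP /form rmorph1 mulr1.
have PhiX p a : Phi (p * 'X + a%:P) = S (Phi p) + a *: Phi 1.
  apply/eqP; rewrite -subr_eq0; apply/eqP; apply: Phi0 => q.
  rewrite innerBl innerDl innerZl SPhi !PhiP (formDl h0 dV') -(formZl h0 dV') -mul_polyC mulr1.
  by rewrite (mulrC p) subrr.
split.
- by apply/bounded_operatorP; exists (2 * h).
- exact: Ssym.
- by rewrite PhiE (ell1 h0 dV' C0 aV).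
(* The induction is on [p] for all [x] in [T]: symmetry transfers one factor [S] from [Phi] to [x],
   and [S x] is again in [T]. *)
- move=> T TS Te x Tx; apply: (Phi0 x) => p; elim/poly_ind: p x Tx => [|p a ih] x Tx.
    by rewrite (_ : Phi 0 = 0) ?inner0r //; apply: Phi0 => q; rewrite PhiP -(scale0r 0) (formZl h0 dV') mul0r.
  by rewrite PhiX innerDr innerZr -Ssym ih ?(Te x) ?mulr0 ?addr0 //; exact: TS.
- move=> z; exact: (resolvent_formula h0 dV' C0 aV SK Ssym SPhi PhiE).
Qed.

Section RankOnePerturbation.
Variables (H : hilbertType R) (S A : {linear H -> H}) (e : H) (k : R).
Hypothesis bS : bounded_operator S.
Hypothesis Ssym : forall x y, inner (S x) y = inner x (S y).
Hypothesis e1 : inner e e = 1.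
Hypothesis cyc : forall T : set H, invariant_subspace S T ->
  (forall x, T x -> inner x e = 0) -> forall x, T x -> x = 0.
Hypothesis k0 : 0 < k.
Hypothesis AE : forall x, A x = S x + ('i * k%:C%C * inner x e) *: e.

Lemma nrm_e : nrm e = 1.
Proof.
have := inner_nrm e; rewrite e1 => /(congr1 (@complex.Re R)) /= h.
by apply/eqP; rewrite -(@eqrXn2 _ 2) ?nrm_ge0 // expr1n -h.
Qed.

Lemma perturbation_bounded : bounded_operator A.
Proof.
have [K K0 hK] := iffLR (bounded_operatorP S) bS.
apply/bounded_operatorP; exists (K + k) => [|x]; first by rewrite addr_gt0.
rewrite AE mulrDl (le_trans (nrmD _ _)) // lerD //.
rewrite nrmZ !nrmM nrm_i mul1r nrm_real (gtr0_norm k0) nrm_e mulr1 ler_wpM2l ?(ltW k0) //.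
by have := cauchy_schwarz x e; rewrite nrm_e mulr1.
Qed.

Lemma perturbation_imag_part x : imag_part A x = (k%:C%C * inner x e) *: e.
Proof.
apply: inner_ext => y; rewrite -inner_conj -[RHS]inner_conj; congr (_^*).
apply: (mulfI (@two_i_neq0 R)).
rewrite -(imag_partE perturbation_bounded) !AE innerDl innerDr innerZl innerZr innerZl Ssym.
rewrite !rmorphM /= conjCi conj_real inner_conj; ring.
Qed.

Lemma perturbation_dissipative : dissipative A.
Proof.
move=> x; rewrite perturbation_imag_part innerZl -(inner_conj x e) -mulrA mul_conj.
by rewrite -rmorphM ler0c mulr_ge0 ?exprn_ge0 ?nrm_ge0 // ltW.
Qed.

Lemma perturbation_rank_one : rank_one (imag_part A).
Proof.
have kn : k%:C%C != 0 :> R[i] by rewrite fmorph_eq0 gt_eqF.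
exists e; first by rewrite -nrm_gt0 nrm_e.
apply/seteqP; split=> [_ [x _ <-]|_ [a _ <-]].
  by rewrite perturbation_imag_part; exists (k%:C%C * inner x e).
exists ((a / k%:C%C) *: e) => //; rewrite perturbation_imag_part innerZl e1 mulr1.
by rewrite mulrC divfK.
Qed.

(** Where [A] is self-adjoint, the form of its imaginary part, [k] times [nrm (inner x e) ^+ 2],
    vanishes. The subspace is therefore orthogonal to [e], and on it [A] coincides with [S]. *)
Lemma perturbation_prime : prime_operator A.
Proof.
move=> [N [[[_ N0 _] NA _] nN0 saN]]; apply: nN0.
have Ne x : N x -> inner x e = 0.
  move=> Nx; have := imag_partE perturbation_bounded x x.
  rewrite saN // subrr => /esym/eqP; rewrite mulf_eq0 (negPf (@two_i_neq0 R)) /=.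
  rewrite perturbation_imag_part innerZl -(inner_conj x e) -mulrA mul_conj -rmorphM.
  rewrite fmorph_eq0 mulf_eq0 gt_eqF //= expf_eq0 /= => /eqP; exact: nrm0_eq0.
have NS : invariant_subspace S N.
  by move=> x Nx; have := NA x Nx; rewrite AE Ne // mulr0 scale0r addr0.
by apply/seteqP; split => [x /(cyc NS Ne) ->|_ ->].
Qed.

Lemma perturbation_range : exists x, e = A x - adjoint A x.
Proof.
have kn : k%:C%C != 0 :> R[i] by rewrite fmorph_eq0 gt_eqF.
exists ((2 * 'i * k%:C%C)^-1 *: e); rewrite adjoint_sub perturbation_imag_part innerZl e1 mulr1.
rewrite scalerA mulrA mulfV ?scale1r // mulf_neq0 // two_i_neq0 //.
Qed.

Lemma perturbation_weyl z : complex.Im z != 0 -> resolvent_set A z ->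
  weyl_function A e z * (1 + 'i * k%:C%C * inner (resolvent S z e) e)
    = inner (resolvent S z e) e.
Proof.
move=> zI rA; have rS := resolvent_symmetric bS Ssym zI.
rewrite /weyl_function; have := resolventK e rA; rewrite AE.
set y := resolvent A z e => yE.
have yS : S y - z *: y = (1 - 'i * k%:C%C * inner y e) *: e.
  by rewrite scalerBl scale1r -{1}yE addrAC addrK.
have : inner y e = (1 - 'i * k%:C%C * inner y e) * inner (resolvent S z e) e.
  by rewrite -innerZl -resolventZ // -yS (resolvent_eq rS erefl).
by move: (inner y e) (inner _ e) => m v h; rewrite mulrDr mulr1 {1}h; ring.
Qed.

End RankOnePerturbation.

(** [z Q + 1] equals [('i (z M + 1) + k M) / ('i + k M)]: both terms of the numerator are of order
    [1 / z], and the denominator stays away from 0. *)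
Lemma cayley_asymp M b : expansion_at_infinity M b -> 0 < complex.Im b ->
  exists C r : R, [/\ 0 < C, 0 < r & forall z, r < nrm z ->
    nrm (z * ('i * M z / ('i + 'Im b * M z)) + 1) <= C / nrm z].
Proof.
move=> eM; rewrite ImC_real; set k := complex.Im b => k0.
have [K [r1 [r10 K0 hK]]] := iffLR (expansionP M b) eM.
have [|r2 r20 hr2] := expansion_asymp eM (e := 1); first lra.
have nb := nrm_ge0 b.
exists (2 * (nrm b + K + 2 * k)), (r1 + r2 + 1 + 4 * k); split; [lra|lra|] => z hz.
have z1 : 1 < nrm z by lra.
have z0 : 0 < nrm z by lra.
have zn : z != 0 by rewrite -nrm_gt0.
have h1 : nrm (z * M z + 1) <= (nrm b + K) / nrm z.
  have := hK z ltac:(lra); set rho := M z - _ => hrho.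
  have -> : z * M z + 1 = - b / z + z * rho by rewrite /rho; field.
  rewrite (le_trans (nrmD _ _)) // mulrDl !nrmM nrmN nrmV lerD2l.
  apply: (le_trans (ler_wpM2l (ltW z0) hrho)).
  have -> : nrm z * (K / nrm z ^+ 3) = K / nrm z * (nrm z)^-1 by field; rewrite gt_eqF.
  by rewrite ler_piMr ?divr_ge0 ?(ltW K0) ?(ltW z0) // invf_le1 // ltW.
have h2 : nrm (M z) <= 2 / nrm z.
  rewrite ler_pdivlMr // mulrC -nrmM.
  have := hr2 z ltac:(lra); have := nrmB (z * M z + 1) 1; rewrite addrK nrm1; lra.
have h3 : nrm (k%:C%C * M z) <= 2 * k / nrm z.
  by rewrite nrmM nrm_real (gtr0_norm k0) -mulrA mulrCA ler_wpM2l ?(ltW k0) //.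
have h4 : 1 / 2 <= nrm ('i + k%:C%C * M z).
  have := nrm_ler_distB ('i : R[i]) (- (k%:C%C * M z)); rewrite opprK nrmN nrm_i.
  have h5 : 2 * k / nrm z <= 1 / 2 by rewrite ler_pdivrMr //; lra.
  by move=> h6; apply: le_trans h6; have := le_trans h3 h5; lra.
have dn : 'i + k%:C%C * M z != 0 by rewrite -nrm_gt0; lra.
have -> : z * ('i * M z / ('i + k%:C%C * M z)) + 1
    = ('i * (z * M z + 1) + k%:C%C * M z) / ('i + k%:C%C * M z) by field.
rewrite nrmM nrmV ler_pdivrMr; last lra.
apply: (le_trans (nrmD _ _)); rewrite (nrmM 'i) nrm_i mul1r.
have h5 : 0 <= (nrm b + K + 2 * k) / nrm z by rewrite divr_ge0 //; lra.
have h6 : nrm (z * M z + 1) + nrm (k%:C%C * M z) <= (nrm b + K + 2 * k) / nrm z.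
  by rewrite mulrDl lerD.
apply: (le_trans h6); rewrite -[2 * _ / _]mulrA mulrAC.
by rewrite ler_peMl //; lra.
Qed.

Lemma herglotz_to_weyl (D : set R[i]) (M : R[i] -> R[i]) b : bounded_set D ->
  (forall z, D z -> 0 <= 'Im z) -> holomorphic_on (~` D) M ->
  expansion_at_infinity M b -> 0 < 'Im b ->
  has_HN_continuation (~` D) [set z | 'i + 'Im b * M z != 0]
    (fun z => 'i * M z / ('i + 'Im b * M z)) ->
  exists (H : hilbertType R) (A : {linear H -> H}),
      [/\ separable H, bounded_operator A, prime_operator A, dissipative A &
          rank_one (imag_part A)] /\
      is_weyl_function (~` D) M A.
Proof.
move=> bD Dup hM eM; rewrite ImC_real ltcR => k0 [c [d [V [cd HN dV VE]]]].
have [C [r [C0 r0 hC]]] := cayley_asymp eM k0.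
rewrite ImC_real in hC; set k := complex.Im b in k0 VE hC *.
have [r1 r10 hr1] := bounded_set_nrm bD.
pose r2 := r + r1 + `|c| + `|d|.
have aV z : r2 < nrm z -> nrm (z * V z + 1) <= C / nrm z.
  rewrite /r2 => hz; have := normr_ge0 c; have := normr_ge0 d => d0 c0.
  have [||_ ->] := VE z; [by apply: hr1; lra| |by apply: hC; lra].
  move=> [t]; rewrite /= in_itv /= => /andP[ct td] tz; move: hz; rewrite -tz nrm_real.
  have : `|t| <= `|c| + `|d|.
    rewrite ler_norml; apply/andP; split.
      have := ler_norm (- c); rewrite normrN; lra.
    have := ler_norm d; lra.
  lra.
have [P [S [e [bS Ssym e1 cyc VS]]]] := herglotz_resolvent HN dV (ltW C0) aV.
pose A0 x := S x + ('i * k%:C%C * inner x e) *: e.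
have lA : linear A0.
  move=> a x y; rewrite /A0 linearP innerDl innerZl mulrDr scalerDl scalerDr.
  by rewrite [_ * (a * _)]mulrCA addrACA scalerA.
pose A : {linear @l2 R P -> @l2 R P} := HB.pack A0 (GRing.isLinear.Build _ _ _ *:%R A0 lA).
have AE x : A x = S x + ('i * k%:C%C * inner x e) *: e by [].
clearbody A.
have bA := perturbation_bounded bS e1 k0 AE.
have dA := perturbation_dissipative bS Ssym e1 k0 AE.
exists (@l2 R P), A; split.
  split => //; [exact: l2_separable|exact: (perturbation_prime bS Ssym e1 cyc k0 AE)|].
  exact: (perturbation_rank_one bS Ssym e1 k0 AE).
exists e; split; first exact: (perturbation_range bS Ssym e1 k0 AE).
  by rewrite normE (nrm_e e1).
(* At nonreal points the agreement is algebraic: [Q = 'i M / ('i + k M)] inverts to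
   [M = Q / (1 + 'i k Q)], which is the relation of [perturbation_weyl]. *)
have nonreal z : complex.Im z != 0 -> ~ D z -> resolvent_set A z ->
    M z = weyl_function A e z.
  move=> zI Dz rA; have [dn] := VE z Dz (real_segment_Im zI).
  rewrite (VS z zI); have := perturbation_weyl bS Ssym AE zI rA.
  move: (inner _ e) (weyl_function A e z) => v m mv vM.
  have Mv : M z * (1 + 'i * k%:C%C * v) = v.
    have vM' : v * ('i + k%:C%C * M z) = 'i * M z by rewrite vM divfK.
    apply: (mulfI (neq0Ci _)).
    have -> : 'i * (M z * (1 + 'i * k%:C%C * v)) = 'i * M z + 'i ^+ 2 * k%:C%C * v * M z by ring.
    by rewrite sqrCi -vM'; ring.
  have n0 : 1 + 'i * k%:C%C * v != 0.
    apply/eqP => h; move: Mv; rewrite h mulr0 => v0; move: h; rewrite -v0 mulr0 addr0.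
    exact/eqP/oner_neq0.
  by apply: (mulIf n0); rewrite Mv mv.
(* A real resolvent point is approached from below, where every point is outside [D] and, by
   dissipativity, in the resolvent set. *)
move=> z Dz rA; have [zI|zI] := eqVneq (complex.Im z) 0; last exact: nonreal.
apply/eqP; rewrite -subr_eq0; apply/eqP; apply: nrm_le_eps => t t0.
have cM : {for z, continuous M} by apply/cdiff_cont/derivable_cdiff/hM.
have t2 : 0 < t / 2 by lra.
have [d1 d10 hd1] := iffLR (ccontP _ _) cM _ t2.
have [L [d2 [d20 L0 hd2]]] := resolvent_lipschitz e e rA.
pose s := Num.min (d1 / 2) (Num.min (d2 / 2) (t / 2 / (L + 1))).
have [s1 s2 s3] : [/\ s <= d1 / 2, s <= d2 / 2 & s <= t / 2 / (L + 1)].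
  by rewrite /s; split; rewrite !ge_min lexx ?orbT.
have s0 : 0 < s.
  by rewrite !lt_min; apply/and3P; split; [lra|lra|rewrite divr_gt0 //; lra].
clearbody s; pose w := z - 'i * s%:C%C.
have wI : complex.Im w = - s by rewrite /w !ReImE zI /=; ring.
have wz : nrm (w - z) = s.
  by rewrite /w addrAC subrr sub0r nrmN nrmM nrm_i mul1r nrm_real gtr0_norm.
have Dw : ~ D w by move=> /Dup; rewrite ImC_real ler0c wI; lra.
have rw : resolvent_set A w.
  apply: resolvent_dissipative => //; first exact: dissipativeP.
  by rewrite wI; lra.
have Mw : M w = weyl_function A e w by apply: nonreal => //; rewrite wI; lra.
have h1 : nrm (M w - M z) < t / 2 by apply: hd1; rewrite wz; lra.
have h2 : nrm (weyl_function A e w - weyl_function A e z) <= t / 2.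
  apply: le_trans (hd2 w rw _) _; first by rewrite wz; lra.
  rewrite wz; move: s3; rewrite ler_pdivlMr; last lra.
  by apply: le_trans; rewrite mulrC ler_wpM2l ?(ltW s0) //; lra.
have := nrmB (weyl_function A e w - weyl_function A e z) (M w - M z).
have -> : weyl_function A e w - weyl_function A e z - (M w - M z)
    = M z - weyl_function A e z by rewrite Mw; ring.
lra.
Qed.

End HerglotzToWeyl.

Section Equivalence.
Context {R : realType}.
Lemma kernel_to_herglotz_Im (D : set R[i]) (M : R[i] -> R[i]) (b : R[i]) :
  bounded_set D -> (forall z, D z -> 0 <= 'Im z) -> holomorphic_on (~` D) M ->
  expansion_at_infinity M b -> 0 < 'Im b ->
  nonnegative_kernel
          [set p : R[i] * R[i] | [/\ ~ D p.1, ~ D p.2 & p.1 - p.2^* != 0]]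
          (fun z xi =>
             (M z - (M xi)^* + 2%:R * 'i * 'Im b * M z * (M xi)^*)
               / (z - xi^*)) ->
  has_HN_continuation (~` D) [set z | M z != 0] (fun z => - (M z)^-1 + b).
Proof.
move=> bD Dup hM eM; rewrite ImC_real => _ psd.
exact: (kernel_to_herglotz psd Dup erefl eM hM bD).
Qed.
End Equivalence.
Theorem theorem2p10 (R : realType) (M : R[i] -> R[i]) (D : set R[i])
    (closedD : closed D) (boundedD : bounded_set D)
    (D_upper : forall z : R[i], D z -> 0 <= 'Im z)
    (holM : holomorphic_on (~` D) M) :
  [<->
    (* (i) *)
    exists (H : hilbertType R) (A : {linear H -> H}),
      [/\ separable H, bounded_operator A, prime_operator A, dissipative A &
          rank_one (imag_part A)] /\
      is_weyl_function (~` D) M A ;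
    (* (ii) *)
    exists b : R[i],
      [/\ expansion_at_infinity M b, 0 < 'Im b &
        exists (H : hilbertType R) (A : {linear H -> H}),
          [/\ separable H, bounded_operator A, dissipative A &
              rank_one (imag_part A)] /\
          is_char_function (~` D) (fun z => 1 - 2%:R * 'i * 'Im b * M z) A] ;
    (* (iii) *)
    exists b : R[i],
      [/\ expansion_at_infinity M b, 0 < 'Im b &
        nonnegative_kernel
          [set p : R[i] * R[i] | [/\ ~ D p.1, ~ D p.2 & p.1 - p.2^* != 0]]
          (fun z xi =>
             (M z - (M xi)^* + 2%:R * 'i * 'Im b * M z * (M xi)^*)
               / (z - xi^*))] ;
    (* (iv) *)
    exists b : R[i],
      [/\ expansion_at_infinity M b, 0 < 'Im b &
        has_HN_continuation (~` D)
          [set z | 'i + 'Im b * M z != 0]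
          (fun z => 'i * M z / ('i + 'Im b * M z))] ;
    (* (v) *)
    exists b : R[i],
      [/\ expansion_at_infinity M b, 0 < 'Im b &
        has_HN_continuation (~` D)
          [set z | M z != 0]
          (fun z => - (M z)^-1 + b)]
  ].
Proof.
have i_ii := @weyl_to_char R D M boundedD.
have ii_iii := @char_to_kernel R D M closedD holM.
have iii_v b := @kernel_to_herglotz_Im R D M b boundedD D_upper holM.
have v_iv b := @herglotz_transform R D M b boundedD holM.
have iv_i b := @herglotz_to_weyl R D M b boundedD D_upper holM.
tfae => //.
- move=> [b [eM b0 psd]]; exists b; split=> //.
  by apply: v_iv => //; exact: iii_v.
(* From (iv) to (v) by way of (i), (ii) and (iii); [b'] is the constant supplied by (ii). *)
- move=> [b [eM b0 hQ]].
  have /i_ii/ii_iii[b' [eM' b0' psd]] := iv_i b eM b0 hQ.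
  by exists b'; split=> //; exact: iii_v.
- move=> [b [eM b0 hQ]]; apply: (iv_i b) => //; exact: v_iv.
Qed.
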